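(* Let $a$ be a quasi-primary vector, of conformal weight $d_a$, of a simple energy-bounded unitary vertex operator superalgebra $V$. Define the operator $K:=i\pi\overline{(L_1-L_{-1})}$ and let $f\in C_c^\infty(S^1\setminus\{-1\})$ with $\mathrm{supp}f\subset S^1_+$. Then $Y(a,f)\Omega$ is in the domain of the operator $e^{\frac{K}{2}}$ and $$e^{\frac{K}{2}}Y(a,f)\Omega=i^{2d_a}Y(a,f\circ j)\Omega,$$ where $j(z)=\overline z=z^{-1}$ for all $z\in S^1$.
   Context: **VOSA.** A vertex operator superalgebra (VOSA) $V=(V,\Omega,T,Y,\nu)$ consists of a complex vector superspace $V=V_{\bar 0}\oplus V_{\bar 1}$, an even vector $\Omega$ (vacuum), an even endomorphism $T$, and a linear parity-preserving map $a\mapsto Y(a,z)=\sum_{n\in\mathbb{Z}}a_{(n)}z^{-n-1}\in \mathrm{End}(V)[[z,z^{-1}]]$ such that for all $a,b$: $a_{(n)}b=0$ for $n$ large; $[T,Y(a,z)]=\frac{d}{dz}Y(a,z)$; $Y(\Omega,z)=1_V$, $T\Omega=0$, $a_{(-1)}\Omega=a$; $(z-w)^N[Y(a,z),Y(b,w)]=0$ for $N$ large (graded commutator); together with an even vector $\nu$ (conformal vector) such that $L_n:=\nu_{(n+1)}$ satisfy the Virasoro relations with some central charge $c$, $L_{-1}=T$, $L_0$ is diagonalizable with eigenspaces $V_n=\ker(L_0-n)$, $V_{\bar0}=\bigoplus_{n\in\mathbb{Z}}V_n$, $V_{\bar1}=\bigoplus_{n\in\mathbb{Z}-\frac12}V_n$,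 $\dim V_n<\infty$, $V_n=0$ for $n$ sufficiently negative. A non-zero $a\in V_{d_a}$ is homogeneous of conformal weight $d_a$, and $a_n:=a_{(n+d_a-1)}$ for $n\in\mathbb{Z}-d_a$, $a_n:=0$ for the other $n\in\frac12\mathbb{Z}$; extended to all $a\in V$ by linearity. A homogeneous $a$ with $L_1a=0$ is quasi-primary. $V$ is simple if its only ideals ($T$-invariant subspaces $\mathscr{J}$ with $a_{(n)}\mathscr{J}\subseteq \mathscr{J}$ for all $a\in V,n\in\mathbb{Z}$) are $0$ and $V$. **Unitary VOSA.** A VOSA with a scalar product $(\cdot|\cdot)$ (positive-definite Hermitian, linear in the second variable), $(\Omega|\Omega)=1$, and an antilinear bijection $\theta$ of $V$ preserving $(n)$-products, $\Omega$, $\nu$, with $\theta^2=1$, such that $(Y(\theta(a),z)b|c)=(b|Y(e^{zL_1}(-1)^{2L_0^2+L_0}z^{-2L_0}a,z^{-1})c)$ for all $a,b,c\in V$. $\mathcal{H}$ denotes the Hilbert space completion of $V$. The operator $i(L_1-L_{-1})$ with domain $V$ is essentially self-adjoint on $\mathcal{H}$, so $K$ is self-adjoint (the bar denotes closure) and $e^{K/2}$ is defined by functional calculus. **Energy bounds and smeared vertex operators.** $V$ is energy-bounded if for every $a\in V$ there are $M,s,k\ge 0$ with $\|a_nb\|\le M(|n|+1)^s\|(L_0+1)^kb\|$ for all $n\in\frac12\mathbb{Z}$, $b\in V$. $C_c^\infty(S^1\setminus\{-1\})$ is the space of smooth complex functions with compact support in $S^1\setminus\{-1\}$ (extended by $0$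 to $S^1$), and $\widehat f_n=\frac1{2\pi}\int_{-\pi}^{\pi}f(e^{ix})e^{-inx}dx$ for $n\in\frac12\mathbb{Z}$. For homogeneous $a\in V_{d_a}$ and $f\in C_c^\infty(S^1\setminus\{-1\})$, $Y(a,f)$ is the closure on $\mathcal{H}$ of the operator with domain $V$, $c\mapsto\sum_{n\in\mathbb{Z}-d_a}\widehat f_na_nc$. $S^1_+=\{z\in S^1:\mathrm{Im}\,z>0\}$ is the open upper semicircle. *)

(* Defs.v *)
From HB Require Import structures.
From mathcomp Require Import all_boot all_order all_algebra.
From mathcomp Require Import all_classical all_reals all_analysis.
From mathcomp Require Import complex.

Set Implicit Arguments.
Unset Strict Implicit.
Unset Printing Implicit Defensive.

Import Order.TTheory GRing.Theory Num.Theory.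
Import numFieldNormedType.Exports.

Local Open Scope classical_set_scope.
Local Open Scope ring_scope.
Local Open Scope complex_scope.

(* Half-integers n are encoded throughout by the integer k = 2n. *)
Definition half {F : fieldType} (k : int) : F := k%:~R / 2.

Definition zodd (k : int) : bool := odd `|k|%N.

Record vosaData (R : realType) := VosaData {
  vcar :> lmodType R[i];
  vpar : bool -> set vcar;              (* vpar false = even, vpar true = odd *)
  vvac : vcar;
  vT : vcar -> vcar;
  vprod : vcar -> int -> vcar -> vcar;  (* vprod a n b = a_(n) b *)
  vnu : vcar
}.

Section VOSA.
Variables (R : realType) (V : vosaData R).
Local Notation C := R[i].

Definition vir (n : int) : V -> V := vprod (vnu V) (n + 1).

(* vhom k = ker (L_0 - k/2); it contains 0 *)
Definition vhom (k : int) : set V := [set v | vir 0 v = half k *: v].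

Definition subspace (J : set V) : Prop :=
  J 0 /\ forall (c : C) u v, J u -> J v -> J (c *: u + v).

(* s lists homogeneous vectors (with their doubled weights) adding up to v *)
Definition decomposition (v : V) (s : seq (int * V)) : Prop :=
  (forall p, p \in s -> vhom p.1 p.2) /\ v = \sum_(p <- s) p.2.

(* coefficient of z^(-m-1) w^(-n-1) in (z-w)^N [Y(a,z), Y(b,w)] c,
   for a of parity p and b of parity q *)
Definition locality_coef (N : nat) (p q : bool) (a b : V) (m n : int) (c : V)
    : V :=
  \sum_(j < N.+1) ((-1) ^+ j * 'C(N, j)%:R : C) *:
    (vprod a (m + N%:Z - j%:Z) (vprod b (n + j%:Z) c)
     - ((-1) ^+ (p && q) : C) *:
       vprod b (n + j%:Z) (vprod a (m + N%:Z - j%:Z) c)).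

Record vosa_axioms : Prop := VosaAxioms {
  par_subspace : forall p, subspace (@vpar R V p);
  par_direct : forall v : V, exists! u : V * V,
    [/\ vpar false u.1, vpar true u.2 & v = u.1 + u.2];
  vac_even : vpar false (vvac V);
  T_linear : linear (@vT R V);
  T_even : forall p v, vpar p v -> vpar p (@vT R V v);
  prod_linearl : forall n (b : V), linear (fun a : V => vprod a n b);
  prod_linearr : forall (a : V) n, linear (vprod a n);
  prod_par : forall p q (a b : V) n,
    vpar p a -> vpar q b -> vpar (p (+) q) (vprod a n b);
  prod_trunc : forall a b : V,
    exists N : int, forall n, N <= n -> vprod a n b = 0;
  T_cov : forall (a : V) n (b : V),
    vT (vprod a n b) - vprod a n (vT b) = - n%:~R *: vprod a (n - 1) b;
  vac_prod : forall n (b : V),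
    vprod (vvac V) n b = if n == -1 then b else 0;
  T_vac : vT (vvac V) = 0;
  prod_vac : forall a : V, vprod a (-1) (vvac V) = a;
  locality : forall p q (a b : V), vpar p a -> vpar q b ->
    exists N0 : nat, forall N : nat, (N0 <= N)%N ->
    forall m n c, locality_coef N p q a b m n c = 0;
  nu_even : vpar false (vnu V);
  virasoro : exists cc : C, forall m n v,
    vir m (vir n v) - vir n (vir m v) =
    (m - n)%:~R *: vir (m + n) v
    + (if m + n == 0 then (cc / 12 * (m ^+ 3 - m)%:~R) *: v else 0);
  vir_T : forall v, vir (-1) v = vT v;
  (* V_even and V_odd are the sums of the integer, resp. half-odd-integer,
     eigenspaces of L_0; together with par_direct this makes L_0
     diagonalizable *)
  par_weights : forall p v, vpar p v <->
    exists s, decomposition v s /\ forall x, x \in s -> zodd x.1 = p;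
  weight_fin_dim : forall k, exists s : seq V, forall v, vhom k v ->
    exists c : nat -> C, v = \sum_(i < size s) c i *: s`_i;
  weight_lbound : exists N : int, forall k, k <= N ->
    forall v, vhom k v -> v = 0
}.

Definition ideal (J : set V) : Prop :=
  [/\ subspace J, forall v, J v -> J (vT v)
    & forall a n v, J v -> J (vprod a n v)].

Definition simple_vosa : Prop :=
  forall J, ideal J -> J = [set 0] \/ J = setT.

(* a_{k/2} b for a in vhom d : the index k/2 + d/2 - 1 must be an integer *)
Definition hmode (d : int) (a : V) (k : int) (b : V) : V :=
  if zodd (k + d) then 0 else vprod a (((k + d) %/ 2)%Z - 1) b.

Definition homogeneous (d : int) (a : V) : Prop := a != 0 /\ vhom d a.

Definition quasi_primary (d : int) (a : V) : Prop :=
  homogeneous d a /\ vir 1 a = 0.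

(* A chosen decomposition; the definitions below do not depend on it. *)
Definition decomp (v : V) : seq (int * V) :=
  xget [::] [set s | decomposition v s].

Definition mode (a : V) (k : int) (b : V) : V :=
  \sum_(p <- decomp a) hmode p.1 p.2 k b.

(* (L_0 + 1)^r b *)
Definition L0p1_pow (r : R) (b : V) : V :=
  \sum_(p <- decomp b) ((half p.1 + 1) `^ r)%:C *: p.2.

End VOSA.

Record VOSA (R : realType) := MkVOSA {
  vdata :> vosaData R;
  vosaP : vosa_axioms vdata
}.

Record scalar_product (R : realType) (V : lmodType R[i]) (ip : V -> V -> R[i])
    : Prop := ScalarProduct {
  ip_linear : forall x, scalar (ip x);
  ip_herm : forall x y, ip x y = conjc (ip y x);
  ip_pos : forall x, x != 0 -> 0 < ip x x
}.

Record unitaryVOSA (R : realType) := UnitaryVOSA {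
  uvosa :> VOSA R;
  uip : uvosa -> uvosa -> R[i];
  utheta : uvosa -> uvosa;
  uipP : scalar_product uip;
  uip_vac : uip (vvac uvosa) (vvac uvosa) = 1;
  theta_antilinear : forall (c : R[i]) u v,
    utheta (c *: u + v) = conjc c *: utheta u + utheta v;
  theta_prod : forall a n b,
    utheta (vprod a n b) = vprod (utheta a) n (utheta b);
  theta_vac : utheta (vvac uvosa) = vvac uvosa;
  theta_nu : utheta (vnu uvosa) = vnu uvosa;
  thetaK : involutive utheta;
  (* coefficient of z^(-n-1), for a homogeneous of weight d/2, of the
     invariance identity; the sign is (-1)^(2 L_0^2 + L_0) on weight d/2, and
     the sum is the expansion of e^(z L_1), cut where it vanishes *)
  uip_invariant : forall d a n b c (J : nat), vhom d a ->
    (forall j, (J <= j)%N -> iter j (@vir R uvosa 1) a = 0) ->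
    uip (vprod (utheta a) n b) c =
    (-1) ^ (d * (d + 1) %/ 2)%Z *
    \sum_(j < J) (j`!%:R)^-1 *
      uip b (vprod (iter j (@vir R uvosa 1) a) (d - j%:Z - n - 2) c)
}.

Definition unorm (R : realType) (V : unitaryVOSA R) (v : V) : R :=
  Num.sqrt (complex.Re (uip v v)).

Definition energy_bounded (R : realType) (V : unitaryVOSA R) : Prop :=
  forall a : V, exists M s r : R, [/\ 0 <= M, 0 <= s, 0 <= r &
    forall (k : int) (b : V),
      unorm (mode a k b) <=
      M * (`|half k| + 1) `^ s * unorm (L0p1_pow r b)].

Record hilbert (R : realType) := Hilbert {
  hcar :> completeNormedModType R[i];
  hip : hcar -> hcar -> R[i];
  hipP : scalar_product hip;
  hip_norm : forall x : hcar, `|x| ^+ 2 = hip x x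
}.

(* The Hilbert space completion, determined up to unitary isomorphism *)
Record completion (R : realType) (V : unitaryVOSA R) := Completion {
  chil :> hilbert R;
  cinj : {linear V -> chil};
  cinj_isom : forall u v, hip (cinj u) (cinj v) = uip u v;
  cinj_dense : dense (range cinj)
}.

(* Unbounded operators are represented by their graphs. *)
Section Operators.
Variables (R : realType) (H : hilbert R).

Definition dom (G : set (H * H)) : set H := [set x | exists y, G (x, y)].

(* the value G x; meaningful when x is in the domain of G *)
Definition app (G : set (H * H)) (x : H) : H := xget 0 [set y | G (x, y)].

Definition scale_op (c : R[i]) (G : set (H * H)) : set (H * H) :=
  [set p | exists2 y, G (p.1, y) & p.2 = c *: y].

(* projection-valued measures on the Borel subsets of the real line *)
Record pvm := Pvm {
  pproj :> set (measurableTypeR R) -> H -> H;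
  pproj_linear : forall B, measurable B -> linear (pproj B);
  pproj_sym : forall B, measurable B ->
    forall x y, hip x (pproj B y) = hip (pproj B x) y;
  pprojI : forall A B, measurable A -> measurable B ->
    forall x, pproj A (pproj B x) = pproj (A `&` B) x;
  pprojT : forall x, pproj setT x = x;
  pproj_sigma : forall B : (set (measurableTypeR R))^nat,
    (forall n, measurable (B n)) -> trivIset setT B ->
    forall x, (\sum_(i < n) pproj (B i) x) @[n --> \oo]
              --> pproj (\bigcup_n B n) x
}.

(* the measure (x | E(.) x) = ||E(.) x||^2 *)
Definition pmeas (E : pvm) (x : H) (B : set (measurableTypeR R)) : \bar R :=
  ((complex.Re `|E B x|) ^+ 2)%:E.

Definition fc_dom (E : pvm) (g : R -> R) : set H :=
  [set x | (\int[pmeas E x]_t ((g t ^+ 2)%:E) < +oo)%E].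

Definition fc_quad (E : pvm) (g : R -> R) (x : H) : R :=
  fine (\int[pmeas E x]_t (g t)%:E)%E.

(* the integral of g against the complex measure (z | E(.) x), which is
   1/4 sum_k i^k (x + i^k z | E(.) (x + i^k z)) by polarization *)
Definition fc_form (E : pvm) (g : R -> R) (z x : H) : R[i] :=
  4^-1 * \sum_(k < 4) 'i%C ^+ k *
    (fc_quad E g (x + 'i%C ^+ k *: z))%:C.

(* the operator int g dE *)
Definition fcalc (E : pvm) (g : R -> R) : set (H * H) :=
  [set p | fc_dom E g p.1 /\
           forall z, fc_dom E g z -> hip z p.2 = fc_form E g z p.1].

(* K = int t dE(t); by the spectral theorem such an E exists, and is unique,
   exactly when K is self-adjoint. Then g(K) is fcalc E g. *)
Definition spectral_measure (K : set (H * H)) (E : pvm) : Prop :=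
  K = fcalc E (fun t : R => t).

End Operators.

Section Smearing.
Variable R : realType.
Local Notation C := R[i].

Definition cis (t : R) : C := cos t +i* sin t.

Definition circle : set C := [set z | `|z| = 1].

(* S^1_+ *)
Definition upper_circle : set C := [set z | circle z /\ 0 < complex.Im z].

(* Functions on S^1 are represented by functions on C, of which only the
   restriction to S^1 is ever used. *)
Definition supp (f : C -> C) : set C :=
  closure ([set z | circle z /\ f z != 0] : set C^o).

Definition smooth (u : R -> R) : Prop :=
  forall n x, derivable (derive1n n u) x 1.

(* C_c^oo(S^1 \ {-1}) *)
Definition test_function (f : C -> C) : Prop :=
  [/\ smooth (fun t => complex.Re (f (cis t))),
      smooth (fun t => complex.Im (f (cis t))),
      compact (supp f : set C^o) & supp f `<=` circle `\ (-1)].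

(* the Fourier coefficient of index k/2 *)
Definition fhat (f : C -> C) (k : int) : C :=
  let h t := f (cis t) * cis (- half k * t) in
  ((2 * pi)^-1)%:C *
  ((\int[lebesgue_measure]_(t in `[(- pi : R), (pi : R)]) complex.Re (h t)) +i*
   (\int[lebesgue_measure]_(t in `[(- pi : R), (pi : R)]) complex.Im (h t))).

Variables (V : unitaryVOSA R) (H : completion V).

(* sum of the terms of index k/2 with |k| <= N; those with k/2 not in
   Z - d/2 vanish *)
Definition smeared_partial (d : int) (a : V) (f : C -> C) (c : V) (N : nat)
    : H :=
  \sum_(i < N.*2.+1)
    fhat f (i%:Z - N%:Z) *: cinj H (hmode d a (i%:Z - N%:Z) c).

(* Y(a, f), for a homogeneous of weight d/2 *)
Definition smeared (d : int) (a : V) (f : C -> C) : set (H * H) :=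
  closure [set p | exists2 c, p.1 = cinj H c &
                   smeared_partial d a f c N @[N --> \oo] --> p.2].

(* K = i pi closure(L_1 - L_{-1}) *)
Definition opK : set (H * H) :=
  scale_op ('i%C * pi%:C)
    (closure [set p | exists c : V,
       p = (cinj H c, cinj H (vir 1 c - vir (-1) c))]).

End Smearing.

Arguments upper_circle {R}.
Arguments smeared {R V} H d a f.
Arguments opK {R V} H.

(* Main.v *)
(* The vectors e_m = T^m a / m! satisfy L_{-1} e_m = (m+1) e_{m+1} and
   L_1 e_m = (d+m-1) e_{m-1} (d twice the weight of a), so on their span K acts
   as a Jacobi matrix and e_m = p_m(K) a for polynomials p_m with
   (m+1) p_{m+1}(t) = (d+m-1) p_{m-1}(t) + (i t / pi) p_m(t). Hence
   Y(a,f) Omega = F(K) a with F(t) = sum_m phi_m p_m(t), where phi_m is the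
   Fourier coefficient of f of index -(d/2+m), and the theorem reduces to the
   numerical identity exp(t/2) F_f(t) = i^d F_{f o j}(t).

   The recurrence says that P(z) = sum_m p_m(t) z^m solves
   (1 - z^2) P' = (d z + i t / pi) P, so that
   P(z) = (1 - z^2)^(-d/2) ((1+z)/(1-z))^(i t/(2 pi)) on the disc. On the open
   upper semicircle arg((1+z)/(1-z)) = pi/2, so P(conj z) is P(z) times
   exp(t/2) and a phase; integrating against f, after an Abel summation
   r -> 1, gives the identity.

   To pass from numbers to K, cut the spectrum into intervals of length h: on
   the spectral subspace of an interval around c, K is c up to O(h), so e_m is
   p_m(c) a up to O(h), and Riemann sums of exp(t/2) against the spectral
   measure of Y(a,f) Omega converge to i^d Y(a, f o j) Omega. *)
Require Import Defs.
From HB Require Import structures.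
From mathcomp Require Import all_boot all_order all_algebra.
From mathcomp Require Import all_classical all_reals all_analysis.
From mathcomp Require Import complex.
From mathcomp Require Import measurable_realfun ring lra zify.

Set Implicit Arguments.
Unset Strict Implicit.
Unset Printing Implicit Defensive.

Import Order.TTheory GRing.Theory Num.Theory.
Import numFieldNormedType.Exports.

Local Open Scope classical_set_scope.
Local Open Scope ring_scope.
Local Open Scope complex_scope.

(** * Norms with values in the reals *)

(** [fcalc] prescribes a value only through inner products, as polarized integrals, so the proof
    never forms [p_m(K)] and never multiplies functions of K. All that it extracts from [opK] is
    that K is within O(h) of c on the range of E(B) when B is a short interval around c; the
    three-term recurrence carries this from e_0 to e_m with a constant that depends on m. This fixes
    the order of choices: a window of the spectrum, then a truncation N of the series, and only then
    the mesh h. The truncation needs the scalar identity with a rate uniform for bounded t. There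
    p_m(t) grows like a power of m whose degree depends on |t|, and the rapid decay of the Fourier
    coefficients beats every such power. Adding up the cells costs nothing, because their spectral
    ranges are orthogonal.

    The generating function is singular at 1 and -1; the closed set supp f avoids both, so all
    boundary estimates are uniform on it.

    Finally, [app] selects a value from a graph, so both operators must be shown single-valued: Y(a,
    f) through its adjoint, the exponential by testing against spectral windows. *)

Section Nm.
Variable R : realType.

(* The norms of R[i]-normed groups take values in R[i]; Nm is their real part. *)
Definition Nm (V : normedZmodType R[i]) (x : V) : R := complex.Re `|x|.

Section generic.
Variable V : normedZmodType R[i].
Implicit Types x y : V.

Lemma NmE x : `|x| = (Nm x)%:C.
Proof. by rewrite /Nm RRe_real// normr_real. Qed.

Lemma Nm_ge0 x : 0 <= Nm x.
Proof. by rewrite -lecR -NmE; exact: normr_ge0. Qed.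

Lemma Nm0 : Nm (0 : V) = 0.
Proof. by apply: complexI; rewrite -NmE normr0. Qed.

Lemma Nm_eq0 x : Nm x = 0 -> x = 0.
Proof. by move=> h; apply/eqP; rewrite -normr_eq0 NmE h. Qed.

Lemma NmN x : Nm (- x) = Nm x.
Proof. by rewrite /Nm normrN. Qed.

Lemma NmD x y : Nm (x + y) <= Nm x + Nm y.
Proof. by rewrite -lecR rmorphD/= -!NmE ler_normD. Qed.

Lemma NmB x y : Nm (x - y) <= Nm x + Nm y.
Proof. by rewrite -[Nm y]NmN NmD. Qed.

Lemma Nm_sum I (r : seq I) (P : pred I) (F : I -> V) :
  Nm (\sum_(i <- r | P i) F i) <= \sum_(i <- r | P i) Nm (F i).
Proof.
elim/big_rec2 : _ => [|i y x _ h]; first by rewrite Nm0.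
by apply: le_trans (NmD _ _) _; rewrite lerD2l.
Qed.

Lemma Nm_small_eq0 x : (forall e, 0 < e -> Nm x <= e) -> x = 0.
Proof.
move=> h; apply: Nm_eq0; apply/eqP; rewrite eq_le Nm_ge0 andbT.
by apply/ler_addgt0Pl => e /h; rewrite addr0.
Qed.

End generic.

Lemma NmM (a b : R[i]) : Nm (a * b) = Nm a * Nm b.
Proof. by apply: complexI; rewrite rmorphM/= -!NmE normrM. Qed.

Lemma NmX (a : R[i]) n : Nm (a ^+ n) = Nm a ^+ n.
Proof. by apply: complexI; rewrite rmorphXn/= -!NmE normrX. Qed.

Lemma NmZ (V : normedModType R[i]) (a : R[i]) (x : V) : Nm (a *: x) = Nm a * Nm x.
Proof. by apply: complexI; rewrite rmorphM/= -!NmE normrZ. Qed.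

Lemma NmR (a : R) : Nm a%:C = `|a|.
Proof. by rewrite /Nm normc_def/= expr0n addr0 sqrtr_sqr. Qed.

Lemma Nm_nat n : Nm (n%:R : R[i]) = n%:R.
Proof. by rewrite -(rmorph_nat (real_complex R)) NmR normr_nat. Qed.

Lemma Nm1 : Nm (1 : R[i]) = 1.
Proof. exact: (Nm_nat 1). Qed.

Lemma NmV (a : R[i]) : Nm a^-1 = (Nm a)^-1.
Proof. by apply: complexI; rewrite fmorphV/= -!NmE normfV. Qed.

Lemma Nm_i : Nm ('i : R[i]) = 1.
Proof. by rewrite /Nm normc_def/= expr0n add0r expr1n sqrtr1. Qed.

Lemma Nm_sqr (z : R[i]) : Nm z ^+ 2 = complex.Re z ^+ 2 + complex.Im z ^+ 2.
Proof. by rewrite /Nm normc_def/= sqr_sqrtr// addr_ge0// sqr_ge0. Qed.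

Lemma Nm_conj (z : R[i]) : Nm (conjc z) = Nm z.
Proof. by rewrite /Nm !normc_def; case: z => a b /=; rewrite sqrrN. Qed.

Lemma ler_Re_Nm (z : R[i]) : `|complex.Re z| <= Nm z.
Proof.
rewrite -(ler_pXn2r (ltn0Sn 1)) ?nnegrE ?Nm_ge0// Nm_sqr real_normK ?num_real//.
by rewrite lerDl sqr_ge0.
Qed.

Lemma ler_Im_Nm (z : R[i]) : `|complex.Im z| <= Nm z.
Proof.
rewrite -(ler_pXn2r (ltn0Sn 1)) ?nnegrE ?Nm_ge0// Nm_sqr real_normK ?num_real//.
by rewrite lerDr sqr_ge0.
Qed.

Lemma ler_Nm_ReIm (z : R[i]) : Nm z <= `|complex.Re z| + `|complex.Im z|.
Proof.
rewrite -(ler_pXn2r (ltn0Sn 1)) ?nnegrE ?Nm_ge0 ?addr_ge0// Nm_sqr.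
rewrite sqrrD -[X in X + _]real_normK ?num_real//.
rewrite -[X in _ + X <= _]real_normK ?num_real//.
by rewrite -addrA lerD2l lerDr mulrn_wge0// mulr_ge0.
Qed.

Lemma conjcM (a b : R[i]) : conjc (a * b) = conjc a * conjc b.
Proof. exact: rmorphM. Qed.

Lemma conjcD (a b : R[i]) : conjc (a + b) = conjc a + conjc b.
Proof. exact: rmorphD. Qed.

Lemma conjcN (a : R[i]) : conjc (- a) = - conjc a.
Proof. exact: rmorphN. Qed.

(** A positive element of R[i] has imaginary part 0, so quantifying over complex radii amounts to
    quantifying over real ones. *)
Lemma cvg_Nm (V : normedModType R[i]) (u : V^nat) (l : V) :
  (u @ \oo --> l) <->
  (forall e, 0 < e -> exists N, forall n, (N <= n)%N -> Nm (u n - l) <= e).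
Proof.
split=> [/cvgrPdist_le h e e0|h].
  have e0' : 0 < e%:C by rewrite ltcR.
  have [N _ hN] := h _ e0'; exists N => n Nn.
  by rewrite -lecR -NmE distrC; exact: (hN n).
apply/cvgrPdist_le => e; rewrite ltcE/= => /andP[/eqP ei er].
have [N hN] := h _ er; exists N => // n Nn /=.
by rewrite distrC NmE lecE/= -ei eqxx; apply: hN.
Qed.

Lemma cvg_Nm_unique (V : normedModType R[i]) (u : V^nat) (l l' : V) :
  u @ \oo --> l -> u @ \oo --> l' -> l = l'.
Proof.
move=> /cvg_Nm h /cvg_Nm h'; apply/eqP; rewrite -subr_eq0; apply/eqP.
apply: Nm_small_eq0 => e e0.
have e2 : 0 < e / 2 by lra.
have [N hN] := h _ e2; have [N' hN'] := h' _ e2.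
have := hN (maxn N N') (leq_maxl _ _); have := hN' (maxn N N') (leq_maxr _ _).
set w := u _ => h1 h2.
have -> : l - l' = (w - l') - (w - l) by rewrite opprB [RHS]addrC addrA subrK.
by apply: le_trans (NmB _ _) _; lra.
Qed.

(* The rate 1/(n+1) - 1/(n+2) is the telescoping majorant of 1/(n+1)^2. *)
Lemma telescope_bound (C : R) (u : R^nat) n m :
  (forall k, u k <= C * ((k.+1%:R)^-1 - (k.+2%:R)^-1)) ->
  \sum_(n <= k < n + m) u k <= C * ((n.+1%:R)^-1 - (n + m).+1%:R^-1).
Proof.
move=> h; elim: m => [|m IH]; first by rewrite addn0 big_geq// subrr mulr0.
rewrite addnS big_nat_recr ?leq_addr//=.
apply: le_trans (lerD IH (h _)) _.
by rewrite -mulrDr addrA subrK.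
Qed.

Lemma invS_telescope (k : nat) :
  ((k.+1%:R : R) ^+ 2)^-1 <= 2 * ((k.+1%:R)^-1 - (k.+2%:R)^-1).
Proof.
have h1 : 0 < (k.+1%:R : R) by rewrite ltr0n.
have h2 : 0 < (k.+2%:R : R) by rewrite ltr0n.
have e : (k.+2%:R : R) = k.+1%:R + 1 by rewrite -natr1.
have k1 : 1 <= (k.+1%:R : R) by rewrite ler1n.
rewrite -[leLHS]mul1r ler_pdivrMr ?exprn_gt0//.
have -> : 2 * (k.+1%:R^-1 - k.+2%:R^-1) * k.+1%:R ^+ 2 = 2 * k.+1%:R / k.+2%:R :> R.
  by rewrite e; field; rewrite !(addrC 1) !natr1 !pnatr_eq0.
by rewrite ler_pdivlMr// e; lra.
Qed.

(** The majorant telescopes: the terms from n on add up to at most C/(n+1). This gives the Cauchy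
    property and also the explicit rate, used later to compare two ways of truncating the same
    series. *)
Lemma series_cvg (V : completeNormedModType R[i]) (u : V^nat) (C : R) :
  (forall k, Nm (u k) <= C * ((k.+1%:R)^-1 - (k.+2%:R)^-1)) ->
  exists2 l : V, (\sum_(k < n) u k @[n --> \oo] --> l)
    & forall n, Nm (\sum_(k < n) u k - l) <= C / n.+1%:R.
Proof.
move=> h.
have C0 : 0 <= C.
  have := le_trans (Nm_ge0 _) (h 0%N).
  by rewrite invr1; rewrite -[2%:R]/(2:R) pmulr_lge0//; lra.
have d n m : (n <= m)%N ->
    Nm (\sum_(k < m) u k - \sum_(k < n) u k) <= C / n.+1%:R.
  move=> nm; rewrite -!(big_mkord predT u) (big_cat_nat (leq0n n) nm)/= addrAC subrr add0r.
  apply: le_trans (Nm_sum _ _ _) _; rewrite -(subnKC nm).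
  apply: le_trans (telescope_bound n (m - n) h) _.
  by rewrite ler_wpM2l// gerBl invr_ge0.
have dl e : 0 < e -> exists N, forall n, (N <= n)%N -> C / n.+1%:R <= e.
  move=> e0; have [N hN] : exists N : nat, C / e <= N%:R.
    exists (Num.truncn (C / e)).+1; apply: ltW; rewrite truncnS_gt//.
  exists N => n Nn; rewrite ler_pdivrMr ?ltr0n// mulrC -ler_pdivrMr//.
  by apply: le_trans hN _; rewrite ler_nat (leq_trans Nn).
have cu : cvgn (fun n => \sum_(k < n) u k).
  apply/cauchy_cvgP/cauchy_exP => e; rewrite ltcE/= => /andP[/eqP ei er].
  have e2 : 0 < complex.Re e / 2 by rewrite divr_gt0.
  have [N hN] := dl _ e2.
  exists (\sum_(k < N) u k); exists N => // n Nn /=.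
  rewrite -ball_normE/= distrC NmE ltcE/= -ei eqxx/=.
  by apply: le_lt_trans (d _ _ Nn) _; apply: le_lt_trans (hN N (leqnn N)) _; rewrite ltr_pdivrMr//; move: er => /=; lra.
exists (lim ((fun n => \sum_(k < n) u k) @ \oo)) => // n.
apply/ler_addgt0Pr => e e0.
have /cvg_Nm /(_ e e0) [N hN] := cu.
have := hN (maxn N n) (leq_maxl _ _).
have := d n (maxn N n) (leq_maxr _ _).
set l := lim _; set w := \sum_(k < maxn _ _) _; set v := \sum_(k < n) _ => h1 h2.
have -> : v - l = (w - l) - (w - v) by rewrite opprB [RHS]addrC addrA subrK.
by apply: le_trans (NmB _ _) _; rewrite addrC; apply: lerD.
Qed.

End Nm.

(** * Hilbert spaces *)

Section Hilbert.
Variables (R : realType) (H : hilbert R).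
Implicit Types (x y z : H) (c : R[i]).
Local Notation "<< x , y >>" := (hip x y).

Lemma hipDr x y z : <<x, y + z>> = <<x, y>> + <<x, z>>.
Proof. by have := ip_linear (hipP H) x 1 y z; rewrite scale1r mul1r. Qed.

Lemma hip0r x : <<x, 0>> = 0.
Proof. by apply: (addrI (hip x 0)); rewrite -hipDr !addr0. Qed.

Lemma hipZr x c y : <<x, c *: y>> = c * <<x, y>>.
Proof. by have := ip_linear (hipP H) x c y 0; rewrite hip0r !addr0. Qed.

Lemma hipNr x y : <<x, - y>> = - <<x, y>>.
Proof. by rewrite -scaleN1r hipZr mulN1r. Qed.

Lemma hipBr x y z : <<x, y - z>> = <<x, y>> - <<x, z>>.
Proof. by rewrite hipDr hipNr. Qed.

Lemma hipC x y : <<x, y>> = conjc <<y, x>>.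
Proof. exact: (ip_herm (hipP H)). Qed.

Lemma hipDl x y z : <<x + y, z>> = <<x, z>> + <<y, z>>.
Proof. by rewrite hipC hipDr conjcD -!hipC. Qed.

Lemma hip0l x : <<0, x>> = 0.
Proof. by rewrite hipC hip0r conjc0. Qed.

Lemma hipZl c x y : <<c *: x, y>> = conjc c * <<x, y>>.
Proof. by rewrite hipC hipZr conjcM -hipC. Qed.

Lemma hipNl x y : <<- x, y>> = - <<x, y>>.
Proof. by rewrite hipC hipNr conjcN -hipC. Qed.

Lemma hipBl x y z : <<x - y, z>> = <<x, z>> - <<y, z>>.
Proof. by rewrite hipDl hipNl. Qed.

Lemma hipxx x : <<x, x>> = (Nm x ^+ 2)%:C.
Proof. by rewrite -hip_norm NmE rmorphXn. Qed.

Lemma hip_sumr I (r : seq I) (P : pred I) (F : I -> H) x :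
  <<x, \sum_(i <- r | P i) F i>> = \sum_(i <- r | P i) <<x, F i>>.
Proof. by elim/big_rec2 : _ => [|i y z _ <-]; rewrite ?hip0r// hipDr. Qed.

Lemma hip_suml I (r : seq I) (P : pred I) (F : I -> H) x :
  <<\sum_(i <- r | P i) F i, x>> = \sum_(i <- r | P i) <<F i, x>>.
Proof. by elim/big_rec2 : _ => [|i y z _ <-]; rewrite ?hip0l// hipDl. Qed.

Lemma CauchySchwarz x y : Nm <<x, y>> <= Nm x * Nm y.
Proof.
have [y0|y0] := eqVneq y 0; first by rewrite y0 hip0r !Nm0 mulr0.
have ny : 0 < Nm y.
  rewrite lt_neqAle Nm_ge0 andbT eq_sym; apply: contra y0 => /eqP/Nm_eq0 ->.
  exact: eqxx.
(* x + c y is the component of x orthogonal to y; its squared norm is the defect in the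
   inequality. *)
pose c := - (<<y, x>> / (Nm y ^+ 2)%:C).
have : 0 <= complex.Re <<x + c *: y, x + c *: y>>.
  by rewrite hipxx/= sqr_ge0.
have -> : <<x + c *: y, x + c *: y>> = (Nm x ^+ 2 - Nm <<x, y>> ^+ 2 / Nm y ^+ 2)%:C.
  rewrite hipDl !hipDr !hipZl !hipZr !hipxx.
  have yy : (Nm y ^+ 2)%:C != 0 :> R[i].
    by rewrite (inj_eq (@complexI _)) expf_neq0// lt0r_neq0.
  have -> : conjc c = - (<<x, y>> / (Nm y ^+ 2)%:C).
    by rewrite /c conjcN conjcM conjc_inv conjc_real -hipC.
  have e : (Nm <<x, y>> ^+ 2)%:C = <<x, y>> * <<y, x>>.
    rewrite rmorphXn/= -NmE sqr_normc -hipC//.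
  rewrite rmorphB/= (rmorphM _ (Nm <<x, y>> ^+ 2))/= e fmorphV/= /c.
  by move: {c e} yy (Nm x ^+ 2)%:C; move: (Nm y ^+ 2)%:C => w yy X; field.
rewrite /= subr_ge0 ler_pdivrMr ?exprn_gt0// -exprMn.
by rewrite ler_pXn2r// ?nnegrE ?mulr_ge0 ?Nm_ge0.
Qed.

Lemma Pythagoras x y : <<x, y>> = 0 -> Nm (x + y) ^+ 2 = Nm x ^+ 2 + Nm y ^+ 2.
Proof.
move=> xy; have yx : <<y, x>> = 0 by rewrite hipC xy conjc0.
apply: complexI; rewrite -hipxx hipDl !hipDr xy yx !hipxx addr0 add0r.
by rewrite rmorphD.
Qed.

(** The form is antilinear on the left, so i^k cancels against its conjugate only in <z, x>; every
    other term carries the sum of i^k or i^(2k) over k < 4, which is 0. *)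
Lemma polarization x z :
  \sum_(k < 4) 'i%C ^+ k * <<x + 'i%C ^+ k *: z, x + 'i%C ^+ k *: z>> =
  4 * <<z, x>>.
Proof.
rewrite !big_ord_recl big_ord0 /= /bump /= !hipDl !hipDr !hipZl !hipZr.
rewrite !exprS !expr0.
case: (hip x x) (hip x z) (hip z x) (hip z z) => [a a'] [b b'] [c c'] [e e'].
by apply/eqP; rewrite eq_complex /=; apply/andP; split; apply/eqP; ring.
Qed.

End Hilbert.

(** * Projection-valued measures and functional calculus *)

Section pvm.
Variables (R : realType) (H : hilbert R) (E : pvm H).
Implicit Types (x y z : H) (A B : set (measurableTypeR R)) (c : R[i]).

Lemma pprojD B x y : measurable B -> E B (x + y) = E B x + E B y.
Proof. by move=> mB; have := pproj_linear E mB 1 x y; rewrite !scale1r. Qed.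

Lemma pproj0 B : measurable B -> E B 0 = 0.
Proof. by move=> mB; apply: (addrI (E B 0)); rewrite -pprojD// !addr0. Qed.

Lemma pprojZ B c x : measurable B -> E B (c *: x) = c *: E B x.
Proof.
by move=> mB; have := pproj_linear E mB c x 0; rewrite pproj0// !addr0.
Qed.

Lemma pprojB B x y : measurable B -> E B (x - y) = E B x - E B y.
Proof. by move=> mB; rewrite pprojD// -scaleN1r pprojZ// scaleN1r. Qed.

Lemma pproj_sum B I (r : seq I) (F : I -> H) : measurable B ->
  E B (\sum_(i <- r) F i) = \sum_(i <- r) E B (F i).
Proof.
move=> mB; elim: r => [|i r IH]; first by rewrite !big_nil pproj0.
by rewrite !big_cons pprojD// IH.
Qed.

Lemma pproj_id B x : measurable B -> E B (E B x) = E B x.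
Proof. by move=> mB; rewrite pprojI// setIid. Qed.

Lemma hip_pproj B x y : measurable B -> hip x (E B y) = hip (E B x) (E B y).
Proof. by move=> mB; rewrite -pproj_sym// pproj_id. Qed.

Lemma hip_pprojxx B x : measurable B -> hip x (E B x) = (Nm (E B x) ^+ 2)%:C.
Proof. by move=> mB; rewrite hip_pproj// hipxx. Qed.

(** Sigma-additivity for the constant sequence of empty sets: consecutive partial sums differ by
    [E set0 x], so convergence forces it to vanish. *)
Lemma pproj_set0 x : E set0 x = 0.
Proof.
have t : trivIset setT (fun _ : nat => set0 : set (measurableTypeR R)).
  by apply/trivIsetP => i j _ _ _; rewrite setI0.
have /cvg_Nm h := @pproj_sigma _ _ E _ (fun=> measurable0) t x.
apply: Nm_small_eq0 => e e0.
have e2 : 0 < e / 2 by rewrite divr_gt0.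
have [N hN] := h _ e2.
have := hN N.+1 (leqnSn N); have := hN N (leqnn N).
rewrite big_ord_recr/=; set s := \sum_(i < N) _; set l := E (\bigcup_n _) x.
move=> h1 h2; have -> : E set0 x = (s + E set0 x - l) - (s - l).
  by rewrite opprB addrA subrK addrC addKr.
by apply: le_trans (NmB _ _) _; lra.
Qed.

Lemma pproj_disj A B x : measurable A -> measurable B -> A `&` B = set0 ->
  E A (E B x) = 0.
Proof. by move=> mA mB AB; rewrite pprojI// AB pproj_set0. Qed.

Lemma pprojU A B x : measurable A -> measurable B -> A `&` B = set0 ->
  E (A `|` B) x = E A x + E B x.
Proof.
move=> mA mB AB.
have mAB : forall n, measurable (bigcup2 A B n).
  by case=> [|[|n]]//=; exact: measurable0.
have t : trivIset setT (bigcup2 A B) by rewrite -trivIset_bigcup2.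
have := @pproj_sigma _ _ E _ mAB t x; rewrite bigcup2E => h.
apply: (cvg_Nm_unique h); apply/cvg_Nm => e e0; exists 2 => // n n2.
rewrite (_ : \sum_(i < n) _ = E A x + E B x) ?subrr ?Nm0 ?ltW//.
case: n n2 => [|[|n]]// _; rewrite !big_ord_recl/= big1 ?addr0// => i _.
by rewrite /bump /= pproj_set0.
Qed.

Lemma pproj_orth A B x y : measurable A -> measurable B -> A `&` B = set0 ->
  hip (E A x) (E B y) = 0.
Proof. by move=> mA mB AB; rewrite -pproj_sym// pproj_disj// hip0r. Qed.

Lemma pprojT_sqr A x : measurable A ->
  Nm x ^+ 2 = Nm (E A x) ^+ 2 + Nm (x - E A x) ^+ 2.
Proof.
move=> mA; rewrite -Pythagoras; first by rewrite addrC subrK.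
by rewrite -pproj_sym// pprojB// pproj_id// subrr hip0r.
Qed.

Lemma Nm_pproj A x : measurable A -> Nm (E A x) <= Nm x.
Proof.
move=> mA; rewrite -(ler_pXn2r (ltn0Sn 1)) ?nnegrE ?Nm_ge0//.
by rewrite (pprojT_sqr x mA) lerDl sqr_ge0.
Qed.

Section pmeas.
Variable x : H.

Let pmeas0 : pmeas E x set0 = 0%E.
Proof. by rewrite /pmeas pproj_set0 normr0 expr0n. Qed.

Let pmeas_ge0 A : (0 <= pmeas E x A)%E.
Proof. by rewrite lee_fin sqr_ge0. Qed.

Let pmeas_sigma : semi_sigma_additive (pmeas E x).
Proof.
move=> F mF tF mU; rewrite /pmeas.
(* The squared norm becomes the inner product of x with [E A x], which is linear in the projection,
   so strong sigma-additivity of E passes to the measure. *)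
have e A : measurable A -> complex.Re `|E A x| ^+ 2 = complex.Re (hip x (E A x)).
  by move=> mA; rewrite hip_pprojxx.
under eq_fun do rewrite sumEFin; apply: cvg_EFin; first exact: nearW.
rewrite /comp /= e//; under eq_fun do under eq_bigr do rewrite e//.
have /cvg_Nm h := @pproj_sigma _ _ E _ mF tF x.
have n0 : 0 < Nm x + 1 by rewrite ltr_wpDl// Nm_ge0.
apply/cvgrPdist_le => r r0.
have [N hN] := h _ (divr_gt0 r0 n0).
exists N => // n Nn /=; rewrite big_mkord -raddf_sum -hip_sumr distrC.
rewrite -raddfB/= -hipBr; apply: le_trans (ler_Re_Nm _) _.
apply: le_trans (CauchySchwarz _ _) _.
apply: le_trans (ler_wpM2l (Nm_ge0 _) (hN n Nn)) _.
rewrite mulrA ler_pdivrMr// mulrC ler_wpM2l// ?ltW//.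
by rewrite ltrDl.
Qed.

HB.instance Definition _ :=
  isMeasure.Build _ (measurableTypeR R) R (pmeas E x)
    pmeas0 pmeas_ge0 pmeas_sigma.

Let pmeas_fin : fin_num_fun (pmeas E x).
Proof. by []. Qed.

HB.instance Definition _ :=
  Measure_isFinite.Build _ (measurableTypeR R) R (pmeas E x) pmeas_fin.

End pmeas.

End pvm.

(** * Spectral integrals of functions that are nearly constant on a set *)

Section spectral_integrals.
Variables (R : realType) (H : hilbert R) (E : pvm H).
Implicit Types (x y z : H) (A B : set (measurableTypeR R))
  (g : measurableTypeR R -> R).

Lemma fine_pmeas x B : fine (pmeas E x B) = Nm (E B x) ^+ 2.
Proof. by []. Qed.

Lemma integrable_near_cst B g (c e : R) x : measurable B ->
  measurable_fun setT g -> (forall t, B t -> `|g t - c| <= e) ->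
  (pmeas E x).-integrable B (EFin \o g).
Proof.
move=> mB mg h; apply: measurable_bounded_integrable => //.
- by rewrite ltry.
- exact: measurable_funTS.
- exists (`|c| + e); split; first exact: num_real.
  move=> M hM t Bt /=; apply: le_trans (ltW hM).
  rewrite -[g t](subrK c) addrC; apply: le_trans (ler_normD _ _) _.
  by rewrite lerD2l h.
Qed.

Lemma Rintegral_near_cst B g (c e : R) x : measurable B ->
  measurable_fun setT g -> (forall t, B t -> `|g t - c| <= e) ->
  `|\int[pmeas E x]_(t in B) g t - c * Nm (E B x) ^+ 2| <= e * Nm (E B x) ^+ 2.
Proof.
move=> mB mg h.
have ig := integrable_near_cst x mB mg h.
have ic k : (pmeas E x).-integrable B (EFin \o cst k).
  exact: finite_measure_integrable_cst.
have -> : c * Nm (E B x) ^+ 2 = \int[pmeas E x]_(t in B) c.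
  by rewrite Rintegral_cst// fine_pmeas.
have -> : e * Nm (E B x) ^+ 2 = \int[pmeas E x]_(t in B) e.
  by rewrite Rintegral_cst// fine_pmeas.
rewrite -RintegralB//; last exact: (ic c).
have igc : (pmeas E x).-integrable B (EFin \o (fun t => g t - c)).
  exact: (integrableB mB ig (ic c)).
apply: le_trans (le_normr_Rintegral mB igc) _; apply: le_Rintegral => //.
- exact: (integrable_abse igc).
- exact: (ic e).
Qed.

(** |g| <= 1 + g^2, and the spectral measure of x is finite. *)
Lemma fc_dom_integrable g x : measurable_fun setT g ->
  fc_dom E g x -> (pmeas E x).-integrable setT (EFin \o g).
Proof.
move=> mg hx; have mg1 : measurable_fun setT (fun t => (g t)%:E).
  exact/measurable_EFinP.
have mg2 : measurable_fun setT (fun t => (g t ^+ 2)%:E).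
  by apply/measurable_EFinP; exact: measurable_funX.
apply/integrableP; split => //.
apply: (@le_lt_trans _ _ (\int[pmeas E x]_t (1 + (g t ^+ 2)%:E)))%E.
  apply: ge0_le_integral => //=.
  - by apply/measurable_EFinP; apply: measurableT_comp.
  - exact: emeasurable_funD.
  - move=> t _; rewrite -EFinD lee_fin -[g t ^+ 2]real_normK ?num_real//.
    by rewrite -subr_ge0; nra.
rewrite ge0_integralD//=; last by move=> t _; rewrite lee_fin sqr_ge0.
by rewrite lte_add_pinfty// integral_cst//= mul1e ltry.
Qed.

(** Since (b + d)^2 <= 2 b^2 + 2 d^2, the measure of x + c z is dominated by twice the sum of the
    measures of x and z. It keeps the four polarized vectors inside the domain. *)
Lemma fc_domD g x z (c : R[i]) : measurable_fun setT g -> Nm c = 1 ->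
  fc_dom E g x -> fc_dom E g z -> fc_dom E g (x + c *: z).
Proof.
move=> mg c1 hx hz; have mg2 : measurable_fun setT (fun t => (g t ^+ 2)%:E).
  by apply/measurable_EFinP; exact: measurable_funX.
have g0 t : (0 <= (g t ^+ 2)%:E)%E by rewrite lee_fin sqr_ge0.
pose two := NngNum (ler0n R 2).
pose m := measure_add (mscale two (pmeas E x)) (mscale two (pmeas E z)).
apply: (@le_lt_trans _ _ (\int[m]_t (g t ^+ 2)%:E))%E.
  apply: ge0_le_measure_integral => // S mS.
  rewrite [leRHS](_ : _ = mscale two (pmeas E x) S + mscale two (pmeas E z) S)%E;
    last exact: measure_addE.
  rewrite /mscale/= /pmeas -!/(Nm _) -!EFinM -EFinD lee_fin.
  rewrite pprojD// pprojZ//; have := NmD (E S x) (c *: E S z).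
  rewrite NmZ c1 mul1r => h; have := Nm_ge0 (E S x + c *: E S z).
  have := Nm_ge0 (E S x); have := Nm_ge0 (E S z).
  move: h; set a := Nm _; set b := Nm _; set d := Nm _ => h b0 d0 a0.
  have : a ^+ 2 <= (b + d) ^+ 2 by rewrite ler_pXn2r ?nnegrE ?addr_ge0.
  by move: (sqr_ge0 (d - b)); nra.
rewrite /m ge0_integral_measure_add// !ge0_integral_mscale//.
by rewrite lte_add_pinfty// lte_mul_pinfty.
Qed.

Lemma pmeas_pproj A B x : measurable A -> measurable B ->
  pmeas E (E B x) A = pmeas E x (A `&` B).
Proof. by move=> mA mB; rewrite /pmeas pprojI. Qed.

(** The measure of [E B z] lives on B, where |g| <= |c| + e. Such vectors are the supply of test
    vectors for [fcalc]. *)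
Lemma fc_dom_pproj g B z (c e : R) : measurable B -> measurable_fun setT g ->
  (forall t, B t -> `|g t - c| <= e) -> fc_dom E g (E B z).
Proof.
move=> mB mg h; have mg2 : measurable_fun setT (fun t => (g t ^+ 2)%:E).
  by apply/measurable_EFinP; exact: measurable_funX.
have g0 t : (0 <= (g t ^+ 2)%:E)%E by rewrite lee_fin sqr_ge0.
rewrite /fc_dom /= -(setUv B) ge0_integral_setU//.
- rewrite [X in (_ + X)%E](_ : _ = 0%E) ?adde0; last first.
    rewrite (eq_measure_integral mzero) ?integral_measure_zero// => A mA AB.
    transitivity (pmeas E z (A `&` B)); first exact: pmeas_pproj.
    by rewrite (_ : A `&` B = set0) ?measure0//; apply/disjoints_subset.
  apply: (@le_lt_trans _ _ (\int[pmeas E (E B z)]_(t in B) cst ((`|c| + e) ^+ 2)%:E t))%E.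
    apply: ge0_le_integral => //=; first exact: measurable_funTS.
    + move=> t Bt; rewrite lee_fin -[g t ^+ 2]real_normK ?num_real//.
      have h0 : `|g t| <= `|c| + e.
        rewrite -[g t](subrK c) addrC; apply: le_trans (ler_normD _ _) _.
        by rewrite lerD2l h.
      by rewrite ler_pXn2r ?nnegrE ?(le_trans _ h0)//.
  by rewrite integral_cst// lte_mul_pinfty// ?lee_fin ?sqr_ge0// ltry.
- exact: measurableC.
- by rewrite setUv.
- by apply/disj_setPS; rewrite setICr.
Qed.

(* Testing the weak definition of K x against E(B)-vectors only involves the
   values of t on B. *)
Lemma id_near_cst x y B (c e : R) : fcalc E (fun t => t) (x, y) ->
  measurable B -> (forall t, B t -> `|t - c| <= e) -> 0 <= e ->
  Nm (E B (y - c%:C *: x)) <= 4 * e * Nm (E B x).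
Proof.
move=> [/= dx hxy] mB hB e0; set w := E B _.
have mid : measurable_fun setT (fun t : measurableTypeR R => t).
  exact: measurable_id.
have Bw : E B w = w by rewrite /w pproj_id.
have key z : E B z = z ->
    Nm (hip z w) <= e * (Nm (E B x) + Nm z) ^+ 2.
  move=> Bz.
  have dz : fc_dom E (fun t => t) z by rewrite -Bz; exact: fc_dom_pproj hB.
  pose X (k : 'I_4) := x + 'i%C ^+ k *: z.
  pose Q k := \int[pmeas E (X k)]_(t in B) t.
  pose q := \int[pmeas E x]_(t in ~` B) t.
  have i1 (k : nat) : Nm ('i%C ^+ k : R[i]) = 1 by rewrite NmX Nm_i expr1n.
  have dX k : fc_dom E (fun t => t) (X k) by apply: fc_domD.
  (* As z lies in the range of E(B), the measures of the four vectors [X k] agree off B. Their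
     common contribution q drops out because the i^k sum to 0. *)
  have qX k : fc_quad E (fun t => t) (X k) = Q k + q.
    have iX := fc_dom_integrable mid (dX k).
    rewrite /fc_quad -(setUv B) -[LHS]/(Rintegral _ _ _) Rintegral_setU//.
    + congr (_ + _); congr fine; apply: eq_measure_integral => A mA AB.
      change (pmeas E (X k) A = pmeas E x A).
      rewrite /pmeas /X pprojD// pprojZ// -Bz pproj_disj// ?scaler0 ?addr0//.
      exact/disjoints_subset.
    + exact: measurableC.
    + by rewrite setUv.
    + by apply/disj_setPS; rewrite setICr.
  have hz : hip z y - c%:C * hip z (E B x) =
      4^-1 * \sum_(k < 4) 'i%C ^+ k * (Q k - c * Nm (E B (X k)) ^+ 2)%:C.
    rewrite (hxy z dz) /fc_form -[hip z (E B x)]mul1r -[X in X * hip _ _](@mulVf _ 4)//.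
    rewrite -mulrA hip_pproj// Bz -polarization mulrCA -mulrBr mulr_sumr -sumrB.
    congr (4^-1 * _).
    transitivity (\sum_(k < 4) ('i%C ^+ k * (Q k - c * Nm (E B (X k)) ^+ 2)%:C + 'i%C ^+ k * q%:C)).
      apply: eq_bigr => k _; rewrite qX hipxx.
      have -> : E B (X k) = E B x + 'i%C ^+ k *: z by rewrite pprojD// pprojZ// Bz.
      rewrite rmorphB rmorphD/= (rmorphM _ c)/=; ring.
    rewrite big_split/= -mulr_suml [X in _ + X * _](_ : _ = 0) ?mul0r ?addr0//.
    rewrite !big_ord_recl big_ord0 /= /bump /= !exprS !expr0.
    by apply/eqP; rewrite eq_complex /=; apply/andP; split; apply/eqP; ring.
  have -> : hip z w = hip z y - c%:C * hip z (E B x).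
    rewrite /w pprojB// pprojZ// hipBr hipZr; congr (_ - _).
    by rewrite -{2}Bz pproj_sym.
  rewrite hz NmM NmV Nm_nat ler_pdivrMl//.
  apply: le_trans (Nm_sum _ _ _) _.
  apply: (@le_trans _ _ (\sum_(k < 4) (e * (Nm (E B x) + Nm z) ^+ 2))); last first.
    by rewrite sumr_const card_ord mulr_natl.
  apply: ler_sum => k _; rewrite NmM i1 mul1r NmR.
  apply: le_trans (Rintegral_near_cst (X k) mB mid hB) _.
  rewrite ler_wpM2l// ler_pXn2r ?nnegrE ?addr_ge0 ?Nm_ge0//.
  rewrite /X pprojD// pprojZ// Bz; apply: le_trans (NmD _ _) _.
  by rewrite NmZ i1 mul1r.
(* [key] is quadratic in the test vector while the goal is linear, so z = s w is inserted with a
   free scale s, to be optimized. *)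
have keys (s : R) : 0 < s ->
    s * Nm w ^+ 2 <= e * (Nm (E B x) + s * Nm w) ^+ 2.
  move=> s0; have := key (s%:C *: w); rewrite pprojZ// Bw => /(_ erefl).
  rewrite hipZl conjc_real hipxx NmM !NmZ !NmR gtr0_norm//.
  by rewrite ger0_norm// sqr_ge0.
have := Nm_ge0 w; have := Nm_ge0 (E B x).
move: keys; set X := Nm (E B x); set W := Nm w => keys X0 W0.
have [->|Wn0] := eqVneq W 0; first by rewrite !mulr_ge0.
have Wp : 0 < W by rewrite lt_neqAle eq_sym Wn0.
have [X00|Xn0] := eqVneq X 0.
  (* If E(B) x = 0, any s with e s < 1 contradicts W > 0; this one also works for e = 0. *)
  have e1 : 0 < 2 * (e + 1) by lra.
  have s0 : 0 < (2 * (e + 1))^-1 by rewrite invr_gt0.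
  have := keys _ s0; rewrite X00 add0r; set r := _^-1 => k.
  have : r * W ^+ 2 <= (e * r ^+ 2) * W ^+ 2 by rewrite -mulrA -exprMn.
  rewrite ler_pM2r ?exprn_gt0// expr2 mulrA -[X in X <= _]mul1r ler_pM2r//.
  by rewrite /r ler_pdivlMr//; lra.
have Xp : 0 < X by rewrite lt_neqAle eq_sym Xn0.
(* This scale balances the two summands; the factor 4 of the statement is (1 + 1)^2. *)
have s0 : 0 < X / W by rewrite divr_gt0.
have := keys _ s0; rewrite divfK//.
have -> : X / W * W ^+ 2 = X * W by field.
have -> : e * (X + X) ^+ 2 = X * (4 * e * X) by ring.
by rewrite ler_pM2l.
Qed.

End spectral_integrals.

(** * Riemann sums against the spectral measure *)

Section riemann.
Variables (R : realType) (H : hilbert R) (E : pvm H).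
Implicit Types (x y z : H) (g : measurableTypeR R -> R).

(** Half-open intervals, so that consecutive cells are disjoint and tile a block exactly, with no
    atoms counted twice. *)
Definition cell (a h : R) (j : nat) : set (measurableTypeR R) :=
  [set` `[a + j%:R * h, a + j.+1%:R * h[].

Definition block (a h : R) (K : nat) : set (measurableTypeR R) :=
  [set` `[a, a + K%:R * h[].

Lemma measurable_cell a h j : measurable (cell a h j).
Proof. exact: measurable_itv. Qed.

Lemma measurable_block a h K : measurable (block a h K).
Proof. exact: measurable_itv. Qed.

Hint Resolve measurable_cell measurable_block : core.

Lemma block0 a h : block a h 0 = set0.
Proof. by rewrite /block mul0r addr0 set_itvxx. Qed.

Section step.
Variables (a h : R).
Hypothesis h0 : 0 <= h.

Lemma blockS K : block a h K.+1 = block a h K `|` cell a h K.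
Proof.
rewrite /block /cell -itv_bndbnd_setU// bnd_simp ?lerDl ?lerD2l.
  by rewrite mulr_ge0.
by rewrite ler_wpM2r// ler_nat.
Qed.

Lemma block_cell K : block a h K `&` cell a h K = set0.
Proof.
apply/disjoints_subset => t; rewrite /block /cell /= !in_itv/= => /andP[_ t1].
by move=> /andP[]; rewrite leNgt t1.
Qed.

Lemma cell_block j K : (j < K)%N -> cell a h j `<=` block a h K.
Proof.
elim: K => // K IH; rewrite ltnS leq_eqVlt blockS => /predU1P[->|/IH jK] t ct.
  by right.
by left; exact: jK.
Qed.

Lemma pproj_block K x : E (block a h K) x = \sum_(j < K) E (cell a h j) x.
Proof.
elim: K => [|K IH]; first by rewrite block0 pproj_set0 big_ord0.
by rewrite blockS pprojU ?block_cell// big_ord_recr/= IH.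
Qed.

(** Disjoint cells have orthogonal ranges. Errors therefore add in squares, and a relative error
    bound in each cell does not deteriorate with the number of cells. *)
Lemma Nm_sum_cells K (v : nat -> H) :
  Nm (\sum_(j < K) E (cell a h j) (v j)) ^+ 2 =
  \sum_(j < K) Nm (E (cell a h j) (v j)) ^+ 2.
Proof.
elim: K => [|K IH]; first by rewrite !big_ord0 Nm0 expr0n.
rewrite !big_ord_recr/= Pythagoras ?IH//.
have -> : \sum_(j < K) E (cell a h j) (v j) =
    E (block a h K) (\sum_(j < K) E (cell a h j) (v j)).
  rewrite pproj_sum//; apply: eq_bigr => j _; rewrite pprojI//.
  by rewrite setIidr//; exact: cell_block.
by rewrite pproj_orth// block_cell.
Qed.

Lemma Rintegral_block K g x : measurable_fun setT g ->
  (pmeas E x).-integrable setT (EFin \o g) ->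
  \int[pmeas E x]_(t in block a h K) g t =
  \sum_(j < K) \int[pmeas E x]_(t in cell a h j) g t.
Proof.
move=> mg ig; elim: K => [|K IH]; first by rewrite block0 Rintegral_set0 big_ord0.
rewrite blockS Rintegral_setU// ?IH ?big_ord_recr//.
- by apply: integrableS ig => //; exact: measurableU.
- by apply/disj_setPS; rewrite block_cell.
Qed.

Lemma integral_block_sqr_le K g x (c : nat -> R) : measurable_fun setT g ->
  (forall j, (j < K)%N -> forall t, cell a h j t -> `|g t| <= c j) ->
  (\int[pmeas E x]_(t in block a h K) (g t ^+ 2)%:E <=
   (\sum_(j < K) (c j * Nm (E (cell a h j) x)) ^+ 2)%:E)%E.
Proof.
move=> mg; have mg2 : measurable_fun setT (fun t => (g t ^+ 2)%:E).
  by apply/measurable_EFinP; exact: measurable_funX.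
elim: K => [|K IH] hc; first by rewrite block0 integral_set0 big_ord0.
rewrite blockS ge0_integral_setU//; last 3 first.
- exact: measurable_funTS.
- by move=> t _; rewrite lee_fin sqr_ge0.
- by apply/disj_setPS; rewrite block_cell.
rewrite big_ord_recr/= EFinD; apply: leeD.
  by apply: IH => j jK; apply: hc; rewrite ltnS ltnW.
apply: (@le_trans _ _ (\int[pmeas E x]_(t in cell a h K) cst (c K ^+ 2)%:E t))%E.
  apply: ge0_le_integral => //=; first by move=> t _; rewrite lee_fin sqr_ge0.
    exact: measurable_funTS.
  move=> t ct; rewrite lee_fin -[g t ^+ 2]real_normK ?num_real//.
  have gc := hc K (ltnSn K) t ct.
  by rewrite ler_pXn2r ?nnegrE// (le_trans _ gc).
by rewrite integral_cst// exprMn.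
Qed.

End step.

Definition window (n : nat) : set (measurableTypeR R) := [set` `[- n%:R, n%:R[].

Lemma measurable_window n : measurable (window n).
Proof. exact: measurable_itv. Qed.

Hint Resolve measurable_window : core.

Lemma window_nd : nondecreasing_seq window.
Proof.
move=> m n mn; apply/subsetPset; apply: subset_itv; rewrite bnd_simp.
  by rewrite lerN2 ler_nat.
by rewrite ler_nat.
Qed.

Lemma window_bigcup : \bigcup_n window n = setT.
Proof.
apply/seteqP; split=> // t _; exists (Num.truncn `|t|).+1 => //.
have := truncnS_gt `|t|; rewrite ltr_norml /window /= in_itv/= => /andP[a b].
by rewrite b (ltW a).
Qed.

Lemma pproj_window x e : 0 < e ->
  \forall n \near \oo, Nm (x - E (window n) x) <= e.
Proof.
move=> e0.
have : (pmeas E x \o window) n @[n --> \oo] --> pmeas E x (\bigcup_n window n).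
  apply: nondecreasing_cvg_mu => //; last exact: window_nd.
  by rewrite window_bigcup.
rewrite window_bigcup => /fine_cvgP[_ /cvgrPdist_le /(_ (e ^+ 2))].
rewrite exprn_gt0// => /(_ isT); apply: filterS => n /=.
rewrite -!/(Nm _) pprojT (pprojT_sqr E x (measurable_window n)) addrAC subrr add0r.
rewrite ger0_norm ?sqr_ge0// => h.
by rewrite -(ler_pXn2r (ltn0Sn 1)) ?nnegrE ?Nm_ge0// ltW.
Qed.

Lemma Rintegral_window g x e : measurable_fun setT g -> (forall t, 0 <= g t) ->
  (pmeas E x).-integrable setT (EFin \o g) -> 0 < e ->
  \forall n \near \oo, `|\int[pmeas E x]_t g t -
    \int[pmeas E x]_(t in window n) g t| <= e.
Proof.
move=> mg g0 ig e0.
have : (\int[pmeas E x]_(t in window n) (g t)%:E)%E @[n --> \oo] -->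
    (\int[pmeas E x]_(t in \bigcup_n window n) (g t)%:E)%E.
  apply: ge0_nondecreasing_set_cvg_integral => //; first exact: window_nd.
    by move=> n; apply/measurable_EFinP; exact: measurable_funTS.
  by move=> n t _; rewrite lee_fin.
rewrite window_bigcup -[X in _ --> X]fineK; last exact: integrable_fin_num.
by move=> /fine_cvgP[_ /cvgrPdist_le /(_ e e0)]; apply: filterS.
Qed.

(** The criterion for (x, y) to lie in the graph of g(K): on every window, Riemann sums of g against
    E x approximate the spectral cut-off of y. Membership in the domain and the weak identity are
    first obtained on windows; positivity of g gives the passage to the whole line by monotone
    convergence. *)
Lemma fcalc_riemann g x y : measurable_fun setT g -> (forall t, 0 <= g t) ->
  (forall n e, 0 < e -> exists h K (c : nat -> R),
    [/\ 0 <= h, K%:R * h = n%:R + n%:R,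
      forall j, (j < K)%N -> 0 <= c j /\
        forall t, cell (- n%:R) h j t -> `|g t - c j| <= e
    & Nm (\sum_(j < K) (c j)%:C *: E (cell (- n%:R) h j) x - E (window n) y) <= e]) ->
  fcalc E g (x, y).
Proof.
move=> mg g0 hR.
have block_window n h K : K%:R * h = n%:R + n%:R -> block (- n%:R) h K = window n.
  by move=> hK; rewrite /block hK addrA addNr add0r.
have mg2 : measurable_fun setT (fun t => (g t ^+ 2)%:E).
  by apply/measurable_EFinP; exact: measurable_funX.
(* With error 1, g <= c_j + 1 on cell j, and the sum of (c_j + 1)^2 |E(cell j) x|^2 is the squared
   norm of the Riemann sum plus the cut-off of x. This is at most (|y| + 1 + |x|)^2, whatever the
   window. *)
have dx : fc_dom E g x.
  have : (\int[pmeas E x]_(t in window n) (g t ^+ 2)%:E)%E @[n --> \oo] -->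
      (\int[pmeas E x]_(t in \bigcup_n window n) (g t ^+ 2)%:E)%E.
    apply: ge0_nondecreasing_set_cvg_integral => //; first exact: window_nd.
      by move=> n; exact: measurable_funTS.
    by move=> n t _; rewrite lee_fin sqr_ge0.
  rewrite window_bigcup => hlim.
  rewrite /fc_dom /=; apply: (@le_lt_trans _ _ ((Nm y + 1 + Nm x) ^+ 2)%:E); last exact: ltry.
  move/cvg_lim : (hlim) => <-//; apply: lime_le; first by apply/cvg_ex; eexists; exact: hlim.
  apply: nearW => n; have [h [K [c [h0 hK hc hN]]]] := hR n 1 ltr01.
  rewrite -(block_window _ _ _ hK).
  apply: le_trans (integral_block_sqr_le h0 x (c := fun j => c j + 1) mg _) _.
    move=> j jK t ct; have [c0 /(_ t ct) gc] := hc j jK.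
    rewrite -[g t](subrK (c j)) addrC; apply: le_trans (ler_normD _ _) _.
    by rewrite ger0_norm// lerD2l.
  rewrite lee_fin.
  rewrite (_ : \sum_(j < K) _ = \sum_(j < K) Nm (E (cell (- n%:R) h j) ((c j + 1)%:C *: x)) ^+ 2);
    last first.
    apply: eq_bigr => j _; rewrite pprojZ// NmZ NmR ger0_norm// addr_ge0//.
    by have [] := hc j (ltn_ord j).
  rewrite -(Nm_sum_cells _ h0 K (fun j => (c j + 1)%:C *: x)).
  rewrite ler_pXn2r ?nnegrE ?addr_ge0 ?Nm_ge0//.
  rewrite (_ : \sum_(j < K) _ = (\sum_(j < K) (c j)%:C *: E (cell (- n%:R) h j) x
     - E (window n) y) + E (window n) y + E (window n) x); last first.
    rewrite subrK -(block_window _ _ _ hK) (pproj_block _ h0) -big_split/=.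
    by apply: eq_bigr => j _; rewrite pprojZ// rmorphD/= scalerDl scale1r.
  apply: le_trans (NmD _ _) _; apply: lerD; last exact: Nm_pproj.
  apply: le_trans (NmD _ _) _; rewrite addrC; apply: lerD => //.
  exact: Nm_pproj.
split=> //= z dz.
pose X (k : 'I_4) := x + 'i%C ^+ k *: z.
have i1 (k : nat) : Nm ('i%C ^+ k : R[i]) = 1 by rewrite NmX Nm_i expr1n.
have dX k : fc_dom E g (X k) by apply: fc_domD.
have iX k := fc_dom_integrable mg (dX k).
pose Q n k := \int[pmeas E (X k)]_(t in window n) g t.
have key n : hip z (E (window n) y) = 4^-1 * \sum_(k < 4) 'i%C ^+ k * (Q n k)%:C.
  apply/eqP; rewrite -subr_eq0; apply/eqP; apply: Nm_small_eq0 => e e0.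
  (* The first summand pays for Cauchy-Schwarz against z, the second for the cell errors in the four
     polarized integrals; the 1 makes M positive. *)
  pose M := Nm z + 4^-1 * \sum_(k < 4) Nm (X k) ^+ 2 + 1.
  have M0 : 0 < M.
    rewrite ltr_wpDl// addr_ge0 ?Nm_ge0// mulr_ge0// sumr_ge0// => k _.
    exact: sqr_ge0.
  have eM : 0 < e / M by rewrite divr_gt0.
  have [h [K [c [h0 hK hc hN]]]] := hR n _ eM.
  pose s := \sum_(j < K) (c j)%:C *: E (cell (- n%:R) h j) x.
  have hs : hip z s = 4^-1 * \sum_(k < 4) 'i%C ^+ k *
      (\sum_(j < K) c j * Nm (E (cell (- n%:R) h j) (X k)) ^+ 2)%:C.
    rewrite hip_sumr mulr_sumr.
    transitivity (\sum_(j < K) \sum_(k < 4) 4^-1 * ('i%C ^+ k *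
        (c j * Nm (E (cell (- n%:R) h j) (X k)) ^+ 2)%:C)).
      apply: eq_bigr => j _; rewrite hipZr hip_pproj//.
      rewrite -[X in _ * X]mul1r -[X in _ * (X * _)](@mulVf _ 4)// -mulrA -polarization.
      rewrite mulrCA mulr_sumr -[RHS]mulr_sumr; congr (_ * _).
      apply: eq_bigr => k _; rewrite hipxx /X pprojD// pprojZ//.
      by rewrite (rmorphM _ (c j))/= mulrCA.
    rewrite exchange_big/=; apply: eq_bigr => k _.
    by rewrite -mulr_sumr -mulr_sumr rmorph_sum.
  have -> : hip z (E (window n) y) - 4^-1 * \sum_(k < 4) 'i%C ^+ k * (Q n k)%:C =
     4^-1 * (\sum_(k < 4) 'i%C ^+ k *
      (\sum_(j < K) c j * Nm (E (cell (- n%:R) h j) (X k)) ^+ 2 - Q n k)%:C)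
      - hip z (s - E (window n) y).
    rewrite hipBr hs opprB [RHS]addrCA; congr (_ + _).
    rewrite -mulrBr -sumrB -mulrN -sumrN; congr (_ * _).
    by apply: eq_bigr => k _; rewrite rmorphB/= mulrBr addrAC subrr add0r.
  apply: le_trans (NmB _ _) _.
  rewrite [leRHS](_ : e = e / M * M); last by rewrite divfK// lt0r_neq0.
  rewrite {2}/M mulrDr mulr1; apply: ler_wpDr; first exact: ltW.
  rewrite mulrDr addrC; apply: lerD.
    apply: le_trans (CauchySchwarz _ _) _.
    by rewrite mulrC ler_wpM2r// Nm_ge0.
  rewrite NmM NmV Nm_nat mulrCA ler_pM2l ?invr_gt0//.
  apply: le_trans (Nm_sum _ _ _) _; rewrite mulr_sumr; apply: ler_sum => k _.
  rewrite NmM i1 mul1r NmR /Q -(block_window _ _ _ hK) (Rintegral_block _ h0 K mg (iX k)) -sumrB.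
  apply: le_trans (ler_norm_sum _ _ _) _.
  apply: (@le_trans _ _ (\sum_(j < K) e / M * Nm (E (cell (- n%:R) h j) (X k)) ^+ 2)).
    apply: ler_sum => j _; rewrite distrC; apply: Rintegral_near_cst => //.
    by have [] := hc j (ltn_ord j).
  rewrite -mulr_sumr; apply: ler_wpM2l; first exact: ltW.
  rewrite -(Nm_sum_cells _ h0 K (fun=> X k)) -(pproj_block _ h0).
  by rewrite ler_pXn2r ?nnegrE ?Nm_ge0// Nm_pproj.
apply/eqP; rewrite -subr_eq0; apply/eqP; apply: Nm_small_eq0 => e e0.
pose M := Nm z + 1.
have M0 : 0 < M by rewrite ltr_wpDl// Nm_ge0.
have e2 : 0 < e / 2 by rewrite divr_gt0.
near \oo => n.
have -> : hip z y - fc_form E g z x = hip z (y - E (window n) y) -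
    4^-1 * \sum_(k < 4) 'i%C ^+ k * (\int[pmeas E (X k)]_t g t - Q n k)%:C.
  rewrite hipBr key /fc_form.
  under [X in _ = _ - _ * X]eq_bigr do rewrite rmorphB/= mulrBr.
  by rewrite sumrB mulrBr opprB addrA subrK.
apply: le_trans (NmB _ _) _; rewrite [leRHS]splitr; apply: lerD.
  apply: le_trans (CauchySchwarz _ _) _.
  have h : Nm (y - E (window n) y) <= e / 2 / M.
    by near: n; apply: pproj_window; rewrite divr_gt0.
  apply: le_trans (ler_wpM2l (Nm_ge0 _) h) _.
  rewrite mulrCA; apply: ler_piMr; first exact: ltW.
  by rewrite ler_pdivrMr// mul1r lerDl.
rewrite NmM NmV Nm_nat ler_pdivrMl//; apply: le_trans (Nm_sum _ _ _) _.
apply: (@le_trans _ _ (\sum_(k < 4) (e / 2))); last by rewrite sumr_const card_ord mulr_natl.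
apply: ler_sum => k _; rewrite NmM i1 mul1r NmR; move: k.
near: n; apply: filter_forall => k.
by apply: Rintegral_window.
Unshelve. all: by end_near.
Qed.

End riemann.

(** * Fourier coefficients of test functions *)

Section cint.
Variable R : realType.
Implicit Types (h : R -> R[i]) (w : R -> R) (t : R).
Local Notation mu := (@lebesgue_measure R).
Local Notation I := [set` `[(- pi : R), (pi : R)]].

Lemma cis0 : cis 0 = 1 :> R[i].
Proof. by rewrite /cis cos0 sin0. Qed.

Lemma cisD s t : cis (s + t) = cis s * cis t :> R[i].
Proof.
by rewrite /cis cosD sinD; apply/eqP; rewrite eq_complex/= addrC eqxx addrC eqxx.
Qed.

Lemma cisN t : cis (- t) = conjc (cis t) :> R[i].
Proof. by rewrite /cis cosN sinN. Qed.

Lemma Nm_cis t : Nm (cis t : R[i]) = 1.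
Proof.
apply/eqP; rewrite -(eqrXn2 (ltn0Sn 1)) ?Nm_ge0// Nm_sqr/= cos2Dsin2.
by rewrite expr1n.
Qed.

Lemma cisMn t n : cis (n%:R * t) = cis t ^+ n :> R[i].
Proof.
elim: n => [|n IH]; first by rewrite mul0r cis0 expr0.
by rewrite -natr1 mulrDl mul1r cisD IH exprSr.
Qed.

Lemma circle_cis t : circle (cis t : R[i]).
Proof. by rewrite /circle /= NmE Nm_cis. Qed.

Definition cint h : R[i] :=
  (\int[mu]_(t in I) complex.Re (h t)) +i* (\int[mu]_(t in I) complex.Im (h t)).

Definition ccont h : Prop :=
  continuous (fun t => complex.Re (h t)) /\ continuous (fun t => complex.Im (h t)).

Lemma npi_lt_pi : - pi < pi :> R.
Proof. by rewrite gtrN// pi_gt0. Qed.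

Lemma integrable_cont w : continuous w -> mu.-integrable I (EFin \o w).
Proof.
move=> cw; apply: continuous_compact_integrable; first exact: segment_compact.
exact: continuous_subspaceT.
Qed.

Lemma continuousMc (w1 w2 : R -> R) : continuous w1 -> continuous w2 ->
  continuous (fun t => w1 t * w2 t).
Proof. by move=> c1 c2 t; exact: (continuousM (c1 t) (c2 t)). Qed.

Lemma continuousZc k w : continuous w -> continuous (fun t => k * w t).
Proof. by move=> cw; apply: continuousMc => // t; exact: cst_continuous. Qed.

Lemma ccont_cst (c : R[i]) : ccont (fun=> c).
Proof. by split; apply: cst_continuous. Qed.

Lemma ReD (a b : R[i]) : complex.Re (a + b) = complex.Re a + complex.Re b.
Proof. by case: a b => a a' []. Qed.

Lemma ImD (a b : R[i]) : complex.Im (a + b) = complex.Im a + complex.Im b.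
Proof. by case: a b => a a' []. Qed.

Lemma ReM (a b : R[i]) : complex.Re (a * b) =
  complex.Re a * complex.Re b - complex.Im a * complex.Im b.
Proof. by case: a b => a a' []. Qed.

Lemma ImM (a b : R[i]) : complex.Im (a * b) =
  complex.Re a * complex.Im b + complex.Im a * complex.Re b.
Proof. by case: a b => a a' []. Qed.

Lemma ccontD h1 h2 : ccont h1 -> ccont h2 -> ccont (fun t => h1 t + h2 t).
Proof.
move=> [r1 i1] [r2 i2]; split=> t; [under eq_fun do rewrite ReD | under eq_fun do rewrite ImD].
  exact: (continuousD (r1 t) (r2 t)).
exact: (continuousD (i1 t) (i2 t)).
Qed.

Lemma ccontM h1 h2 : ccont h1 -> ccont h2 -> ccont (fun t => h1 t * h2 t).
Proof.
move=> [r1 i1] [r2 i2]; split=> t; [under eq_fun do rewrite ReM | under eq_fun do rewrite ImM].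
  exact: (continuousB (continuousM (r1 t) (r2 t)) (continuousM (i1 t) (i2 t))).
exact: (continuousD (continuousM (r1 t) (i2 t)) (continuousM (i1 t) (r2 t))).
Qed.

Lemma ccont_sum N (h : nat -> R -> R[i]) :
  (forall m, ccont (h m)) -> ccont (fun t => \sum_(m < N) h m t).
Proof.
move=> ch; elim: N => [|N IH].
  under eq_fun do rewrite big_ord0; exact: ccont_cst.
under eq_fun do rewrite big_ord_recr/=; exact: ccontD.
Qed.

Lemma ccont_cis w : continuous w -> ccont (fun t => cis (w t)).
Proof.
move=> cw; split=> t /=.
  exact: (continuous_comp (cw t) (@continuous_cos R _)).
exact: (continuous_comp (cw t) (@continuous_sin R _)).
Qed.

Lemma eq_cint h1 h2 : h1 =1 h2 -> cint h1 = cint h2.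
Proof. by move=> /funext ->. Qed.

Lemma cintD h1 h2 : ccont h1 -> ccont h2 ->
  cint (fun t => h1 t + h2 t) = cint h1 + cint h2.
Proof.
move=> [r1 i1] [r2 i2]; rewrite /cint.
under eq_Rintegral do rewrite ReD; under [X in _ +i* X = _]eq_Rintegral do rewrite ImD.
by rewrite !RintegralD//; exact: integrable_cont.
Qed.

Lemma cintZ (c : R[i]) h : ccont h -> cint (fun t => c * h t) = c * cint h.
Proof.
move=> [rh ih]; rewrite /cint.
under eq_Rintegral do rewrite ReM; under [X in _ +i* X = _]eq_Rintegral do rewrite ImM.
have cZ k w : continuous w -> mu.-integrable I (EFin \o (fun t => k * w t)).
  by move=> cw; apply: integrable_cont; exact: continuousZc.
rewrite RintegralB ?RintegralD//; try exact: cZ.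
rewrite !RintegralZl//; try exact: integrable_cont.
by case: c.
Qed.

Lemma cint_sum N (h : nat -> R -> R[i]) : (forall m, ccont (h m)) ->
  cint (fun t => \sum_(m < N) h m t) = \sum_(m < N) cint (h m).
Proof.
move=> ch; elim: N => [|N IH].
  rewrite big_ord0; transitivity (cint (fun t => 0 * h 0%N t)).
    by apply: eq_cint => t; rewrite big_ord0 mul0r.
  by rewrite cintZ// mul0r.
rewrite big_ord_recr/= -IH -cintD//; last exact: ccont_sum.
by apply: eq_cint => t; rewrite big_ord_recr.
Qed.

Lemma Rintegral_bound w (M : R) : continuous w -> (forall t, I t -> `|w t| <= M) ->
  `|\int[mu]_(t in I) w t| <= M * (2 * pi).
Proof.
move=> cw hM; have iw := integrable_cont cw.
apply: le_trans (le_normr_Rintegral _ iw) _ => //.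
have -> : M * (2 * pi) = \int[mu]_(t in I) M.
  rewrite Rintegral_cst//= lebesgue_measure_itv/= lte_fin npi_lt_pi/=.
  by rewrite opprK; ring.
apply: le_Rintegral => //.
- by have := integrable_abse iw.
- exact: (integrable_cont (fun t => @cst_continuous _ _ M t)).
Qed.

Lemma Nm_cint h (M : R) : ccont h -> (forall t, I t -> Nm (h t) <= M) ->
  Nm (cint h) <= M * (4 * pi).
Proof.
move=> [rh ih] hM; apply: le_trans (ler_Nm_ReIm _) _ => /=.
have -> : M * (4 * pi) = M * (2 * pi) + M * (2 * pi) by ring.
apply: lerD; apply: Rintegral_bound => // t It.
  exact: le_trans (ler_Re_Nm _) (hM t It).
exact: le_trans (ler_Im_Nm _) (hM t It).
Qed.

Lemma cint_opp h : ccont h -> cint (fun t => h (- t)) = cint h.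
Proof.
move=> [rh ih]; rewrite /cint /Rintegral; congr (_ +i* _); congr fine.
  have := @integration_by_substitution_oppr R (fun t => complex.Re (h t)) (- pi) pi.
  by rewrite opprK => ->//; [rewrite ltW// npi_lt_pi | exact: continuous_subspaceT].
have := @integration_by_substitution_oppr R (fun t => complex.Im (h t)) (- pi) pi.
by rewrite opprK => ->//; [rewrite ltW// npi_lt_pi | exact: continuous_subspaceT].
Qed.

(** For a half-integer index the exponential is not 2 pi-periodic, so boundary terms at pi and -pi
    need not cancel each other; flatness makes each of them vanish. *)
Definition flat_at_pi w := forall n, derive1n n w pi = 0 /\ derive1n n w (- pi) = 0.

Lemma smoothD w : smooth w -> smooth (derive1 w).
Proof. by move=> sw n x; rewrite -derive1Sn; exact: sw. Qed.

Lemma smooth_cont w : smooth w -> continuous w.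
Proof.
by move=> sw x; apply/differentiable_continuous/derivable1_diffP; exact: (sw 0%N).
Qed.

Lemma flatD w : flat_at_pi w -> flat_at_pi (derive1 w).
Proof. by move=> fw n; rewrite -derive1Sn; exact: fw. Qed.

Lemma by_parts w (G g : R -> R) : smooth w -> flat_at_pi w -> continuous g ->
  (forall x : R, is_derive x 1 G (g x)) ->
  \int[mu]_(t in I) (w t * g t) = - \int[mu]_(t in I) (derive1 w t * G t).
Proof.
move=> sw fw cg dG.
have cG : continuous G.
  move=> x; apply/differentiable_continuous/derivable1_diffP.
  exact: (@ex_derive _ _ _ _ _ _ _ (dG x)).
have LR (F : R -> R) : (forall x : R, derivable F x 1) -> derivable_oo_LRcontinuous F (- pi : R) pi.
  move=> dF; have cF : continuous F.
    by move=> x; apply/differentiable_continuous/derivable1_diffP.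
  by split=> //; [apply: cvg_at_right_filter|apply: cvg_at_left_filter]; exact: cF.
rewrite (@Rintegration_by_parts R w G (derive1 w) g)//.
- by have [/= -> ->] := fw 0%N; rewrite !mul0r subrr add0r.
- exact: npi_lt_pi.
- by apply: continuous_subspaceT; apply: smooth_cont; exact: smoothD.
- by apply: LR => x; exact: (sw 0%N).
- exact: continuous_subspaceT.
- by apply: LR => x; exact: (@ex_derive _ _ _ _ _ _ _ (dG x)).
- by move=> x _; rewrite derive1E; exact: (@derive_val _ _ _ _ _ _ _ (dG x)).
Qed.

(** Each integration by parts trades a factor k for a derivative of w and exchanges cosine and sine,
    so both bounds go through one induction. The derivative is again smooth and flat. *)
Lemma trig_decay n w : smooth w -> flat_at_pi w -> exists2 C : R, 0 <= C &
  forall k : R, `|k| ^+ n * `|\int[mu]_(t in I) (w t * cos (k * t))| <= C /\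
                `|k| ^+ n * `|\int[mu]_(t in I) (w t * sin (k * t))| <= C.
Proof.
have cs (k : R) : continuous (fun t => cos (k * t)).
  by move=> t; apply: continuous_comp; [exact: mulrl_continuous|exact: continuous_cos].
have sn (k : R) : continuous (fun t => sin (k * t)).
  by move=> t; apply: continuous_comp; [exact: mulrl_continuous|exact: continuous_sin].
elim: n w => [|n IH] w sw fw.
  have cw := smooth_cont sw.
  have [M hM] : exists M, forall t, I t -> `|w t| <= M.
    have [||c cI hc] := @EVT_max R (fun t => `|w t|) (- pi) pi.
    - by rewrite ltW// npi_lt_pi.
    - by apply: continuous_subspaceT => t; apply: continuous_comp; [exact: cw|exact: norm_continuous].
    by exists `|w c| => t It; apply: hc.
  have M0 : 0 <= M.
    apply: le_trans (hM 0 _); first exact: normr_ge0.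
    by rewrite /= in_itv/= oppr_le0 pi_ge0.
  exists (M * (2 * pi)); first by rewrite !mulr_ge0// pi_ge0.
  move=> k; rewrite expr0 !mul1r; split; apply: Rintegral_bound => [|t It].
  - exact: continuousMc.
  - rewrite normrM; apply: le_trans (hM t It).
    by rewrite ler_piMr// ler_norml cos_geN1 cos_le1.
  - exact: continuousMc.
  - rewrite normrM; apply: le_trans (hM t It).
    by rewrite ler_piMr// ler_norml sin_geN1 sin_le1.
have [C C0 hC] := IH _ (smoothD sw) (flatD fw).
exists C => // k; have [hc hs] := hC k; have cw := smooth_cont sw.
have cw' := smooth_cont (smoothD sw).
split.
  have : \int[mu]_(t in I) (w t * (k * cos (k * t))) =
      - \int[mu]_(t in I) (derive1 w t * sin (k * t)).
    apply: by_parts => // [|x]; first exact: continuousZc.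
    by apply: trigger_derive; rewrite /GRing.scale/=; ring.
  under eq_Rintegral do rewrite mulrCA.
  rewrite RintegralZl//; last first.
    by apply: integrable_cont; exact: continuousMc.
  by move=> e; rewrite exprSr -mulrA -normrM e normrN.
have : \int[mu]_(t in I) (w t * (k * sin (k * t))) =
    - \int[mu]_(t in I) (derive1 w t * - cos (k * t)).
  apply: by_parts => // [|x]; first exact: continuousZc.
  by apply: trigger_derive; rewrite /GRing.scale/=; ring.
under eq_Rintegral do rewrite mulrCA.
under [X in _ = - X]eq_Rintegral do rewrite mulrN -mulN1r.
rewrite !RintegralZl//.
- by move=> e; rewrite exprSr -mulrA -normrM e mulN1r opprK.
- by apply: integrable_cont; exact: continuousMc.
- by apply: integrable_cont; exact: continuousMc.
Qed.

End cint.

Section fourier.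
Variable R : realType.
Implicit Types (f : R[i] -> R[i]) (k : int) (t : R).
Local Notation mu := (@lebesgue_measure R).
Local Notation I := [set` `[(- pi : R), (pi : R)]].

Lemma fhatE f k : fhat f k =
  ((2 * pi)^-1)%:C * cint (fun t : R => f (cis t) * cis (- Defs.half k * t)).
Proof. by []. Qed.

Lemma supp_away f (p : R[i]) : ~ supp f p ->
  exists2 e : R, 0 < e & forall z, circle z -> Nm (z - p) < e -> f z = 0.
Proof.
move=> np; have : nbhs (p : R[i]^o) (~` supp f).
  apply: open_nbhs_nbhs; split => //; apply: closed_openC; exact: closed_closure.
move=> /nbhs_ballP[e /=]; rewrite ltcE/= => /andP[/eqP ei er] he.
exists (complex.Re e) => // z cz zp; apply/eqP/negP => /negP fz.
have : (~` supp f) z.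
  by apply: he; rewrite /ball/= distrC NmE ltcE/= -ei eqxx.
by apply; apply: subset_closure.
Qed.

Lemma test_ccont f : test_function f -> ccont (fun t : R => f (cis t)).
Proof. by move=> [su sv _ _]; split; apply: smooth_cont. Qed.

Lemma test_bounded f : test_function f ->
  exists2 M : R, 0 <= M & forall t, I t -> Nm (f (cis t)) <= M.
Proof.
move=> tf; have [cu cv] := test_ccont tf.
have bd (w : R -> R) : continuous w -> exists M, forall t, I t -> `|w t| <= M.
  move=> cw; have [||c cI hc] := @EVT_max R (fun t => `|w t|) (- pi) pi.
  - by rewrite ltW// npi_lt_pi.
  - apply: continuous_subspaceT => t.
    by apply: continuous_comp; [exact: cw|exact: norm_continuous].
  by exists `|w c| => t It; apply: hc.
have [M1 h1] := bd _ cu; have [M2 h2] := bd _ cv.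
have h t : I t -> Nm (f (cis t)) <= M1 + M2.
  by move=> It; apply: le_trans (ler_Nm_ReIm _) _; rewrite lerD ?h1 ?h2.
exists (M1 + M2) => //; apply: le_trans (h 0 _); first exact: Nm_ge0.
by rewrite /= in_itv/= oppr_le0 pi_ge0.
Qed.

Lemma test_zero_near f (p : R) : test_function f -> cis p = -1 :> R[i] ->
  \forall t \near p, f (cis t) = 0.
Proof.
move=> [_ _ _ sf] cp.
have [|e e0 he] := @supp_away f (-1); first by move=> /sf[_]; apply.
have e2 : 0 < e / 2 by rewrite divr_gt0.
have /cvgrPdist_lt /(_ _ e2) hc := @continuous_cos R p.
have /cvgrPdist_lt /(_ _ e2) hs := @continuous_sin R p.
move: cp => [c1 s1].
near=> t; apply: he; first exact: circle_cis.
apply: le_lt_trans (ler_Nm_ReIm _) _; rewrite [ltRHS]splitr /=; apply: ltrD.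
  by rewrite -c1 distrC; near: t.
by rewrite -s1 distrC; near: t.
Unshelve. all: by end_near. Qed.

Lemma zero_near_derive1n (w : R -> R) (p : R) n :
  (\forall t \near p, w t = 0) -> \forall t \near p, derive1n n w t = 0.
Proof.
move=> h; elim: n => // n /near_join; apply: filterS => t ht.
rewrite derive1nS derive1E -(derive_cst (0 : R) t (1 : R)).
by apply: near_eq_derive.
Qed.

Lemma test_flat f : test_function f ->
  flat_at_pi (fun t => complex.Re (f (cis t))) /\
  flat_at_pi (fun t => complex.Im (f (cis t))).
Proof.
move=> tf.
have h1 : cis pi = -1 :> R[i].
  by apply/eqP; rewrite /cis cospi sinpi eq_complex/= oppr0 !eqxx.
have h2 : cis (- pi) = -1 :> R[i].
  by apply/eqP; rewrite /cis cosN sinN cospi sinpi eq_complex/= oppr0 !eqxx.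
split=> n; split.
- by apply: (nbhs_singleton (zero_near_derive1n n (filterS _ (test_zero_near tf h1)))) => t ->.
- by apply: (nbhs_singleton (zero_near_derive1n n (filterS _ (test_zero_near tf h2)))) => t ->.
- by apply: (nbhs_singleton (zero_near_derive1n n (filterS _ (test_zero_near tf h1)))) => t ->.
- by apply: (nbhs_singleton (zero_near_derive1n n (filterS _ (test_zero_near tf h2)))) => t ->.
Qed.

Lemma pi2_gt0 : 0 < 2 * pi :> R.
Proof. by rewrite mulr_gt0// pi_gt0. Qed.

Lemma fhat_decay_half f n : test_function f -> exists2 C : R, 0 <= C &
  forall k, `|Defs.half k : R| ^+ n * Nm (fhat f k) <= C.
Proof.
move=> tf; have [su sv _ _] := tf; have [fu fv] := test_flat tf.
have [Cu Cu0 hu] := trig_decay n su fu; have [Cv Cv0 hv] := trig_decay n sv fv.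
exists ((2 * pi)^-1 * (2 * Cu + 2 * Cv)).
  by rewrite mulr_ge0 ?invr_ge0 ?(ltW pi2_gt0)// addr_ge0// mulr_ge0.
have pi0 : 0 <= (2 * pi)^-1 :> R by rewrite invr_ge0 (ltW pi2_gt0).
move=> k; rewrite fhatE NmM NmR (ger0_norm pi0) [leLHS]mulrCA; apply: ler_wpM2l => //.
set kk := Defs.half k : R; set u := fun t => complex.Re (f (cis t)).
set v := fun t => complex.Im (f (cis t)).
have cu : continuous u := smooth_cont su.
have cv : continuous v := smooth_cont sv.
have cs : continuous (fun t => cos (kk * t)).
  by move=> t; apply: continuous_comp; [exact: mulrl_continuous|exact: continuous_cos].
have sn : continuous (fun t => sin (kk * t)).
  by move=> t; apply: continuous_comp; [exact: mulrl_continuous|exact: continuous_sin].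
have ic (w1 w2 : R -> R) : continuous w1 -> continuous w2 ->
    mu.-integrable I (EFin \o (fun t => w1 t * w2 t)).
  by move=> c1 c2; apply: integrable_cont; exact: continuousMc.
have hre : \int[mu]_(t in I) complex.Re (f (cis t) * cis (- kk * t)) =
    \int[mu]_(t in I) (u t * cos (kk * t)) + \int[mu]_(t in I) (v t * sin (kk * t)).
  rewrite -RintegralD//; try exact: ic.
  by apply: eq_Rintegral => t _; rewrite ReM mulNr cisN/= mulrN opprK.
have him : \int[mu]_(t in I) complex.Im (f (cis t) * cis (- kk * t)) =
    \int[mu]_(t in I) (v t * cos (kk * t)) - \int[mu]_(t in I) (u t * sin (kk * t)).
  rewrite -RintegralB//; try exact: ic.
  by apply: eq_Rintegral => t _; rewrite ImM mulNr cisN/= mulrN addrC.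
have kn : 0 <= `|kk| ^+ n by rewrite exprn_ge0.
apply: le_trans (ler_wpM2l kn (ler_Nm_ReIm _)) _.
rewrite /cint /= hre him.
have [h1 h2] := hu kk; have [h3 h4] := hv kk.
apply: le_trans (ler_wpM2l kn (lerD (ler_normD _ _) (ler_normB _ _))) _.
rewrite !mulrDr !mulrDl; move: h1 h2 h3 h4; rewrite /u /v; lra.
Qed.

Lemma fhat_decay f n : test_function f -> exists2 C : R, 0 <= C &
  forall k, Nm (fhat f k) * (`|k|%N.+1%:R) ^+ n <= C.
Proof.
move=> tf; have [C0 C00 h0] := fhat_decay_half 0 tf.
have [C C1 h] := fhat_decay_half n tf.
(* For k <> 0, |k| + 1 <= 4 |k/2|; the bound for exponent 0 takes care of k = 0. *)
exists (C0 + 4 ^+ n * C); first by rewrite addr_ge0// mulr_ge0// exprn_ge0.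
move=> k; have [->|k0] := eqVneq k 0.
  rewrite absz0 expr1n mulr1; have := h0 0; rewrite expr0 mul1r => /le_trans; apply.
  by rewrite lerDl mulr_ge0// exprn_ge0.
apply: ler_wpDl => //; rewrite mulrC.
apply: le_trans (_ : (4 * `|Defs.half k|) ^+ n * Nm (fhat f k) <= _).
  rewrite ler_wpM2r ?Nm_ge0//; apply: lerXn2r; rewrite ?nnegrE ?mulr_ge0// /Defs.half normrM normfV.
  rewrite [`|2|]ger0_norm// -intr_norm -abszE.
  have : (1 <= `|k|)%N by rewrite absz_gt0.
  rewrite -(ler_nat R) -natr1; lra.
by rewrite exprMn -mulrA ler_wpM2l// exprn_ge0.
Qed.

Lemma fhat_conj f k : test_function f -> fhat (f \o conjc) k = fhat f (- k).
Proof.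
move=> tf; rewrite !fhatE; congr (_ * _).
have c : ccont (fun t : R => f (cis t) * cis (- Defs.half (- k) * t)).
  apply: ccontM; first exact: test_ccont.
  by apply: ccont_cis; exact: mulrl_continuous.
rewrite -(cint_opp c); apply: eq_cint => t; rewrite cisN; congr (_ * cis _).
by rewrite /Defs.half rmorphN/=; ring.
Qed.

(** The closed support misses 1 and -1, hence stays at distance e from both. As |e^(it) -+ 1|^2 = 2
    -+ 2 cos t, this gives |cos t| <= 1 - e^2/2, and then sin t >= e^2/2 because e^2 <= 2. *)
Lemma upper_sin_ge f : supp f `<=` upper_circle ->
  exists2 s : R, 0 < s & forall t : R, f (cis t) != 0 -> s <= sin t.
Proof.
move=> sf.
have [|e1 e10 h1] := @supp_away f 1; first by move=> /sf[_]/=; rewrite ltxx.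
have [|e2 e20 h2] := @supp_away f (-1); first by move=> /sf[_]/=; rewrite oppr0 ltxx.
pose e := Num.min e1 e2; have e0 : 0 < e by rewrite lt_min e10.
exists (e ^+ 2 / 2); first by rewrite divr_gt0// exprn_gt0.
move=> t ft; have cc := @circle_cis R t.
have sp : 0 < sin t.
  by have [] : upper_circle (cis t) by apply: sf; apply: subset_closure.
have n1 : e ^+ 2 <= 2 - 2 * cos t.
  have h : e <= Nm (cis t - 1).
    rewrite leNgt; apply: contra ft => h; rewrite h1//.
    by apply: lt_le_trans h _; rewrite ge_min lexx.
  have := lerXn2r 2 (ltW e0) (Nm_ge0 _) h; rewrite Nm_sqr/=.
  by have := cos2Dsin2 t; rewrite subr0; nra.
have n2 : e ^+ 2 <= 2 + 2 * cos t.
  have h : e <= Nm (cis t - -1).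
    rewrite leNgt; apply: contra ft => h; rewrite h2//.
    by apply: lt_le_trans h _; rewrite ge_min lexx orbT.
  have := lerXn2r 2 (ltW e0) (Nm_ge0 _) h; rewrite Nm_sqr/=.
  by have := cos2Dsin2 t; rewrite oppr0 subr0 opprK; nra.
have e2' : 0 <= e ^+ 2 by rewrite sqr_ge0.
rewrite -(ler_pXn2r (ltn0Sn 1)) ?nnegrE ?(ltW sp) ?divr_ge0//.
have := cos2Dsin2 t; set E := e ^+ 2 in n1 n2 e2' *; nra.
Qed.

End fourier.

(** * The generating function of the polynomials p_m *)

Section complex_calculus.
Variable R : realType.
Implicit Types (F G : R -> R[i]) (r t x : R) (a b c D : R[i]).

Lemma is_derive_mul (f g : R -> R) r (u v : R) :
  is_derive r 1 f u -> is_derive r 1 g v ->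
  is_derive r 1 (fun s => f s * g s) (u * g r + f r * v).
Proof.
move=> df dg; rewrite (_ : (fun s => _) = f * g)//.
have := is_deriveM df dg => h; apply: (is_derive_eq h).
by rewrite /GRing.scale/= addrC mulrC.
Qed.

(** Only the radius r of z = r e^(ix) is ever differentiated, so a componentwise real derivative
    suffices. *)
Definition cder F r D : Prop :=
  is_derive r (1 : R) (fun s => complex.Re (F s)) (complex.Re D) /\
  is_derive r (1 : R) (fun s => complex.Im (F s)) (complex.Im D).

Lemma cder_cst c r : cder (fun=> c) r 0.
Proof. by split; exact: is_derive_cst. Qed.

Lemma cderD F G r a b : cder F r a -> cder G r b ->
  cder (fun s => F s + G s) r (a + b).
Proof.
move=> [f1 f2] [g1 g2]; split.
  rewrite (_ : (fun s => _) = (fun s => complex.Re (F s)) + (fun s => complex.Re (G s))).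
    by rewrite ReD; exact: is_deriveD.
  by apply/funext => s; rewrite ReD.
rewrite (_ : (fun s => _) = (fun s => complex.Im (F s)) + (fun s => complex.Im (G s))).
  by rewrite ImD; exact: is_deriveD.
by apply/funext => s; rewrite ImD.
Qed.

Lemma cderM F G r a b : cder F r a -> cder G r b ->
  cder (fun s => F s * G s) r (a * G r + F r * b).
Proof.
move=> [f1 f2] [g1 g2]; split.
  rewrite (_ : (fun s => _) =
      (fun s => complex.Re (F s) * complex.Re (G s)) -
      (fun s => complex.Im (F s) * complex.Im (G s))).
    have := is_deriveB (is_derive_mul f1 g1) (is_derive_mul f2 g2).
    by move/is_derive_eq; apply; rewrite ReD !ReM; ring.
  by apply/funext => s; rewrite ReM.
rewrite (_ : (fun s => _) =
    (fun s => complex.Re (F s) * complex.Im (G s)) +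
    (fun s => complex.Im (F s) * complex.Re (G s))).
  have := is_deriveD (is_derive_mul f1 g2) (is_derive_mul f2 g1).
  by move/is_derive_eq; apply; rewrite ImD !ImM; ring.
by apply/funext => s; rewrite ImM.
Qed.

Lemma cder_eq F r a b : cder F r a -> a = b -> cder F r b.
Proof. by move=> ? <-. Qed.

Lemma cderZ c F r a : cder F r a -> cder (fun s => c * F s) r (c * a).
Proof.
by move=> dF; apply: cder_eq (cderM (cder_cst c r) dF) _; rewrite mul0r add0r.
Qed.

Lemma cder_sum N (F : nat -> R -> R[i]) r (a : nat -> R[i]) :
  (forall m, cder (F m) r (a m)) ->
  cder (fun s => \sum_(m < N) F m s) r (\sum_(m < N) a m).
Proof.
move=> dF; elim: N => [|N IH].
  rewrite big_ord0; under eq_fun do rewrite big_ord0; exact: cder_cst.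
rewrite big_ord_recr/=; under eq_fun do rewrite big_ord_recr/=; exact: cderD.
Qed.

Lemma cderX (w : R[i]) m r :
  cder (fun s => (s%:C * w) ^+ m) r (m%:R * w * (r%:C * w) ^+ m.-1).
Proof.
have d1 : cder (fun s => s%:C * w) r w.
  apply: (@cder_eq _ _ (1 * w + r%:C * 0)); last by rewrite mul1r mulr0 addr0.
  apply: cderM; last exact: cder_cst.
  by split => /=; [exact: is_derive_id|exact: is_derive_cst].
elim: m => [|m IH].
  by rewrite mul0r mul0r; under eq_fun do rewrite expr0; exact: cder_cst.
under eq_fun do rewrite exprS; apply: cder_eq (cderM d1 IH) _ => /=.
case: m {IH} => [|m]; first by rewrite !expr0 !mul0r mulr0 addr0 mul1r.
by rewrite /= -[in RHS]natr1 exprS; ring.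
Qed.

Definition cexp a : R[i] := (expR (complex.Re a))%:C * cis (complex.Im a).

Lemma Nm_cexp a : Nm (cexp a) = expR (complex.Re a).
Proof. by rewrite /cexp NmM Nm_cis mulr1 NmR ger0_norm// expR_ge0. Qed.

Lemma cexpD a b : cexp (a + b) = cexp a * cexp b.
Proof. by rewrite /cexp ReD ImD expRD cisD rmorphM/=; ring. Qed.

Lemma cexp0 : cexp 0 = 1.
Proof. by rewrite /cexp/= expR0 cis0 mul1r. Qed.

Lemma cder_cexp F r a : cder F r a ->
  cder (fun s => cexp (F s)) r (a * cexp (F r)).
Proof.
move=> [f1 f2].
have de := is_derive1_comp (is_derive_expR _) f1.
have dc := is_derive1_comp (is_derive_cos _) f2.
have ds := is_derive1_comp (is_derive_sin _) f2.
split.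
  rewrite (_ : (fun s => _) =
      (fun s => expR (complex.Re (F s)) * cos (complex.Im (F s)))).
    by apply: is_derive_eq (is_derive_mul de dc) _; rewrite /cexp !(ReM, ImM)/=; ring.
  by apply/funext => s; rewrite /cexp ReM/=; ring.
rewrite (_ : (fun s => _) =
    (fun s => expR (complex.Re (F s)) * sin (complex.Im (F s)))).
  by apply: is_derive_eq (is_derive_mul de ds) _; rewrite /cexp !(ReM, ImM)/=; ring.
by apply/funext => s; rewrite /cexp ImM/=; ring.
Qed.

Lemma real_mean_value (f df : R -> R) (u v M : R) : u <= v ->
  (forall r, u <= r <= v -> is_derive r (1 : R) f (df r) /\ `|df r| <= M) ->
  `|f v - f u| <= M * (v - u).
Proof.
move=> uv h.
have [||c cI ->] := @MVT_segment R f df u v uv.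
- by move=> r; rewrite in_itv/= => /andP[r1 r2]; apply h; rewrite !ltW.
- apply: derivable_within_continuous => r rI.
  by have [d _] := h r rI; exact: (@ex_derive _ _ _ _ _ _ _ d).
by rewrite normrM (ger0_norm (_ : 0 <= v - u)) ?subr_ge0// ler_wpM2r ?subr_ge0//; apply h.
Qed.

(** The mean value theorem is applied to the real and the imaginary part separately, whence the
    factor 2. *)
Lemma complex_mean_value F (D : R -> R[i]) (u v M : R) : u <= v ->
  (forall r, u <= r <= v -> cder F r (D r) /\ Nm (D r) <= M) ->
  Nm (F v - F u) <= 2 * (M * (v - u)).
Proof.
move=> uv h; apply: le_trans (ler_Nm_ReIm _) _.
rewrite -[2]/(1 + 1) mulrDl mul1r !raddfB/=; apply: lerD.
  apply: (@real_mean_value (fun r => complex.Re (F r)) (fun r => complex.Re (D r))) => // r /h[[d _] hM].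
  by split => //; apply: le_trans (ler_Re_Nm _) hM.
apply: (@real_mean_value (fun r => complex.Im (F r)) (fun r => complex.Im (D r))) => // r /h[[_ d] hM].
by split => //; apply: le_trans (ler_Im_Nm _) hM.
Qed.

(* |1 + r e^{ix}|^2 *)
Definition sqmod x r : R := 1 + 2 * (r * cos x) + r ^+ 2.

(* the principal logarithm of 1 + r e^{ix}, for |r| <= 1 and r e^{ix} != -1 *)
Definition logp x r : R[i] :=
  (ln (sqmod x r) / 2) +i* atan (r * sin x / (1 + r * cos x)).

Lemma sqmodE x r : sqmod x r = (1 + r * cos x) ^+ 2 + (r * sin x) ^+ 2.
Proof. by have := cos2Dsin2 x; rewrite /sqmod; nra. Qed.

(** Completing the square, |1 + r e^(ix)|^2 = (r + cos x)^2 + sin(x)^2. The bound is uniform in r up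
    to the circle. *)
Lemma sqmod_sin x r : sin x ^+ 2 <= sqmod x r.
Proof. by have := cos2Dsin2 x; have := sqr_ge0 (r + cos x); rewrite /sqmod; nra. Qed.

Lemma sqmod_ge x r : `|r| <= 1 -> (1 - `|r|) ^+ 2 <= sqmod x r.
Proof.
move=> r1; rewrite /sqmod; have c1 := cos_max x.
have : - `|r| <= r * cos x.
  have : `|r * cos x| <= `|r| by rewrite normrM ler_piMr.
  by rewrite ler_norml => /andP[].
by rewrite -(real_normK (num_real r)); nra.
Qed.

Lemma sqmod_le4 x r : `|r| <= 1 -> sqmod x r <= 4.
Proof.
move=> r1; rewrite /sqmod; have c1 := cos_max x.
have : r * cos x <= `|r|.
  have : `|r * cos x| <= `|r| by rewrite normrM ler_piMr.
  by rewrite ler_norml => /andP[].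
by rewrite -(real_normK (num_real r)); have := normr_ge0 r; nra.
Qed.

(** On the closed disc 1 + z has positive real part unless z = -1, so the arctangent in [logp] is
    the true argument. *)
Lemma oneDcos_gt0 x r : `|r| <= 1 -> 0 < sqmod x r -> 0 < 1 + r * cos x.
Proof.
move=> r1 p0; have c1 := cos_max x.
have h : - 1 <= r * cos x.
  have : `|r * cos x| <= 1 by rewrite normrM mulr_ile1.
  by rewrite ler_norml => /andP[].
rewrite lt_neqAle; apply/andP; split; last by lra.
apply/eqP => e; have e1 : r * cos x = -1 by lra.
have : r * sin x = 0.
  have := cos2Dsin2 x; have : r ^+ 2 <= 1.
    by rewrite -(real_normK (num_real r)) expr_le1.
  move=> r2 cs; apply/eqP; rewrite -sqrf_eq0 eq_le sqr_ge0 andbT; nra.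
by move=> e2; move: p0; rewrite sqmodE -e e2 !expr0n addr0 ltxx.
Qed.

(** The usual derivative e^(ix) / (1 + r e^(ix)), with the denominator made real by multiplying with
    its conjugate. *)
Lemma cder_logp x r : `|r| <= 1 -> 0 < sqmod x r ->
  cder (logp x) r ((r%:C + cis x) / (sqmod x r)%:C).
Proof.
move=> r1 p0; have q0 := oneDcos_gt0 r1 p0.
have dr : is_derive r (1 : R) (fun s : R => s) 1 by exact: is_derive_id.
have dc (k : R) : is_derive r (1 : R) (fun=> k) 0 by exact: is_derive_cst.
have dk (k : R) : is_derive r (1 : R) (fun s : R => s * k) k.
  by apply: is_derive_eq (is_derive_mul dr (dc k)) _; rewrite mulr0 addr0 mul1r.
have dp : is_derive r (1 : R) (sqmod x) (2 * (r + cos x)).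
  rewrite (_ : sqmod x = (fun=> 1) + (fun s => s * (2 * cos x)) + (fun s => s * s)).
    apply: is_derive_eq (is_deriveD (is_deriveD (dc 1) (dk (2 * cos x))) (is_derive_mul dr dr)) _.
    by rewrite add0r; ring.
  by apply/funext => s; rewrite /sqmod !fctE; ring.
have dq : is_derive r (1 : R) (fun s : R => 1 + s * cos x) (cos x).
  by apply: is_derive_eq (is_deriveD (dc 1) (dk _)) _; rewrite add0r.
have e : (r%:C + cis x) / (sqmod x r)%:C =
    ((r + cos x) / sqmod x r) +i* (sin x / sqmod x r).
  rewrite -fmorphV/= /cis; apply/eqP; rewrite eq_complex/=.
  by apply/andP; split; apply/eqP; ring.
rewrite e; split => /=.
  apply: is_derive_eq (is_derive_mul (is_derive1_comp (is_derive1_ln p0) dp) (dc _)) _.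
  by rewrite mulr0 addr0; field; exact: lt0r_neq0.
have du : is_derive r (1 : R) (fun s => s * sin x / (1 + s * cos x)) (sin x / (1 + r * cos x) ^+ 2).
  have := is_derive_mul (dk (sin x)) (@is_deriveV _ (fun s => 1 + s * cos x) r (cos x) 1 (lt0r_neq0 q0) dq).
  move/is_derive_eq; apply; rewrite /GRing.scale/=; field; exact: lt0r_neq0.
apply: is_derive_eq (is_derive1_comp (is_derive1_atan _) du) _.
have q0' := lt0r_neq0 q0; have p0' := lt0r_neq0 p0.
have -> : 1 + (r * sin x / (1 + r * cos x)) ^+ 2 =
    sqmod x r / (1 + r * cos x) ^+ 2 by rewrite sqmodE; field.
move: (1 + r * cos x) (sqmod x r) q0' p0' => q p q0' p0'; field.
by rewrite q0' p0'.
Qed.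

End complex_calculus.

(** * The three-term recurrence and its differential equation *)

Section generating_function.
Variable R : realType.
Implicit Types (r x : R) (m N k : nat).

(* mp_pair d tau m is (p_{m-1}, p_m), with p_{-1} = 0 *)
Fixpoint mp_pair (d : int) (tau : R[i]) (m : nat) : R[i] * R[i] :=
  match m with
  | 0 => (0, 1)
  | n.+1 => let: (a, b) := mp_pair d tau n in
            (b, ((d + n%:Z - 1)%:~R * a + tau * b) / n.+1%:R)
  end.

Definition mp d tau m := (mp_pair d tau m).2.
Definition mp_prev d tau m := (mp_pair d tau m).1.

Lemma mp_prevS d tau m : mp_prev d tau m.+1 = mp d tau m.
Proof. by rewrite /mp_prev /mp /=; case: (mp_pair d tau m). Qed.

Lemma mp_rec d tau m : m.+1%:R * mp d tau m.+1 =
  (d + m%:Z - 1)%:~R * mp_prev d tau m + tau * mp d tau m.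
Proof.
rewrite /mp_prev /mp /=; case: (mp_pair d tau m) => a b /=.
by rewrite mulrC divfK// pnatr_eq0.
Qed.

Lemma Nm_int (z : int) : Nm (z%:~R : R[i]) = `|z|%N%:R.
Proof.
by apply: complexI; rewrite -NmE -intr_norm -abszE rmorph_nat.
Qed.

(** Bernoulli's inequality 1 + k/M <= (1 + 1/M)^k for M = m + 1, without denominators: the inductive
    step of [mp_bound]. *)
Lemma succ_pow_le m k : (m.+1%:R ^+ k * (m.+1%:R + k%:R) <= m.+1%:R * m.+2%:R ^+ k :> R).
Proof.
have -> : (m.+2%:R : R) = m.+1%:R + 1 by rewrite natr1.
have : 0 < (m.+1%:R : R) by rewrite ltr0n.
move: (m.+1%:R) => M M0.
elim: k => [|k IH]; first by rewrite !expr0 addr0 mul1r mulr1.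
apply: (@le_trans _ _ ((M + 1) * (M ^+ k * (M + k%:R)))); last first.
  by rewrite exprS [leRHS]mulrCA ler_wpM2l// addr_ge0// ltW.
have -> : M ^+ k.+1 * (M + k.+1%:R) = M ^+ k * (M * (M + (k%:R + 1))).
  by rewrite exprS natr1; ring.
have -> : (M + 1) * (M ^+ k * (M + k%:R)) = M ^+ k * ((M + 1) * (M + k%:R)) by ring.
rewrite ler_wpM2l ?exprn_ge0 ?(ltW M0)//; have := ler0n R k; nra.
Qed.

Lemma abs_weight d m : (absz (d + m%:Z - 1)%R)%:R <= `|d|%N%:R + m.+1%:R :> R.
Proof. by rewrite -natrD ler_nat; lia. Qed.

(** One step of the recurrence enlarges the bound by at most 1 + k/(m+1), so the growth is
    polynomial. The previous value is carried along because the recurrence reaches back two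
    steps. *)
Lemma mp_bound d tau k m : `|d|%N%:R + Nm tau <= k%:R :> R ->
  Nm (mp d tau m) <= m.+1%:R ^+ k /\ Nm (mp_prev d tau m) <= m.+1%:R ^+ k.
Proof.
move=> hk; elim: m => [|m [IH1 IH2]].
  by rewrite /mp /mp_prev/= Nm1 Nm0 expr1n.
have p0 : 0 < (m.+1%:R : R) by rewrite ltr0n.
split; last first.
  rewrite mp_prevS; apply: le_trans IH1 _.
  by apply: lerXn2r; rewrite ?nnegrE// ler_nat.
rewrite -(ler_pM2l p0) -[in X in X * Nm _]Nm_nat -NmM mp_rec.
apply: le_trans (NmD _ _) _; rewrite !NmM Nm_int.
apply: le_trans (succ_pow_le m k).
have dm := abs_weight d m.
apply: le_trans (lerD (ler_pM _ (Nm_ge0 _) dm IH2) (ler_wpM2l (Nm_ge0 _) IH1)) _ => //.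
rewrite -mulrDl mulrC ler_wpM2l ?exprn_ge0//; lra.
Qed.

Definition psum d tau N x r : R[i] :=
  \sum_(m < N) mp d tau m * (r%:C * cis x) ^+ m.

Definition dpsum d tau N x r : R[i] :=
  \sum_(m < N) mp d tau m * (m%:R * cis x * (r%:C * cis x) ^+ m.-1).

Lemma cder_psum d tau N x r :
  cder (psum d tau N x) r (dpsum d tau N x r).
Proof.
apply: (@cder_sum R N (fun m s => mp d tau m * (s%:C * cis x) ^+ m) r
  (fun m => mp d tau m * (m%:R * cis x * (r%:C * cis x) ^+ m.-1))).
by move=> m; apply: cderZ; exact: cderX.
Qed.

(* The truncations satisfy the differential equation
   (1 - z^2) P' = (d z + tau) P up to two boundary terms. *)
Definition prem d tau N (z : R[i]) : R[i] :=
  - (N%:R * mp d tau N * z ^+ N.-1) - (d + N%:Z - 1)%:~R * mp_prev d tau N * z ^+ N.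

(** A new term cancels the old boundary terms through the recurrence and leaves those of the next
    degree. The factor [cis x] appears because [dpsum] differentiates in r, not in z. *)
Lemma psum_ode d tau N x r : let z := r%:C * cis x in
  (1 - z ^+ 2) * dpsum d tau N x r =
  cis x * ((d%:~R * z + tau) * psum d tau N x r + prem d tau N z).
Proof.
move=> z; elim: N => [|N IH].
  by rewrite /psum /dpsum /prem !big_ord0 /mp_prev /= mul0r !(mulr0, mul0r, oppr0, addr0).
rewrite /psum /dpsum !big_ord_recr/= -/(psum d tau N x r) -/(dpsum d tau N x r).
rewrite mulrDr IH -/z /prem mp_rec mp_prevS/=.
have -> : (d + N.+1%:Z - 1)%:~R = d%:~R + N%:R :> R[i].
  by rewrite -addn1 PoszD addrA addrK rmorphD.
case: N {IH} => [|N]; last by rewrite /= !exprS; ring.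
by rewrite /mp_prev /mp /= !expr0 !mul0r; ring.
Qed.

(* With z = r e^{ix}, a logarithm of (1 - z^2)^(- d/2) ((1 + z) / (1 - z))^(tau/2),
   the solution of that equation with value 1 at z = 0 *)
Definition alog (d : int) (tau : R[i]) x r : R[i] :=
  (- (d%:~R / 2)) * (logp x r + logp x (- r)) + (tau / 2) * (logp x r - logp x (- r)).

Lemma cder_opp (F : R -> R[i]) r D : cder F (- r) D -> cder (fun s => F (- s)) r (- D).
Proof.
move=> [f1 f2].
have dr : is_derive r (1 : R) (fun s : R => - s) (- 1).
  by have := is_deriveN (is_derive_id r (1 : R)).
split; rewrite raddfN/=.
  by apply: is_derive_eq (@is_derive1_comp R _ (fun s : R => - s) r _ _ f1 dr) _; rewrite mulrN1.
by apply: is_derive_eq (@is_derive1_comp R _ (fun s : R => - s) r _ _ f2 dr) _; rewrite mulrN1.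
Qed.

(** Partial fractions with 1 - z^2 = (1 + z)(1 - z): each logarithmic derivative times its own
    factor gives e^(ix), up to sign. D is described only after multiplication by 1 - z^2, the form
    in which it meets [psum_ode]. *)
Lemma cder_alog d tau x r : `|r| <= 1 -> 0 < sqmod x r -> 0 < sqmod x (- r) ->
  exists2 D, cder (alog d tau x) r D &
    (1 - (r%:C * cis x) ^+ 2) * D = cis x * (d%:~R * (r%:C * cis x) + tau).
Proof.
move=> r1 p0 m0; have rN1 : `|- r| <= 1 by rewrite normrN.
have dp := cder_logp r1 p0; have dm := cder_opp (cder_logp rN1 m0).
have hp s : 0 < sqmod x s -> ((s%:C + cis x) / (sqmod x s)%:C) * (1 + s%:C * cis x) = cis x.
  move=> s0; rewrite mulrAC.
  have n0 : (sqmod x s)%:C != 0 :> R[i].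
    by rewrite (inj_eq (@complexI _)) lt0r_neq0.
  apply: (mulIf n0); rewrite divfK//.
  have cs : cos x ^+ 2 = 1 - sin x ^+ 2 by rewrite -(cos2Dsin2 x) addrK.
  rewrite /sqmod /cis; apply/eqP.
  rewrite eq_complex/=; apply/andP; split; apply/eqP; ring: cs.
have := hp r p0; have := hp (- r) m0; move: dp dm.
set lp := (_ / _); set lm := (((- r)%:C + _) / _) => dp dm hm hp'.
exists ((- (d%:~R / 2)) * (lp + - lm) + (tau / 2) * (lp - - lm)).
  apply: cderD; apply: cderZ; first exact: cderD.
  apply: cderD => //; rewrite -mulN1r.
  rewrite (_ : (fun s => _) = (fun s => -1 * logp x (- s))); first exact: cderZ.
  by apply/funext => s; rewrite mulN1r.
have hm1 : lm * (1 - r%:C * cis x) = cis x by rewrite -[RHS]hm rmorphN/= mulNr.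
have -> : (1 - (r%:C * cis x) ^+ 2) *
    (- (d%:~R / 2) * (lp - lm) + tau / 2 * (lp - - lm)) =
    (- (d%:~R / 2) + tau / 2) * (1 - r%:C * cis x) * (lp * (1 + r%:C * cis x))
    + (d%:~R / 2 + tau / 2) * (1 + r%:C * cis x) * (lm * (1 - r%:C * cis x)).
  by ring.
by rewrite hp' hm1; field.
Qed.

End generating_function.

(** * Truncated sums versus the closed form inside the disc *)

Section boundary.
Variable R : realType.
Implicit Types (r x q t : R) (N k : nat) (d : int).

(** Writing r^(N+1) as the (k+1)-st power of e^(-h(N+1)), this is y e^(-y) <= 1 at y = h(N+1),
    raised to the power k + 1. *)
Lemma pow_geom_bounded k (r : R) : 0 < r -> r < 1 ->
  exists2 C : R, 0 <= C & forall N, N.+1%:R ^+ k * r ^+ N <= C.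
Proof.
move=> r0 r1; set h := - ln r / k.+1%:R.
have h0 : 0 < h by rewrite divr_gt0 ?ltr0n// oppr_gt0 ln_lt0// r0.
exists (h^-1 ^+ k.+1 / r).
  by rewrite divr_ge0 ?exprn_ge0 ?invr_ge0 ?ltW.
move=> N; rewrite ler_pdivlMr// -mulrA -exprSr.
have rE : r ^+ N.+1 = expR (- (h * N.+1%:R)) ^+ k.+1.
  rewrite -expRM_natr -[in LHS](lnK (x := r)) ?posrE// -expRM_natr; congr expR.
  by rewrite /h; field; rewrite addrC natr1 pnatr_eq0.
rewrite rE.
apply: (@le_trans _ _ (N.+1%:R ^+ k.+1 * expR (- (h * N.+1%:R)) ^+ k.+1)).
  rewrite ler_wpM2r ?exprn_ge0 ?expR_ge0// exprS ler_peMl ?exprn_ge0//.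
  by rewrite ler1n.
rewrite -exprMn; apply: lerXn2r; rewrite ?nnegrE ?mulr_ge0 ?expR_ge0 ?invr_ge0 ?(ltW h0)//.
rewrite expRN ler_pdivrMr ?expR_gt0// ler_pdivlMl//.
by apply: le_trans (expR_ge1Dx _); rewrite lerDr.
Qed.

Definition imag_tau t : R[i] := 'i%C * (t / pi)%:C.

(** Here q is a lower and 4 an upper bound for |1 + z|^2 and |1 - z|^2, which controls the
    logarithms of the moduli. The two arguments differ by at most pi, so the factor t/(2 pi)
    contributes at most |t|/2. *)
Definition alog_bound d t q : R :=
  `|d|%N%:R / 2 * (`|ln q| + ln 4) + `|t| / 2.

Lemma abs_ln_bound q p : 0 < q -> q <= p -> p <= 4 -> `|ln p| <= `|ln q| + ln 4 :> R.
Proof.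
move=> q0 qp p4; have p0 := lt_le_trans q0 qp.
have l4 : 0 <= ln 4 :> R by rewrite ln_ge0// ler1n.
have h1 : ln q <= ln p by rewrite ler_ln.
have h2 : ln p <= ln 4 by rewrite ler_ln// posrE.
rewrite ler_norml; apply/andP; split.
  have : - `|ln q| <= ln q by rewrite lerNl -normrN ler_norm.
  lra.
by have := normr_ge0 (ln q); lra.
Qed.

Lemma abs_atan x : `|atan x| <= pi / 2 :> R.
Proof. by rewrite ler_norml !ltW// ?atan_gtNpi2 ?atan_ltpi2. Qed.

Lemma Re_alog d t x r : complex.Re (alog d (imag_tau t) x r) =
  - (d%:~R / 2) * (complex.Re (logp x r) + complex.Re (logp x (- r)))
  - t / pi / 2 * (complex.Im (logp x r) - complex.Im (logp x (- r))).
Proof.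
have -> : alog d (imag_tau t) x r =
   (- (d%:~R / 2))%:C * (logp x r + logp x (- r)) +
   ('i%C * (t / pi / 2)%:C) * (logp x r - logp x (- r)).
  rewrite /alog /imag_tau rmorphN !(rmorphM _ _ (2^-1))/= !fmorphV/= rmorph_int rmorph_nat.
  by ring.
case: (logp x r) (logp x (- r)) => [a a'] [b b'] /=; ring.
Qed.

Lemma Re_alog_bound d t q x r : 0 < q -> q <= sqmod x r -> q <= sqmod x (- r) ->
  `|r| <= 1 -> `|complex.Re (alog d (imag_tau t) x r)| <= alog_bound d t q.
Proof.
move=> q0 q1 q2 r1; have r1' : `|- r| <= 1 by rewrite normrN.
have l1 := abs_ln_bound q0 q1 (sqmod_le4 x r1).
have l2 := abs_ln_bound q0 q2 (sqmod_le4 x r1').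
rewrite Re_alog /= /alog_bound; apply: le_trans (ler_normB _ _) _; apply: lerD.
  rewrite normrM normrN normrM normfV -intr_norm -abszE [`|2|]ger0_norm// -mulrDl.
  rewrite ler_wpM2l ?mulr_ge0 ?invr_ge0 ?ler0n//.
  rewrite normrM normfV [`|2|]ger0_norm// ler_pdivrMr//.
  by apply: le_trans (ler_normD _ _) _; lra.
rewrite !normrM !normfV (ger0_norm (pi_ge0 R)) [`|2|]ger0_norm//.
have := abs_atan (r * sin x / (1 + r * cos x)).
have := abs_atan (- r * sin x / (1 + - r * cos x)).
set u := atan _; set v := atan _ => hu hv.
apply: (@le_trans _ _ (`|t| / pi / 2 * pi)).
  rewrite ler_wpM2l ?mulr_ge0 ?invr_ge0 ?pi_ge0//.
  by apply: le_trans (ler_normB _ _) _; lra.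
by rewrite mulrAC divfK// lt0r_neq0// pi_gt0.
Qed.

Lemma sqmodN x r : sqmod (- x) r = sqmod x r.
Proof. by rewrite /sqmod cosN. Qed.

Lemma logpN x r : logp (- x) r = conjc (logp x r).
Proof. by rewrite /logp /= sqmodN cosN sinN mulrN mulNr atanN. Qed.

(** Reflection conjugates both logarithms. As tau is imaginary, the difference of the arguments
    enters the real part, the source of exp(t/2), and their sum only changes the phase. *)
Lemma alogN d t x r : alog d (imag_tau t) (- x) r = alog d (imag_tau t) x r +
  ((t / pi) * (complex.Im (logp x r) - complex.Im (logp x (- r)))) +i*
  (d%:~R * (complex.Im (logp x r) + complex.Im (logp x (- r)))).
Proof.
have e : d%:~R / 2 = (d%:~R / 2)%:C :> R[i].
  by rewrite rmorphM/= fmorphV/= rmorph_int rmorph_nat.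
have e' : imag_tau t / 2 = 'i%C * (t / pi / 2)%:C.
  by rewrite /imag_tau (rmorphM _ _ (2^-1))/= fmorphV/= rmorph_nat mulrA.
rewrite /alog !logpN e e'; move: (t / pi) {e e'} => T.
case: (logp x r) (logp x (- r)) => [a a'] [b b'] /=.
by apply/eqP; rewrite eq_complex/=; apply/andP; split; apply/eqP; field.
Qed.

Lemma logp0 x : logp x 0 = 0.
Proof.
apply/eqP; rewrite eq_complex/= /sqmod !mul0r mulr0 expr0n !addr0 ln1 !mul0r.
by rewrite atan0 !eqxx.
Qed.

(** Integrating factor: the derivative of exp(-alog) psum contains only the truncation remainder of
    [psum_ode], which is O(1/N) uniformly in x for r <= r0 < 1; the product equals 1 at r = 0. *)
Lemma psum_close d t r0 : 0 < r0 -> r0 < 1 ->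
  exists2 K : R, 0 <= K & forall N x,
    Nm (psum d (imag_tau t) N.+1 x r0 - cexp (alog d (imag_tau t) x r0)) <= K / N.+1%:R.
Proof.
move=> r00 r01; set tau := imag_tau t.
have [k hk] : exists k, `|d|%N%:R + Nm tau <= k%:R.
  by exists (Num.truncn (`|d|%N%:R + Nm tau)).+1; rewrite ltW// truncnS_gt.
(* Of the two extra powers of N, one absorbs the factor N in [prem], the other produces the rate
   1/(N+1). *)
have [C C0 hC] := pow_geom_bounded k.+2 r00 r01.
pose q := (1 - r0) ^+ 2.
have q0 : 0 < q by rewrite exprn_gt0// subr_gt0.
pose B := expR (alog_bound d t q).
have B0 : 0 <= B by rewrite expR_ge0.
have h1 : 0 < 1 - r0 ^+ 2 by rewrite subr_gt0 expr_lt1// ltW.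
pose M := B * ((`|d|%N%:R + 2) * (C / r0)) / (1 - r0 ^+ 2).
have M0 : 0 <= M.
  by rewrite divr_ge0 ?(ltW h1)// mulr_ge0// mulr_ge0 ?addr_ge0 ?ler0n// divr_ge0// ltW.
exists (B * (2 * M)); first by rewrite mulr_ge0// mulr_ge0.
move=> N x.
have rbd r : 0 <= r <= r0 -> [/\ `|r| <= 1, q <= sqmod x r & q <= sqmod x (- r)].
  move=> /andP[ra rb]; have rn : `|r| <= 1 by rewrite ger0_norm//; lra.
  split=> //.
    apply: le_trans (sqmod_ge x rn); rewrite ger0_norm//.
    by apply: lerXn2r; rewrite ?nnegrE ?subr_ge0; lra.
  have rn' : `|- r| <= 1 by rewrite normrN.
  apply: le_trans (sqmod_ge x rn'); rewrite normrN ger0_norm//.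
  by apply: lerXn2r; rewrite ?nnegrE ?subr_ge0; lra.
have cB r : 0 <= r <= r0 ->
    Nm (cexp (alog d tau x r)) <= B /\ Nm (cexp (- alog d tau x r)) <= B.
  move=> /rbd[ra rb rc]; have := Re_alog_bound d t q0 rb rc ra.
  rewrite !Nm_cexp !ler_expR ler_norml -/tau raddfN/= => /andP[? ?].
  by split => //; rewrite lerNl.
pose Y r := cexp (- alog d tau x r) * psum d tau N.+1 x r.
have dY r : 0 <= r <= r0 -> exists2 D, cder Y r D & Nm D <= M / N.+1%:R.
  move=> rI; have [rn q1 q2] := rbd r rI; have [_ cN] := cB r rI.
  have [r0' rr] := andP rI.
  have [D dA hD] := cder_alog d tau rn (lt_le_trans q0 q1) (lt_le_trans q0 q2).
  have dAN : cder (fun s => - alog d tau x s) r (- D).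
    rewrite -mulN1r (_ : (fun s => _) = (fun s => -1 * alog d tau x s)).
      exact: cderZ.
    by apply/funext => s; rewrite mulN1r.
  exists (- D * cexp (- alog d tau x r) * psum d tau N.+1 x r +
      cexp (- alog d tau x r) * dpsum d tau N.+1 x r).
    exact: cderM (cder_cexp dAN) (cder_psum _ _ _ _ _).
  set z := r%:C * cis x; set D' := (X in Nm X).
  have zr : Nm z = r by rewrite NmM NmR Nm_cis mulr1 ger0_norm.
  have n1 : 1 - r0 ^+ 2 <= Nm (1 - z ^+ 2).
    have := NmD (1 - z ^+ 2) (z ^+ 2); rewrite subrK Nm1 NmX zr => h.
    have : r ^+ 2 <= r0 ^+ 2 by apply: lerXn2r; rewrite ?nnegrE// ltW.
    lra.
  have key : (1 - z ^+ 2) * D' = cexp (- alog d tau x r) * (cis x * prem d tau N.+1 z).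
    have := psum_ode d tau N.+1 x r; rewrite -/z /= => ode.
    have -> : (1 - z ^+ 2) * D' =
       - ((1 - z ^+ 2) * D) * (cexp (- alog d tau x r) * psum d tau N.+1 x r) +
       cexp (- alog d tau x r) * ((1 - z ^+ 2) * dpsum d tau N.+1 x r).
      by rewrite /D'; ring.
    rewrite ode hD -/z; ring.
  have rem : Nm (prem d tau N.+1 z) <= (`|d|%N%:R + 2) * (C / r0) / N.+1%:R.
    pose P : R := N.+2%:R ^+ k.
    have [b1 b2] : Nm (mp d tau N.+1) <= P /\ Nm (mp_prev d tau N.+1) <= P.
      exact: mp_bound.
    rewrite /prem/=; apply: le_trans (NmB _ _) _; rewrite NmN !NmM !NmX zr Nm_nat Nm_int.
    have z1 : r ^+ N <= r0 ^+ N by apply: lerXn2r; rewrite ?nnegrE// ltW.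
    have z2 : r ^+ N.+1 <= r0 ^+ N.
      apply: le_trans z1; rewrite exprS ler_piMl ?exprn_ge0//; lra.
    have rN0 : 0 <= r0 ^+ N by rewrite exprn_ge0// ltW.
    have dm := @abs_weight R d N.+1.
    have P0 : 0 <= P := exprn_ge0 k (ler0n R N.+2).
    have hC' := hC N.+1; rewrite 2!exprS -/P in hC'.
    move: P b1 b2 P0 hC' => P b1 b2 P0 hC'.
    apply: (@le_trans _ _ ((`|d|%N%:R + 2) * N.+2%:R * P * r0 ^+ N)).
      apply: (@le_trans _ _ (N.+1%:R * P * r0 ^+ N +
          (`|d|%N%:R + N.+2%:R) * P * r0 ^+ N)).
        apply: lerD; apply: ler_pM => //; rewrite ?mulr_ge0 ?exprn_ge0 ?Nm_ge0//.
          by rewrite ler_wpM2l.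
        by apply: ler_pM => //; rewrite Nm_ge0.
      rewrite -!mulrDl ler_wpM2r// ler_wpM2r//.
      have := ler0n R `|d|%N; have := ler0n R N.+1.
      have -> : (N.+2%:R : R) = N.+1%:R + 1 by rewrite natr1.
      move: (N.+1%:R : R) (`|d|%N%:R : R) => n1' n2'; nra.
    rewrite -!mulrA ler_wpM2l ?addr_ge0//.
    rewrite [leRHS]mulrA ler_pdivlMr ?ltr0n// ler_pdivlMr//.
    apply: le_trans hC'; rewrite exprS.
    have -> : N.+2%:R * (P * r0 ^+ N) * N.+1%:R * r0 =
       N.+1%:R * (N.+2%:R * P * (r0 * r0 ^+ N)) by ring.
    have -> : N.+2%:R * (N.+2%:R * P) * (r0 * r0 ^+ N) =
       N.+2%:R * (N.+2%:R * P * (r0 * r0 ^+ N)) by ring.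
    rewrite ler_wpM2r ?ler_nat// !mulr_ge0//; exact: ltW.
  have n0 : 0 < Nm (1 - z ^+ 2) by exact: lt_le_trans n1.
  have : Nm (1 - z ^+ 2) * Nm D' <= B * ((`|d|%N%:R + 2) * (C / r0) / N.+1%:R).
    rewrite -NmM key NmM [Nm (cis x * _)]NmM Nm_cis mul1r.
    by apply: ler_pM => //; exact: Nm_ge0.
  move=> hh; rewrite /M mulrAC ler_pdivlMr//.
  have -> : B * ((`|d|%N%:R + 2) * (C / r0)) / N.+1%:R =
     B * ((`|d|%N%:R + 2) * (C / r0) / N.+1%:R) by ring.
  apply: le_trans hh; rewrite mulrC ler_wpM2r ?Nm_ge0//.
have Y0 : Y 0 = 1.
  rewrite /Y /alog oppr0 !logp0 addr0 subr0 !mulr0 addr0 oppr0 cexp0 mul1r /psum.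
  rewrite big_ord_recl/= expr0 mulr1 big1 ?addr0// => i _.
  by rewrite mul0r expr0n/= mulr0.
have [D hDD] : exists D : R -> R[i], forall r, 0 <= r <= r0 ->
    cder Y r (D r) /\ Nm (D r) <= M / N.+1%:R.
  (* The derivative is only known on [0, r0]; the value 0 elsewhere merely makes it a function. *)
  have /choice[D hD] : forall r, exists D, 0 <= r <= r0 -> cder Y r D /\ Nm D <= M / N.+1%:R.
    move=> r; case: (boolP (0 <= r <= r0)) => [/dY[D ? ?]|_]; first by exists D.
    by exists 0.
  by exists D.
have := complex_mean_value (ltW r00) hDD; rewrite Y0 subr0 => hY.
have rr0 : 0 <= r0 <= r0 by rewrite lexx (ltW r00).
have [cP _] := cB r0 rr0.
have -> : psum d tau N.+1 x r0 - cexp (alog d tau x r0) = cexp (alog d tau x r0) * (Y r0 - 1).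
  by rewrite mulrBr mulr1 /Y mulrA -cexpD subrr cexp0 mul1r.
rewrite NmM -mulrA; apply: ler_pM; rewrite ?Nm_ge0//.
apply: le_trans hY _; rewrite -[leRHS]mulrA ler_wpM2l//.
by apply: ler_piMr; [rewrite divr_ge0|exact: ltW].
Qed.

End boundary.

(** * Comparison of P(z) and P(conj z) near the upper semicircle *)

Section twist.
Variable R : realType.
Implicit Types (r x s t : R) (N k : nat) (d : int) (f : R[i] -> R[i]).

Lemma i_exp d : ('i%C : R[i]) ^ d = cis (d%:~R * (pi / 2)).
Proof.
have i1 : 'i%C = cis (pi / 2) :> R[i] by rewrite /cis cos_pihalf sin_pihalf.
case: d => n; first by rewrite -exprnP i1 -cisMn.
rewrite NegzE -exprnN i1 rmorphN/= mulNr cisN -[in RHS]pmulrn cisMn.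
apply: (@mulIf _ (cis (pi / 2) ^+ n.+1)).
  by apply/eqP => /(congr1 (@Nm R _)); rewrite NmX Nm_cis expr1n Nm0 => /eqP; rewrite oner_eq0.
rewrite mulVf; last first.
  by apply/eqP => /(congr1 (@Nm R _)); rewrite NmX Nm_cis expr1n Nm0 => /eqP; rewrite oner_eq0.
by rewrite mulrC -sqr_normc NmE NmX Nm_cis !expr1n.
Qed.

Lemma Nm_i_exp d : Nm (('i%C : R[i]) ^ d) = 1.
Proof. by rewrite i_exp Nm_cis. Qed.

Lemma half_angle x : sin x = 2 * sin (x / 2) * cos (x / 2) /\
  cos x = 2 * cos (x / 2) ^+ 2 - 1 /\ cos x = 1 - 2 * sin (x / 2) ^+ 2.
Proof.
have e : x / 2 + x / 2 = x by rewrite -splitr.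
have h := cos2Dsin2 (x / 2).
have := sinD (x / 2) (x / 2); have := cosD (x / 2) (x / 2); rewrite e => hc hs.
by rewrite hs hc; split; [|split]; nra.
Qed.

(** On the circle, 1 + e^(ix) points in direction x/2 and 1 - e^(ix) in direction x/2 - pi/2. The
    difference pi/2 yields exp(t/2); the sum x - pi/2 accounts for the factor i^d. *)
Lemma Im_logp_boundary x : 0 < x < pi ->
  complex.Im (logp x 1) = x / 2 /\ complex.Im (logp x (-1)) = x / 2 - pi / 2.
Proof.
move=> /andP[x0 xpi]; have [sx [c1 c2]] := half_angle x.
have c0 : 0 < cos (x / 2) by apply: cos_gt0_pihalf; apply/andP; split; lra.
have s0 : 0 < sin (x / 2) by apply: sin_gt0_pi; apply/andP; split; lra.
split=> /=.
  rewrite !mul1r; have -> : sin x / (1 + cos x) = tan (x / 2).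
    by rewrite c1 sx /tan; field; rewrite lt0r_neq0//=; nra.
  by rewrite tanK// in_itv/=; apply/andP; split; lra.
rewrite !mulN1r; have -> : - sin x / (1 - cos x) = tan (x / 2 - pi / 2).
  rewrite /tan sinB cosB cos_pihalf sin_pihalf !mulr0 !mulr1 sub0r add0r.
  by rewrite c2 sx; field; rewrite lt0r_neq0//=; nra.
by rewrite tanK// in_itv/=; apply/andP; split; lra.
Qed.

(** The argument has r-derivative sin x / |1 + z|^2, at most 1 / sin x by [sqmod_sin]. *)
Lemma Im_logp_lip s x (u v : R) : 0 < s -> s <= sin x -> -1 <= u -> u <= v -> v <= 1 ->
  `|complex.Im (logp x v) - complex.Im (logp x u)| <= s^-1 * (v - u).
Proof.
move=> s0 sx u1 uv v1.
have sx0 : 0 < sin x by exact: lt_le_trans sx.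
apply: (@real_mean_value R (fun r => complex.Im (logp x r)) (fun r => sin x / sqmod x r)) => //.
move=> r /andP[ur rv].
have r1 : `|r| <= 1 by rewrite ler_norml; apply/andP; split; lra.
have p0 : 0 < sqmod x r by apply: lt_le_trans (sqmod_sin x r); rewrite exprn_gt0.
have [_] := cder_logp r1 p0; rewrite ImM -fmorphV/= mulr0 add0r add0r => h; split => //.
rewrite (ger0_norm (divr_ge0 (ltW sx0) (ltW p0))) ler_pdivrMr// ler_pdivlMl//.
by apply: le_trans (sqmod_sin x r); rewrite expr2 ler_wpM2r// ltW.
Qed.

Lemma Nm_cexp_sub1 (w : R[i]) : Nm (cexp w - 1) <= 2 * (Nm w * expR `|complex.Re w|).
Proof.
have d1 s : cder (fun u => u%:C * w) s w.
  by have := cderX w 1 s; rewrite expr0 mulr1 mul1r.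
have h s : 0 <= s <= 1 ->
    cder (fun u => cexp (u%:C * w)) s (w * cexp (s%:C * w)) /\
    Nm (w * cexp (s%:C * w)) <= Nm w * expR `|complex.Re w|.
  move=> /andP[s0 s1]; split; first exact: cder_cexp.
  rewrite NmM ler_wpM2l ?Nm_ge0// Nm_cexp ler_expR ReM/= mul0r subr0.
  apply: le_trans (ler_norm _) _; rewrite normrM ger0_norm// ler_piMl//.
have := complex_mean_value (F := fun u => cexp (u%:C * w)) ler01 h.
by rewrite mul1r mul0r cexp0 subr0 mulr1.
Qed.

(** The quotient of the two terms is [cexp W], where W vanishes at r = 1 and is Lipschitz in r. The
    constant depends on x only through the lower bound s of sin x. *)
Lemma boundary_twist d t s : 0 < s -> exists2 K : R, 0 <= K &
  forall x r, - pi <= x <= pi -> s <= sin x -> 0 <= r <= 1 ->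
  Nm ('i%C ^ d * cis (- (d%:~R / 2) * x) * cexp (alog d (imag_tau t) (- x) r)
      - (expR (t / 2))%:C * cis (d%:~R / 2 * x) * cexp (alog d (imag_tau t) x r))
  <= K * (1 - r).
Proof.
move=> s0.
pose B := expR (alog_bound d t (s ^+ 2)).
(* 2/s adds the Lipschitz constants 1/s of the two arguments. *)
pose T := `|t| / pi * (2 / s); pose L := `|d|%N%:R * (2 / s).
have pi0 := pi_gt0 R.
have s2 : 0 <= 2 / s by rewrite divr_ge0// ltW.
have T0 : 0 <= T by rewrite mulr_ge0// divr_ge0// ltW.
have L0 : 0 <= L by rewrite mulr_ge0.
exists (expR (t / 2) * B * (2 * ((T + L) * expR T))).
  by rewrite !mulr_ge0 ?expR_ge0 ?addr_ge0.
move=> x r /andP[x1 x2] sx /andP[r0 r1].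
have sx0 : 0 < sin x by exact: lt_le_trans sx.
(* On [-pi, pi] a positive sine singles out the upper semicircle. *)
have xpi : 0 < x < pi.
  apply/andP; split.
    rewrite ltNge; apply/negP => xle.
    have : 0 <= sin (- x) by apply: sin_ge0_pi; apply/andP; split; lra.
    by rewrite sinN; lra.
  rewrite lt_neqAle x2 andbT; apply/eqP => e; move: sx0; rewrite e sinpi ltxx//.
have [b1 b2] := Im_logp_boundary xpi.
have l1 := Im_logp_lip s0 sx (_ : -1 <= r) r1 (lexx 1).
have l2 := Im_logp_lip s0 sx (lexx (-1)) (_ : -1 <= - r) (_ : - r <= 1).
have {}l1 := l1 ltac:(lra); have {}l2 := l2 ltac:(lra) ltac:(lra).
rewrite b1 in l1; rewrite b2 in l2.
set P := complex.Im (logp x r) in l1; set Q := complex.Im (logp x (- r)) in l2.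
pose W : R[i] := ((t / pi) * ((P - Q) - pi / 2)) +i* (d%:~R * ((P + Q) - (x - pi / 2))).
have key : 'i%C ^ d * cis (- (d%:~R / 2) * x) * cexp (alog d (imag_tau t) (- x) r)
    - (expR (t / 2))%:C * cis (d%:~R / 2 * x) * cexp (alog d (imag_tau t) x r) =
    (expR (t / 2))%:C * cis (d%:~R / 2 * x) * cexp (alog d (imag_tau t) x r) * (cexp W - 1).
  rewrite mulrBr mulr1 alogN cexpD -/P -/Q; congr (_ - _).
  set A := cexp (alog _ _ _ _).
  have -> : 'i%C ^ d * cis (- (d%:~R / 2) * x) *
      (A * cexp (t / pi * (P - Q) +i* (d%:~R * (P + Q)))) =
      A * (('i%C ^ d * cis (- (d%:~R / 2) * x)) * cexp (t / pi * (P - Q) +i* (d%:~R * (P + Q)))).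
    by ring.
  have -> : (expR (t / 2))%:C * cis (d%:~R / 2 * x) * A * cexp W =
     A * ((expR (t / 2))%:C * (cis (d%:~R / 2 * x) * cexp W)) by ring.
  congr (A * _); rewrite i_exp -cisD /cexp /W /=.
  have e1 u a b : cis u * ((expR a)%:C * cis b) = (expR a)%:C * cis (u + b) :> R[i].
    by rewrite cisD; ring.
  have e2 u a b e : (expR e)%:C * (cis u * ((expR a)%:C * cis b)) =
      (expR (e + a))%:C * cis (u + b) :> R[i].
    by rewrite cisD expRD (rmorphM _ (expR e))/=; ring.
  rewrite e1 e2.
  have pn := lt0r_neq0 pi0.
  congr ((expR _)%:C * cis _); last by field.
  by move: pi pn => p pn; field.
rewrite key 3!NmM NmR (ger0_norm (expR_ge0 _)) Nm_cis mulr1.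
have q1 : s ^+ 2 <= sqmod x r.
  by apply: le_trans (sqmod_sin x r); apply: lerXn2r => //; rewrite nnegrE ltW.
have q2 : s ^+ 2 <= sqmod x (- r).
  by apply: le_trans (sqmod_sin x (- r)); apply: lerXn2r => //; rewrite nnegrE ltW.
have rn : `|r| <= 1 by rewrite ger0_norm.
have hB : Nm (cexp (alog d (imag_tau t) x r)) <= B.
  rewrite Nm_cexp ler_expR; apply: le_trans (ler_norm _) _.
  by apply: Re_alog_bound => //; rewrite exprn_gt0.
have u1 : `|P - Q - pi / 2| <= 2 / s * (1 - r).
  have -> : P - Q - pi / 2 = - (x / 2 - P) - (Q - (x / 2 - pi / 2)) by lra.
  apply: le_trans (ler_normB _ _) _; rewrite normrN.
  by apply: le_trans (lerD l1 l2) _; rewrite opprK (addrC (- r)); lra.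
have u2 : `|P + Q - (x - pi / 2)| <= 2 / s * (1 - r).
  have -> : P + Q - (x - pi / 2) = - (x / 2 - P) + (Q - (x / 2 - pi / 2)) by lra.
  apply: le_trans (ler_normD _ _) _; rewrite normrN.
  by apply: le_trans (lerD l1 l2) _; rewrite opprK (addrC (- r)); lra.
have w1 : `|complex.Re W| <= T * (1 - r).
  rewrite /= !normrM normfV (ger0_norm (ltW pi0)) /T -[leRHS]mulrA.
  by apply: ler_wpM2l => //; rewrite divr_ge0// ltW.
have w2 : `|complex.Im W| <= L * (1 - r).
  by rewrite /= normrM -intr_norm -abszE /L -[leRHS]mulrA ler_wpM2l.
rewrite -!mulrA ler_wpM2l ?expR_ge0//.
have r1' : 0 <= 1 - r by rewrite subr_ge0.
apply: ler_pM => //; rewrite ?Nm_ge0//.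
apply: le_trans (Nm_cexp_sub1 _) _. rewrite ler_wpM2l//.
have -> : (T + L) * (expR T * (1 - r)) = ((T + L) * (1 - r)) * expR T by ring.
apply: ler_pM; rewrite ?Nm_ge0 ?expR_ge0//.
  by apply: le_trans (ler_Nm_ReIm _) _; rewrite mulrDl lerD.
by rewrite ler_expR; apply: le_trans w1 _; rewrite ler_piMr//; lra.
Qed.

End twist.

(** * The scalar identity, with a rate uniform in t *)

Section twisted_sums.
Variable R : realType.
Implicit Types (r x t : R) (N k m : nat) (d : int) (f : R[i] -> R[i]).

(* The identity exp(t/2) sum_m p_m(t) phi_m = i^d sum_m p_m(t) phi'_m, where phi
   and phi' are the coefficients of f and f o j, reads sum_m p_m(t) twist m = 0. *)
Definition twist f d t m : R[i] :=
  'i%C ^ d * fhat f (d + m.*2%:Z) - (expR (t / 2))%:C * fhat f (- (d + m.*2%:Z)).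

(** Converts decay in the index |d + 2m| into decay in m, also for negative d, where that index may
    be small. *)
Lemma weight_shift d m : (m.+1 <= `|d|.+1 * `|(d + m.*2%:Z)%R|.+1)%N.
Proof.
have : (m + m <= `|d| + `|(d + m.*2%:Z)%R|)%N by lia.
by nia.
Qed.

Lemma coeff_decay f d n : test_function f -> exists2 C : R, 0 <= C &
  forall m, Nm (fhat f (d + m.*2%:Z)) * m.+1%:R ^+ n <= C /\
            Nm (fhat f (- (d + m.*2%:Z))) * m.+1%:R ^+ n <= C.
Proof.
move=> tf; have [C C0 hC] := fhat_decay n tf.
exists (`|d|%N.+1%:R ^+ n * C); first by rewrite mulr_ge0// exprn_ge0.
have h j m : `|j|%N = `|(d + m.*2%:Z)%R|%N ->
    Nm (fhat f j) * m.+1%:R ^+ n <= `|d|%N.+1%:R ^+ n * C.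
  move=> ej; have mw : m.+1%:R ^+ n <= (`|d|%N.+1%:R * `|j|%N.+1%:R) ^+ n :> R.
    by apply: lerXn2r; rewrite ?nnegrE ?mulr_ge0// -natrM ler_nat ej weight_shift.
  apply: le_trans (ler_wpM2l (Nm_ge0 _) mw) _.
  by rewrite exprMn mulrCA ler_wpM2l ?exprn_ge0.
by move=> m; split; apply: h => //; rewrite abszN.
Qed.

Lemma twist_decay f d n T : test_function f -> exists2 C : R, 0 <= C &
  forall t m, `|t| <= T -> Nm (twist f d t m) * m.+1%:R ^+ n <= C.
Proof.
move=> tf; have [C C0 hC] := coeff_decay d n tf.
exists ((1 + expR (T / 2)) * C); first by rewrite mulr_ge0// addr_ge0// expR_ge0.
move=> t m tT; have [h1 h2] := hC m.
have e0 : expR (t / 2) <= expR (T / 2).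
  by rewrite ler_expR ler_wpM2r ?invr_ge0//; apply: le_trans tT; exact: ler_norm.
have p0 : 0 <= m.+1%:R ^+ n :> R by rewrite exprn_ge0.
apply: le_trans (ler_wpM2r p0 (NmB _ _)) _.
rewrite (NmM (_ ^ d)) (NmM (expR _)%:C) Nm_i_exp mul1r NmR (ger0_norm (expR_ge0 _)) mulrDl [leRHS]mulrDl mul1r.
apply: lerD => //; rewrite -mulrA; apply: ler_pM => //; rewrite ?expR_ge0//.
by rewrite mulr_ge0// Nm_ge0.
Qed.

Lemma sum_mp_bound d T : exists k, forall t m, `|t| <= T ->
  Nm (mp d (imag_tau t) m) <= m.+1%:R ^+ k.
Proof.
have pi0 := pi_gt0 R.
exists (Num.truncn (`|d|%N%:R + T / pi)).+1 => t m tT.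
apply: (mp_bound (k := _) m _).1; apply: (@le_trans _ _ (`|d|%N%:R + T / pi)).
  rewrite lerD2l /imag_tau NmM Nm_i mul1r NmR normrM normfV (ger0_norm (ltW pi0)).
  by rewrite ler_wpM2r// invr_ge0 ltW.
by rewrite ltW// truncnS_gt.
Qed.

(** Exponent k + 3: k beats the growth of p_m, 2 gives summability, and 1 pays for the factor m + 1
    that the Abel summation consumes. *)
Lemma mp_twist_bound f d T : test_function f -> exists2 C : R, 0 <= C &
  forall t m, `|t| <= T ->
    m.+1%:R * Nm (mp d (imag_tau t) m * twist f d t m) <=
    C * (m.+1%:R^-1 - m.+2%:R^-1).
Proof.
move=> tf; have [k hk] := sum_mp_bound d T.
have [C C0 hC] := twist_decay d (k + 3) T tf.
exists (C * 2); first by rewrite mulr_ge0.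
move=> t m tT; rewrite -mulrA.
apply: le_trans (_ : C * (m.+1%:R ^+ 2)^-1 <= _); last first.
  by rewrite ler_wpM2l// invS_telescope.
have p0 : 0 < (m.+1%:R : R) by rewrite ltr0n.
rewrite ler_pdivlMr ?exprn_gt0//; apply: le_trans (hC t m tT).
rewrite (NmM (mp _ _ _)) (exprD _ k 3) (exprS _ 2).
have -> : Nm (twist f d t m) * (m.+1%:R ^+ k * (m.+1%:R * m.+1%:R ^+ 2)) =
    m.+1%:R * (m.+1%:R ^+ k * Nm (twist f d t m)) * m.+1%:R ^+ 2 by ring.
rewrite ler_wpM2r ?exprn_ge0// ler_wpM2l// ler_wpM2r ?Nm_ge0//.
exact: hk.
Qed.

Lemma ccontX h m : ccont h -> ccont (fun x : R => h x ^+ m).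
Proof.
move=> ch; elim: m => [|m IH]; first by under eq_fun do rewrite expr0; exact: ccont_cst.
by under eq_fun do rewrite exprS; exact: ccontM.
Qed.

Lemma cis_weight d m x : cis (Defs.half (d + m.*2%:Z) * x) =
  cis (d%:~R / 2 * x) * cis x ^+ m :> R[i].
Proof.
rewrite -cisMn -cisD /Defs.half rmorphD/= -mul2n PoszM rmorphM/=; congr cis.
by rewrite -!pmulrn; field.
Qed.

Lemma cis_weightN d m x : cis (- Defs.half (d + m.*2%:Z) * x) =
  cis (- (d%:~R / 2) * x) * cis (- x) ^+ m :> R[i].
Proof.
have -> : - Defs.half (d + m.*2%:Z) * x = Defs.half (d + m.*2%:Z) * - x by ring.
by rewrite cis_weight; congr (cis _ * _); ring.
Qed.

(** Each Fourier coefficient is an integral of f against an exponential of frequency d/2 + m or its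
    negative; with r^m inserted, the exponentials add up to [psum] at x and at -x. *)
Lemma twist_integral f d t N r : test_function f ->
  \sum_(m < N) mp d (imag_tau t) m * r%:C ^+ m * twist f d t m =
  ((2 * pi)^-1)%:C * cint (fun x => f (cis x) *
     ('i%C ^ d * cis (- (d%:~R / 2) * x) * psum d (imag_tau t) N (- x) r
      - (expR (t / 2))%:C * cis (d%:~R / 2 * x) * psum d (imag_tau t) N x r)).
Proof.
move=> tf; set tau := imag_tau t.
have cc (s : R) : ccont (fun x => f (cis x) * cis (s * x)).
  apply: ccontM; first exact: test_ccont.
  by apply: ccont_cis; exact: mulrl_continuous.
pose h m x := mp d tau m * r%:C ^+ m *
  ('i%C ^ d * (f (cis x) * cis (- Defs.half (d + m.*2%:Z) * x)) +
   (- (expR (t / 2))%:C) * (f (cis x) * cis (Defs.half (d + m.*2%:Z) * x))).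
have cZ c (g : R -> R[i]) : ccont g -> ccont (fun x => c * g x).
  by apply: ccontM; exact: ccont_cst.
have ch m : ccont (h m) by apply: (cZ _ _ _); apply: ccontD; exact: cZ.
have -> : cint (fun x => f (cis x) *
     ('i%C ^ d * cis (- (d%:~R / 2) * x) * psum d tau N (- x) r
      - (expR (t / 2))%:C * cis (d%:~R / 2 * x) * psum d tau N x r)) =
    cint (fun x => \sum_(m < N) h m x).
  apply: eq_cint => x; rewrite /psum !mulr_sumr -sumrB mulr_sumr.
  by apply: eq_bigr => m _; rewrite /h cis_weight cis_weightN !exprMn; ring.
rewrite cint_sum// mulr_sumr; apply: eq_bigr => m _.
rewrite /h cintZ; last by apply: ccontD; exact: cZ.
rewrite cintD ?cintZ//; try exact: cZ.
rewrite /twist !fhatE /Defs.half.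
have -> : cint (fun x => f (cis x) * cis (- (((- (d + m.*2%:Z))%:~R) / 2) * x)) =
    cint (fun x => f (cis x) * cis ((d + m.*2%:Z)%:~R / 2 * x)).
  by apply: eq_cint => x; congr (_ * cis _); rewrite rmorphN/=; ring.
by ring.
Qed.

Lemma one_sub_pow r m : 0 <= r -> r <= 1 -> 1 - r ^+ m <= m%:R * (1 - r).
Proof.
move=> r0 r1; elim: m => [|m IH]; first by rewrite expr0 subrr mul0r.
have : r ^+ m <= 1 by rewrite exprn_ile1.
have : 0 <= r ^+ m by rewrite exprn_ge0.
rewrite -natr1 exprS; move: (r ^+ m) IH => p IH p0 p1; nra.
Qed.

(** Abel summation in two stages: r is taken so close to 1 that inserting r^m and the boundary
    mismatch cost at most e/2; then N, depending on r, makes [psum] close to its closed form.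
    Convergence of the power series on the circle is never invoked. *)
Lemma twist_sum_lim f d t e : test_function f -> supp f `<=` upper_circle -> 0 < e ->
  exists N0, forall N, (N0 <= N)%N ->
    Nm (\sum_(m < N.+1) mp d (imag_tau t) m * twist f d t m) <= e.
Proof.
move=> tf sf e0; set tau := imag_tau t.
have [C1 C10 h1] := mp_twist_bound d `|t| tf.
have [s s0 hs] := upper_sin_ge sf.
have [K K0 hK] := boundary_twist d t s0.
have [M M0 hM] := test_bounded tf.
(* C1 is the cost of inserting r^m and 2 M K that of the mismatch, both times 1 - r; the 2 is the
   factor 4 pi of [Nm_cint] over 2 pi. *)
pose A := C1 + 2 * M * K + 1.
have A0 : 0 < A by rewrite ltr_wpDl// addr_ge0// !mulr_ge0.
pose r := Num.max (2^-1) (1 - e / 2 / A).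
have r0 : 0 < r by rewrite lt_max invr_gt0 ltr0n.
have r1 : r < 1.
  by rewrite gt_max invf_lt1// ltr1n/= ltrBlDr ltrDl !divr_gt0.
have rA : A * (1 - r) <= e / 2.
  have : 1 - r <= e / 2 / A by rewrite lerBlDl -lerBlDr le_max lexx orbT.
  by rewrite ler_pdivlMr// mulrC.
have [L L0 hL] := psum_close d t r0 r1.
pose B := 2 * M * (1 + expR (t / 2)) * L.
have B0 : 0 <= B by rewrite !mulr_ge0// addr_ge0// expR_ge0.
exists (Num.truncn (B / (e / 2))).+1 => N NN.
have bN : B / N.+1%:R <= e / 2.
  rewrite ler_pdivrMr ?ltr0n// mulrC -ler_pdivrMr ?divr_gt0//.
  apply: ltW; apply: lt_le_trans (truncnS_gt _) _; rewrite ler_nat.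
  exact: leq_trans NN _.
pose Sr := \sum_(m < N.+1) mp d tau m * r%:C ^+ m * twist f d t m.
have hd : Nm (\sum_(m < N.+1) mp d tau m * twist f d t m - Sr) <= C1 * (1 - r).
  rewrite /Sr -sumrB; apply: le_trans (Nm_sum _ _ _) _.
  apply: (@le_trans _ _ (\sum_(m < N.+1) (1 - r) * (m.+1%:R * Nm (mp d tau m * twist f d t m)))).
    apply: ler_sum => m _.
    have -> : mp d tau m * twist f d t m - mp d tau m * r%:C ^+ m * twist f d t m =
       (1 - r ^+ m)%:C * (mp d tau m * twist f d t m).
      by rewrite rmorphB rmorphXn/=; ring.
    rewrite [leLHS](NmM _%:C) mulrA ler_wpM2r ?Nm_ge0// NmR ger0_norm; last first.
      by rewrite subr_ge0 exprn_ile1// ltW.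
    apply: le_trans (one_sub_pow m (ltW r0) (ltW r1)) _.
    by rewrite mulrC ler_wpM2l ?subr_ge0 ?(ltW r1)// ler_nat.
  rewrite -mulr_sumr mulrC ler_wpM2r ?subr_ge0 ?(ltW r1)//.
  rewrite -(big_mkord predT (fun m => m.+1%:R * Nm (mp d tau m * twist f d t m))).
  have := telescope_bound 0 N.+1 (fun m => h1 t m (lexx _)); rewrite add0n => /le_trans; apply.
  by rewrite invr1 ler_piMr// gerBl invr_ge0.
have hS : Nm Sr <= 2 * M * (K * (1 - r) + (1 + expR (t / 2)) * (L / N.+1%:R)).
  rewrite /Sr twist_integral// NmM NmR ger0_norm ?invr_ge0 ?(ltW (pi2_gt0 R))//.
  rewrite ler_pdivrMl ?pi2_gt0//.
  have -> : 2 * pi * (2 * M * (K * (1 - r) + (1 + expR (t / 2)) * (L / N.+1%:R))) =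
     M * (K * (1 - r) + (1 + expR (t / 2)) * (L / N.+1%:R)) * (4 * pi).
    by move: (pi : R) => p; ring.
  apply: Nm_cint.
    have cp (w : R -> R) : continuous w -> ccont (fun x => psum d tau N.+1 (w x) r).
      move=> cw; rewrite /psum.
      apply: (@ccont_sum R N.+1 (fun m x => mp d tau m * (r%:C * cis (w x)) ^+ m)) => m.
      apply: ccontM; first exact: ccont_cst.
      by apply: ccontX; apply: ccontM; [exact: ccont_cst|exact: ccont_cis].
    apply: ccontM; first exact: test_ccont.
    apply: ccontD.
      apply: ccontM; last by apply: (cp -%R) => x; exact: opp_continuous.
      apply: ccontM; first exact: ccont_cst.
      by apply: ccont_cis; exact: mulrl_continuous.
    have -> : (fun x : R => - ((expR (t / 2))%:C * cis (d%:~R / 2 * x) * psum d tau N.+1 x r)) =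
      (fun x => - (expR (t / 2))%:C * (cis (d%:~R / 2 * x) * psum d tau N.+1 x r)).
      by apply/funext => x; ring.
    apply: ccontM; first exact: ccont_cst.
    apply: ccontM; last by apply: (cp id) => x; exact: cvg_id.
    by apply: ccont_cis; exact: mulrl_continuous.
  move=> x xI; have [fx|fx] := eqVneq (f (cis x)) 0.
    have q1 : 0 <= K * (1 - r) by rewrite mulr_ge0// subr_ge0 ltW.
    have q2 : 0 <= (1 + expR (t / 2)) * (L / N.+1%:R).
      by rewrite mulr_ge0 ?divr_ge0// addr_ge0 ?expR_ge0.
    by rewrite fx mul0r Nm0 mulr_ge0 ?addr_ge0.
  rewrite NmM; apply: ler_pM; rewrite ?Nm_ge0 ?hM//.
  set X := 'i%C ^ d * _; set Y := (expR _)%:C * _.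
  have NX : Nm X = 1 by rewrite /X NmM Nm_i_exp Nm_cis mulr1.
  have NY : Nm Y = expR (t / 2).
    by rewrite /Y NmM Nm_cis mulr1 NmR ger0_norm// expR_ge0.
  have xI' : - pi <= x <= pi by move: xI; rewrite /= in_itv.
  have r01 : 0 <= r <= 1 by rewrite !ltW.
  have := hK x r xI' (hs x fx) r01; rewrite -/X -/Y -/tau.
  have := hL N (- x); have := hL N x; rewrite -/tau.
  set c1 := cexp (alog d tau x r); set c2 := cexp (alog d tau (- x) r).
  set p1 := psum d tau N.+1 x r; set p2 := psum d tau N.+1 (- x) r.
  move: c1 c2 p1 p2 => c1 c2 p1 p2 h2 h3 h4.
  have -> : X * p2 - Y * p1 = (X * c2 - Y * c1) + (X * (p2 - c2) - Y * (p1 - c1)) by ring.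
  apply: le_trans (NmD _ _) _; apply: lerD => //.
  apply: le_trans (NmB _ _) _; rewrite (NmM X) (NmM Y) NX NY mulrDl !mul1r; apply: lerD => //.
  by apply: ler_wpM2l => //; exact: expR_ge0.
have -> : \sum_(m < N.+1) mp d tau m * twist f d t m =
    (\sum_(m < N.+1) mp d tau m * twist f d t m - Sr) + Sr by rewrite subrK.
apply: le_trans (NmD _ _) _; apply: le_trans (lerD hd hS) _.
have -> : C1 * (1 - r) + 2 * M * (K * (1 - r) + (1 + expR (t / 2)) * (L / N.+1%:R)) =
    (C1 + 2 * M * K) * (1 - r) + B / N.+1%:R by rewrite /B; ring.
rewrite [leRHS]splitr; apply: lerD => //; apply: le_trans rA.
by rewrite ler_wpM2r ?subr_ge0 ?(ltW r1)// lerDl.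
Qed.

(** The partial sums tend to 0, so each is minus its tail, and the tail has a majorant uniform in
    |t| <= T. The rate is thus uniform although N0 in [twist_sum_lim] depends on t. *)
Lemma twist_sum_bound f d T : test_function f -> supp f `<=` upper_circle ->
  exists2 C : R, 0 <= C & forall t N, `|t| <= T ->
    Nm (\sum_(m < N) mp d (imag_tau t) m * twist f d t m) <= C / N.+1%:R.
Proof.
move=> tf sf; have [C C0 hC] := mp_twist_bound d T tf.
exists C => // t N tT; apply/ler_addgt0Pr => e e0.
have [N0 hN] := twist_sum_lim d t tf sf e0.
pose F m := mp d (imag_tau t) m * twist f d t m.
have := hN (maxn N0 N) (leq_maxl _ _); rewrite -(big_mkord predT F).
rewrite (big_cat_nat (leq0n N) (leq_trans (leq_maxr N0 N) (leqnSn _)))/= big_mkord.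
set S := \sum_(m < N) _; set V := \sum_(N <= i < _) _ => hS.
have hV : Nm V <= C / N.+1%:R.
  apply: le_trans (Nm_sum _ _ _) _.
  rewrite -(subnKC (leq_trans (leq_maxr N0 N) (leqnSn _))).
  have hF m : Nm (F m) <= C * (m.+1%:R^-1 - m.+2%:R^-1).
    apply: le_trans (hC t m tT); rewrite ler_peMl ?Nm_ge0// ler1n//.
  apply: le_trans (telescope_bound N _ hF) _.
  by rewrite ler_wpM2l// gerBl invr_ge0.
have -> : S = (S + V) - V by rewrite addrK.
by apply: le_trans (NmB _ _) _; rewrite addrC lerD.
Qed.

End twisted_sums.

(** * The vectors T^m a / m! in the vertex algebra *)

Section weights.
Variables (R : realType) (V : VOSA R).
Local Notation C := R[i].
Local Notation Om := (vvac V).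
Let ax := vosaP V.

Lemma prod0r (a : V) n : vprod a n 0 = 0.
Proof.
have := prod_linearr ax a n 1 0 0; rewrite !scale1r !addr0 => h.
by apply: (addrI (vprod a n 0)); rewrite -h addr0.
Qed.

Lemma prodZr (a b : V) n (c : C) : vprod a n (c *: b) = c *: vprod a n b.
Proof. by have := prod_linearr ax a n c b 0; rewrite prod0r !addr0. Qed.

Lemma prodDr (a b b' : V) n : vprod a n (b + b') = vprod a n b + vprod a n b'.
Proof. by have := prod_linearr ax a n 1 b b'; rewrite !scale1r. Qed.

Lemma prod0l (b : V) n : vprod 0 n b = 0.
Proof.
have := prod_linearl ax n b 1 0 0; rewrite !scale1r !addr0 => h.
by apply: (addrI (vprod 0 n b)); rewrite -h addr0.
Qed.

Lemma prodDl (a a' b : V) n : vprod (a + a') n b = vprod a n b + vprod a' n b.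
Proof. by have := prod_linearl ax n b 1 a a'; rewrite !scale1r. Qed.

Lemma vir0r n : vir n (0 : V) = 0.
Proof. exact: prod0r. Qed.

Lemma virZ n c (v : V) : vir n (c *: v) = c *: vir n v.
Proof. exact: prodZr. Qed.

Lemma virD n (u v : V) : vir n (u + v) = vir n u + vir n v.
Proof. exact: prodDr. Qed.

(** Translation covariance with T Omega = 0 expresses (j+1) a_(j) Omega through T a_(j+1) Omega;
    descend from an index where the product is already 0. *)
Lemma prod_vac_nat (a : V) (n : nat) : vprod a n%:Z Om = 0.
Proof.
have Tc j : - j%:~R *: vprod a (j - 1) Om = vT (vprod a j Om).
  by have := T_cov ax a j Om; rewrite (T_vac ax) prod0r subr0 => ->.
have T0 : @vT R V 0 = 0.
  have := T_linear ax 1 0 0; rewrite !scale1r !addr0 => h.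
  by apply: (addrI (vT 0)); rewrite -h addr0.
have [N hN] := prod_trunc ax a Om.
have h k : forall j : nat, (N <= (j + k)%N%:Z) -> vprod a j%:Z Om = 0.
  elim: k => [|k IH] j; first by rewrite addn0; exact: hN.
  move=> jk; have := Tc j.+1%:Z; rewrite (IH j.+1) ?addSnnS// T0.
  have -> : j.+1%:Z - 1 = j%:Z by rewrite -addn1 PoszD addrK.
  by move/eqP; rewrite scaler_eq0 oppr_eq0 -pmulrn pnatr_eq0 => /orP[//|/eqP].
apply: (h `|N|%N); lia.
Qed.

Lemma Tprod_vac (a : V) (n : int) : vT (vprod a n Om) = - n%:~R *: vprod a (n - 1) Om.
Proof. by have := T_cov ax a n Om; rewrite (T_vac ax) prod0r subr0. Qed.

(* e_m = T^m a / m!, the coefficient of z^m in Y(a, z) Omega *)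
Definition desc (a : V) (m : nat) : V := vprod a (- m%:Z - 1) Om.

Lemma desc0 (a : V) : desc a 0 = a.
Proof. by rewrite /desc oppr0 add0r (prod_vac ax). Qed.

Lemma T_desc (a : V) m : vT (desc a m) = m.+1%:R *: desc a m.+1.
Proof.
rewrite /desc Tprod_vac.
have -> : - m%:Z - 1 = - m.+1%:Z by rewrite -addn1 PoszD opprD.
by rewrite rmorphN/= opprK -pmulrn.
Qed.

Lemma vir_mix : exists cc : C, forall m n v,
  vir m (vir n v) = vir n (vir m v) + (m - n)%:~R *: vir (m + n) v +
    (if m + n == 0 then (cc / 12 * (m ^+ 3 - m)%:~R) *: v else 0) :> V.
Proof.
have [cc h] := virasoro ax; exists cc => m n v; have := h m n v.
by move/eqP; rewrite subr_eq => /eqP ->; rewrite addrC addrA.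
Qed.

Section quasi_primary.
Variables (d : int) (a : V).
Hypothesis a_hom : vhom d a.
Hypothesis a_qp : vir 1 a = 0.

Lemma S_neq0 (m : nat) : (m.+1%:R : C) != 0.
Proof. by rewrite pnatr_eq0. Qed.

Lemma L0_desc m : vir 0 (desc a m) = (Defs.half d + m%:R) *: desc a m.
Proof.
have [cc hv] := vir_mix.
elim: m => [|m IH]; first by rewrite desc0 addr0; exact: a_hom.
apply: (scalerI (S_neq0 m)); rewrite -[in LHS]virZ -T_desc.
rewrite -(vir_T ax) hv IH virZ /= addr0.
rewrite add0r (vir_T ax) T_desc !scalerA -scalerDl; congr (_ *: _).
by rewrite -[in RHS]natr1 opprK /=; ring.
Qed.

(** Moving L_1 past L_{-1} costs 2 L_0, whose eigenvalue is known from [L0_desc]; the base case uses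
    L_1 a = 0. *)
Lemma L1_descS m : vir 1 (desc a m.+1) = (d + m%:Z)%:~R *: desc a m.
Proof.
have [cc hv] := vir_mix.
have step j : m.+1%:R *: vir 1 (desc a m.+1) = m.+1%:R *: ((d + m%:Z)%:~R *: desc a m) ->
    vir 1 (desc a m.+1) = (d + m%:Z)%:~R *: desc a m by move/scalerI; apply; exact: S_neq0.
apply: (scalerI (S_neq0 m)); elim: m {step} => [|m IH].
  rewrite -[in LHS]virZ -T_desc -(vir_T ax) hv desc0 a_qp vir0r.
  rewrite subrr eqxx ?expr1n ?subrr mulr0 scale0r addr0 add0r.
  rewrite (_ : vir _ a = Defs.half d *: a); last exact: a_hom.
  by rewrite scale1r addr0 scalerA /Defs.half mulrC divfK// pnatr_eq0.
rewrite -[in LHS]virZ -T_desc -(vir_T ax) hv.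
rewrite subrr eqxx ?expr1n ?subrr mulr0 scale0r addr0 L0_desc.
rewrite (scalerI (S_neq0 m) IH) virZ (vir_T ax) T_desc.
rewrite !scalerA -scalerDl; congr (_ *: _).
by rewrite opprK /Defs.half !rmorphD/= -!pmulrn -!natr1; field.
Qed.

(** The value 0 at m = 0 reflects L_1 a = 0 and keeps [K_desc] uniform in m. *)
Definition desc_prev m := if m is n.+1 then desc a n else 0.

Lemma K_desc m : vir 1 (desc a m) - vir (-1) (desc a m) =
  (d + m%:Z - 1)%:~R *: desc_prev m - m.+1%:R *: desc a m.+1.
Proof.
rewrite (vir_T ax) T_desc; congr (_ - _); case: m => [|m] /=.
  by rewrite desc0 a_qp scaler0.
by rewrite L1_descS -addn1 PoszD addrA addrK.
Qed.

(** The product index (k+d)/2 - 1 must be a negative integer -m - 1 to act non-trivially on the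
    vacuum. *)
Lemma hmode_vac k :
  (exists2 m : nat, k = - (d + m.*2%:Z) & hmode d a k Om = desc a m) \/
  ((forall m : nat, k <> - (d + m.*2%:Z)) /\ hmode d a k Om = 0).
Proof.
rewrite /hmode; case: ifPn => odd_kd.
  right; split=> // m km; move: odd_kd; rewrite /zodd km; have -> : - (d + m.*2%:Z) + d = - m.*2%:Z by ring.
  by rewrite abszN absz_nat odd_double.
have [j jE] : exists j : int, k + d = j * 2.
  have /dvdzP[j jE] : (2 %| k + d)%Z by have : (2 %| `|(k + d)%R|)%N by rewrite dvdn2.
  by exists j.
rewrite jE mulzK//; have [j0|j0] := leP j 0.
  left; exists `|j|%N; first by rewrite -muln2 PoszM abszE ler0_norm//; move: jE; lia.
  by rewrite /desc abszE ler0_norm// opprK.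
right; split; first by move=> m km; move: jE; rewrite km -muln2 PoszM; lia.
have -> : j - 1 = (`|j|%N.-1)%:Z by lia.
exact: prod_vac_nat.
Qed.

Lemma hmode_desc (m : nat) : hmode d a (- (d + m.*2%:Z)) Om = desc a m.
Proof.
have [[n e ->]|[/(_ m)]//] := hmode_vac (- (d + m.*2%:Z)).
by congr desc; move: e => /oppr_inj/addrI [] /double_inj.
Qed.

End quasi_primary.

Lemma vhomD k (u v : V) : vhom k u -> vhom k v -> vhom k (u + v).
Proof. by rewrite /vhom /= /vir prodDr => -> ->; rewrite scalerDr. Qed.

Lemma vhom0 k : vhom k (0 : V).
Proof. by rewrite /vhom /= /vir prod0r scaler0. Qed.

Lemma vhomZ k c (u : V) : vhom k u -> vhom k (c *: u).
Proof. by rewrite /vhom /= /vir prodZr => ->; rewrite !scalerA mulrC. Qed.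

Lemma vhom_sum k I (r : seq I) (P : pred I) (F : I -> V) :
  (forall i, P i -> vhom k (F i)) -> vhom k (\sum_(i <- r | P i) F i).
Proof.
by move=> h; elim/big_ind: _ => //; [exact: vhom0|move=> *; exact: vhomD].
Qed.

Lemma half_inj : injective (@Defs.half C).
Proof.
move=> j k; rewrite /Defs.half => /mulIf; rewrite invr_eq0 pnatr_eq0 => /(_ isT).
exact: intr_inj.
Qed.

(** Applying L_0 - k0/2 kills the first eigenvector and rescales the others by non-zero factors. *)
Lemma vhom_indep (s : seq int) (F : int -> V) : uniq s ->
  (forall k, vhom k (F k)) -> \sum_(k <- s) F k = 0 ->
  forall k, k \in s -> F k = 0.
Proof.
elim: s F => // k0 s IH F /= /andP[k0s us] hF; rewrite big_cons => e.
have hs k : k \in s -> F k = 0.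
  move=> ks; pose G k := (Defs.half k - Defs.half k0 : C) *: F k.
  have G0 : \sum_(k <- s) G k = 0.
    have e0 : vir 0 (F k0 + \sum_(k <- s) F k) = 0 by rewrite e vir0r.
    have vs : vir 0 (\sum_(k <- s) F k) = \sum_(k <- s) Defs.half k *: F k.
      elim: (s) => [|j r IHr]; first by rewrite !big_nil vir0r.
      by rewrite !big_cons virD IHr (hF j).
    move: e0; rewrite virD vs (hF k0) => e0.
    under eq_bigr do rewrite /G scalerBl.
    rewrite sumrB -scaler_sumr; apply/eqP; rewrite subr_eq0; apply/eqP.
    apply: (addrI (Defs.half k0 *: F k0)); rewrite e0 -scalerDr e scaler0//.
  have := IH G us (fun k => vhomZ _ (hF k)) G0 k ks; move/eqP.
  rewrite scaler_eq0 subr_eq0 => /orP[/eqP/half_inj kk0|/eqP//].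
  by move: k0s; rewrite -kk0 ks.
move=> k; rewrite inE => /predU1P[->|/hs//].
by move: e; rewrite big_seq big1 ?addr0.
Qed.

Lemma hmodeD d (a a' b : V) k : hmode d (a + a') k b = hmode d a k b + hmode d a' k b.
Proof. by rewrite /hmode; case: ifP => _; rewrite ?addr0// prodDl. Qed.

Lemma hmode0 d (b : V) k : hmode d 0 k b = 0.
Proof. by rewrite /hmode; case: ifP => _ //; exact: prod0l. Qed.

Lemma hmode_sum d I (r : seq I) (P : pred I) (F : I -> V) k (b : V) :
  hmode d (\sum_(i <- r | P i) F i) k b = \sum_(i <- r | P i) hmode d (F i) k b.
Proof.
by elim/big_rec2: _ => [|i y x _ <-]; [exact: hmode0|rewrite hmodeD].
Qed.

Lemma big_eq_seq (W : nmodType) (u : seq int) j (F : int -> W) :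
  uniq u -> j \in u -> \sum_(k <- u | k == j) F k = F j.
Proof.
by move=> uu ju; rewrite -big_filter (filter_pred1_uniq uu ju) big_seq1.
Qed.

(** [mode] uses a chosen decomposition, in which weights may repeat. Grouping by weight and
    subtracting the trivial decomposition leaves homogeneous vectors with sum 0, which vanish by
    independence. *)
Lemma mode_hmode d (a : V) k b : vhom d a -> mode a k b = hmode d a k b.
Proof.
move=> ha; rewrite /mode.
have : decomposition a (decomp a).
  rewrite /decomp; case: xgetP => // h; exfalso; apply: (h [:: (d, a)]).
  split; last by rewrite big_seq1.
  by move=> p; rewrite inE => /eqP ->.
move: (decomp a) => s [hs ea].
pose A k := \sum_(p <- s | p.1 == k) p.2.
have hA k' : vhom k' (A k').
  rewrite /A big_seq_cond; apply: vhom_sum => p /andP[ps /eqP <-]; exact: hs.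
pose F k' := A k' - (if k' == d then a else 0).
have hF k' : vhom k' (F k').
  apply: vhomD => //; rewrite -scaleN1r; apply: vhomZ.
  by case: eqP => [->|_] //; exact: vhom0.
pose u := undup (d :: map fst s).
have sub : {subset undup (map fst s) <= u}.
  by move=> j; rewrite !mem_undup inE => ->; rewrite orbT.
have ext (W : nmodType) (G : int * V -> W) : \sum_(p <- s) G p =
    \sum_(k' <- u) \sum_(p <- s | p.1 == k') G p.
  rewrite (exchange_big_dep predT)//=; apply: eq_big_seq => p ps.
  under eq_bigl do rewrite eq_sym.
  rewrite big_eq_seq ?undup_uniq// mem_undup inE; apply/orP; right.
  by apply/mapP; exists p.
have du : d \in u by rewrite mem_undup inE eqxx.
have F0 : \sum_(k' <- u) F k' = 0.
  rewrite sumrB -(ext _ snd) -ea -big_mkcond/= big_eq_seq ?undup_uniq// subrr//.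
have FE := vhom_indep (undup_uniq _) hF F0.
rewrite ext.
transitivity (\sum_(k' <- u) hmode k' (A k') k b).
  apply: eq_bigr => k' _; rewrite /A hmode_sum.
  by apply: eq_bigr => p /eqP ->.
transitivity (\sum_(k' <- u) if k' == d then hmode d a k b else 0).
  apply: eq_big_seq => k' ku; have := FE k' ku; rewrite /F => /eqP.
  rewrite subr_eq0 => /eqP ->; case: eqP => [->//|_]; exact: hmode0.
by rewrite -big_mkcond/= big_eq_seq// undup_uniq.
Qed.

End weights.

(** * Convergence and closability of smeared vertex operators *)

Section vacuum.
Variables (R : realType) (V : unitaryVOSA R) (H : completion V).
Local Notation C := R[i].
Local Notation Om := (vvac V).
Local Notation J := (cinj H).

Lemma unormE (v : V) : unorm v = Nm (J v).
Proof.
rewrite /unorm -(cinj_isom H) hipxx /= sqrtr_sqr ger0_norm//; exact: Nm_ge0.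
Qed.

Definition rapid (f : C -> C) := forall n, exists2 D : R, 0 <= D &
  forall k : int, Nm (fhat f k) * (`|k|%N.+1%:R) ^+ n <= D.

(** For a fixed b the norm of (L_0 + 1)^r b is a constant, so the energy bound reduces to polynomial
    growth in the mode index. *)
Lemma hmode_bound d (a b : V) : energy_bounded V -> vhom d a ->
  exists D n, 0 <= D /\
    forall k, Nm (J (hmode d a k b)) <= D * (`|k|%N.+1%:R) ^+ n :> R.
Proof.
move=> eb ha; have [M [s [r [M0 s0 r0 h]]]] := eb a.
exists (M * unorm (L0p1_pow r b)), (Num.truncn s).+1; split.
  by rewrite mulr_ge0// unormE Nm_ge0.
move=> k; have := h k b; rewrite (mode_hmode _ _ ha) unormE => /le_trans; apply.
rewrite [leRHS]mulrAC; apply: ler_wpM2r; first by rewrite unormE Nm_ge0.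
apply: ler_wpM2l => //.
have k1 : `|Defs.half k| + 1 <= `|k|%N.+1%:R :> R.
  rewrite -natr1 lerD2r /Defs.half normrM normfV [`|2|]ger0_norm// -intr_norm -abszE.
  by rewrite ler_pdivrMr// mulr_natr mulr2n lerDl.
rewrite -powR_mulrn//.
apply: (@le_trans _ _ (`|k|%N.+1%:R `^ s)).
  by apply: ge0_ler_powR => //; rewrite nnegrE// addr_ge0.
apply: ler_powR; first by rewrite ler1n.
by rewrite ltW// truncnS_gt.
Qed.

Lemma theta0 : utheta (0 : V) = 0.
Proof.
have := theta_antilinear 1 (0 : V) 0; rewrite conjc1 !scale1r !addr0 => h.
by apply: (addrI (utheta 0)); rewrite -h addr0.
Qed.

Lemma conjc_half k : conjc (Defs.half k : C) = Defs.half k.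
Proof.
rewrite /Defs.half conjcM conjc_inv conjc_nat; congr (_ * _).
by rewrite -(rmorph_int (real_complex R)) conjc_real.
Qed.

Lemma theta_hom d (a : V) : vhom d a -> vhom d (utheta a).
Proof.
rewrite /vhom /= /vir => ha; rewrite -{1}(theta_nu V) -theta_prod ha.
have := theta_antilinear (Defs.half d) a 0.
by rewrite !addr0 theta0 addr0 conjc_half.
Qed.

Definition adj_sign (d : int) : C := (-1) ^ (d * (d + 1) %/ 2)%Z.

(** For a quasi-primary vector e^(z L_1) a = a, so invariance keeps only its j = 0 term: the adjoint
    of a mode is, up to sign, the opposite mode of theta(a). *)
Lemma hmode_adj d (a b c : V) k : vhom d a -> vir 1 a = 0 ->
  uip (hmode d (utheta a) (- k) b) c = adj_sign d * uip b (hmode d a k c).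
Proof.
move=> ha qa; rewrite /hmode.
have od : zodd (- k + d) = zodd (k + d) by rewrite /zodd; lia.
have ip0 x : uip x (0 : V) = 0.
  have := ip_linear (uipP V) x 1 0 0; rewrite scale1r addr0 mul1r => h.
  by apply: (addrI (uip x 0)); rewrite -h addr0.
have ip0l x : uip (0 : V) x = 0 by rewrite (ip_herm (uipP V)) ip0 conjc0.
rewrite od; case: ifPn => odd_kd; first by rewrite ip0l ip0 mulr0.
have [j jE] : exists j : int, k + d = j * 2.
  have /dvdzP[j jE] : (2 %| k + d)%Z by have : (2 %| `|(k + d)%R|)%N by rewrite dvdn2.
  by exists j.
have jE' : - k + d = (d - j) * 2 by rewrite mulrBl -jE; ring.
have it n : (1 <= n)%N -> iter n (@vir R V 1) a = 0.
  case: n => // n _; rewrite iterSr qa; elim: n => //= n ->; exact: prod0r.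
rewrite jE jE' !mulzK// (uip_invariant _ _ _ ha it) big_ord1/= invr1 mul1r.
rewrite /adj_sign; congr (_ * uip _ (vprod _ _ _)); ring.
Qed.

Lemma adj_sign_real d : conjc (adj_sign d) = adj_sign d /\ adj_sign d * adj_sign d = 1.
Proof.
have h : adj_sign d = 1 \/ adj_sign d = - 1.
  rewrite /adj_sign; case: (_ %/ _)%Z => n.
    by rewrite -exprnP -signr_odd; case: odd; [right|left].
  by rewrite NegzE -exprnN -signr_odd; case: odd; [right|left]; rewrite ?expr1 ?expr0 ?invrN ?invr1.
by case: h => ->; rewrite ?conjcN conjc1; split=> //; rewrite ?mul1r// mulrNN mul1r.
Qed.

Lemma symmetric_sum (W : zmodType) (t : int -> W) N :
  \sum_(i < N.*2.+1) t (i%:Z - N%:Z) =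
  \sum_(j < N.+1) (if j == 0 :> nat then t 0 else t j%:Z + t (- j%:Z)).
Proof.
elim: N => [|N IH]; first by rewrite !big_ord1 subr0.
rewrite [RHS]big_ord_recr/= -IH doubleS big_ord_recl/= big_ord_recr/=.
rewrite addrCA; congr (_ + _).
  by apply: eq_bigr => i _; congr t; rewrite /bump /=; lia.
by rewrite addrC; congr (t _ + t _); rewrite /bump /=; lia.
Qed.

Lemma symmetric_cvg (W : completeNormedModType C) (t : int -> W) (D : R) :
  (forall k, Nm (t k) * (`|k|%N.+1%:R) ^+ 2 <= D) ->
  exists l : W, \sum_(i < N.*2.+1) t (i%:Z - N%:Z) @[N --> \oo] --> l.
Proof.
move=> ht; pose w (j : nat) := if j == 0 :> nat then t 0 else t j%:Z + t (- j%:Z).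
have D0 : 0 <= D by apply: le_trans (ht 0); rewrite mulr_ge0 ?Nm_ge0 ?exprn_ge0.
have hw j : Nm (w j) <= 4 * D * (j.+1%:R^-1 - j.+2%:R^-1).
  have hk k : `|k|%N = j -> Nm (t k) <= D / (j.+1%:R ^+ 2).
    by move=> kj; rewrite ler_pdivlMr ?exprn_gt0 ?ltr0n// -kj.
  apply: (@le_trans _ _ (2 * (D * (j.+1%:R ^+ 2)^-1))); last first.
    have -> : 4 * D * (j.+1%:R^-1 - j.+2%:R^-1) =
       2 * (D * (2 * (j.+1%:R^-1 - j.+2%:R^-1))) by ring.
    by rewrite ler_wpM2l// ler_wpM2l// invS_telescope.
  rewrite /w; case: eqP => [j0|_].
    apply: le_trans (hk 0 _) _; first by rewrite j0.
    by apply: ler_peMl; [rewrite divr_ge0 ?exprn_ge0|rewrite ler1n].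
  apply: le_trans (NmD _ _) _; rewrite mulr_natl mulr2n.
  by apply: lerD; apply: hk => //; rewrite abszN.
have [l hl _] := series_cvg hw; exists l.
under eq_fun do rewrite symmetric_sum.
have /cvg_Nm h := hl; apply/cvg_Nm => e /h[N hN]; exists N => n Nn.
by apply: (hN n.+1); rewrite leqW.
Qed.

Variables (d : int) (a : V).
Hypotheses (V_eb : energy_bounded V) (a_hom : vhom d a) (a_qp : vir 1 a = 0).

(** The index map s allows for reflected modes, as they occur in the adjoint. *)
Lemma rapid_cvg (g : int -> C) (a' b : V) : vhom d a' ->
  (forall n, exists2 D : R, 0 <= D &
    forall k : int, Nm (g k) * (`|k|%N.+1%:R) ^+ n <= D) ->
  forall s : int -> int, (forall k, `|s k|%N = `|k|%N) ->
  exists l : H, \sum_(i < N.*2.+1) g (i%:Z - N%:Z) *: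
     J (hmode d a' (s (i%:Z - N%:Z)) b) @[N --> \oo] --> l.
Proof.
move=> ha' hg s hs; have [D [n [D0 hD]]] := hmode_bound b V_eb ha'.
have [D' D'0 hD'] := hg (n + 2)%N.
apply: (symmetric_cvg (t := fun k => g k *: J (hmode d a' (s k) b)) (D := D * D')).
move=> k; rewrite NmZ mulrAC.
have -> : Nm (g k) * `|k|%N.+1%:R ^+ 2 * Nm (J (hmode d a' (s k) b)) =
   (Nm (g k) * `|k|%N.+1%:R ^+ 2) * Nm (J (hmode d a' (s k) b)) by [].
have h1 := hD (s k); rewrite hs in h1.
apply: le_trans (ler_wpM2l (mulr_ge0 (Nm_ge0 _) (exprn_ge0 _ (ler0n _ _))) h1) _.
have -> : Nm (g k) * `|k|%N.+1%:R ^+ 2 * (D * `|k|%N.+1%:R ^+ n) =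
   D * (Nm (g k) * `|k|%N.+1%:R ^+ (n + 2)) by rewrite exprD; ring.
by rewrite ler_wpM2l.
Qed.

Lemma hip_cvg (u : nat -> H) (l x : H) (z : C) : u @ \oo --> l ->
  (forall e, 0 < e -> exists N, forall n, (N <= n)%N -> Nm (hip x (u n) - z) <= e) ->
  hip x l = z.
Proof.
move=> /cvg_Nm hu hz; apply/eqP; rewrite -subr_eq0; apply/eqP.
apply: Nm_small_eq0 => e e0.
have e2 : 0 < e / 2 by rewrite divr_gt0.
have M0 : 0 < Nm x + 1 by rewrite ltr_wpDl// Nm_ge0.
have [N1 h1] := hu _ (divr_gt0 e2 M0); have [N2 h2] := hz _ e2.
have := h1 (maxn N1 N2) (leq_maxl _ _); have := h2 (maxn N1 N2) (leq_maxr _ _).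
move: (u _) => v hv hl.
have -> : hip x l - z = (hip x v - z) - hip x (v - l) by rewrite hipBr; ring.
apply: le_trans (NmB _ _) _; rewrite [leRHS]splitr; apply: lerD => //.
apply: le_trans (CauchySchwarz _ _) _; apply: le_trans (ler_wpM2l (Nm_ge0 _) hl) _.
rewrite mulrCA; apply: ler_piMr; first exact: ltW.
by rewrite ler_pdivrMr// mul1r lerDl.
Qed.

Lemma cinj_dense_eq (y y' : H) : (forall b, hip (J b) y = hip (J b) y') -> y = y'.
Proof.
move=> h; apply/eqP; rewrite -subr_eq0; apply/eqP; set w := y - y'.
have hw b : hip (J b) w = 0 by rewrite hipBr h subrr.
apply: Nm_small_eq0 => e e0.
have eC : 0 < e%:C by rewrite ltcR.
have [|x0 [/= wb [b _ bE]]] := @cinj_dense _ _ H (ball w e%:C)^° _ (@open_interior _ _).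
  by exists w; exact: nbhsx_ballx.
have := interior_subset wb; rewrite -bE -ball_normE /= NmE ltcR => lt_e.
have [W0|W0] := eqVneq (Nm w) 0; first by rewrite W0 ltW.
have Wp : 0 < Nm w by rewrite lt_neqAle eq_sym W0 Nm_ge0.
have : Nm w * Nm w <= e * Nm w.
  have -> : Nm w * Nm w = Nm (hip (w - J b) w).
    by rewrite hipBl hw subr0 hipxx NmR ger0_norm ?sqr_ge0.
  apply: le_trans (CauchySchwarz _ _) _; rewrite ler_wpM2r ?Nm_ge0// ltW//.
by rewrite ler_pM2r.
Qed.

(* Y(a, f) is closable at Omega because its adjoint is defined on V. *)
Lemma smeared_unique (f : C -> C) (x y y' : H) : rapid f ->
  smeared H d a f (x, y) -> smeared H d a f (x, y') -> y = y'.
Proof.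
move=> rf hy hy'.
(* [bd] is the adjoint of Y(a, f) at b: conjugated coefficients with the reflected modes of
   theta(a). *)
have adj b : exists bd : H, forall y, smeared H d a f (x, y) -> hip (J b) y = hip bd x.
  have rg n : exists2 D : R, 0 <= D & forall k : int,
      Nm (conjc (fhat f k) * adj_sign d) * (`|k|%N.+1%:R) ^+ n <= D.
    have [D D0 hD] := rf n; exists D => // k; apply: le_trans (hD k).
    have -> : Nm (conjc (fhat f k) * adj_sign d) = Nm (fhat f k); last by [].
    rewrite NmM Nm_conj -[RHS]mulr1; congr (_ * _).
    have [_ /(congr1 (@Nm R _))] := adj_sign_real d; rewrite NmM Nm1 => h.
    by have := Nm_ge0 (adj_sign d); nra.
  have [bd hbd] := rapid_cvg b (theta_hom a_hom) rg (s := -%R) (fun k => abszN k).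
  exists bd => z hz.
  (* The relation holds on V by taking limits of partial sums; both sides are continuous, so it
     survives the closure. *)
  have sub : [set p | exists2 c, p.1 = J c &
      smeared_partial H d a f c N @[N --> \oo] --> p.2] `<=`
      [set p : H * H | hip (J b) p.2 = hip bd p.1].
    move=> [p1 p2] /= [c -> hc]; apply: (hip_cvg hc) => e e0.
    have M0 : 0 < Nm (J c) + 1 by rewrite ltr_wpDl// Nm_ge0.
    have /cvg_Nm /(_ _ (divr_gt0 e0 M0)) [N hN] := hbd.
    exists N => n /hN {}hN.
    have -> : hip (J b) (smeared_partial H d a f c n) =
        hip (\sum_(i < n.*2.+1) (conjc (fhat f (i%:Z - n%:Z)) * adj_sign d) *:
          J (hmode d (utheta a) (- (i%:Z - n%:Z)) b)) (J c).
      rewrite hip_sumr hip_suml; apply: eq_bigr => i _.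
      rewrite hipZr hipZl !cinj_isom (hmode_adj _ _ _ a_hom a_qp).
      have [s1 s2] := adj_sign_real d; rewrite conjcM conjcK s1.
      by rewrite -mulrA [X in _ = _ * X]mulrA s2 mul1r.
    rewrite -hipBl; apply: le_trans (CauchySchwarz _ _) _.
    apply: le_trans (ler_wpM2r (Nm_ge0 _) hN) _.
    rewrite -mulrA; apply: ler_piMr; first exact: ltW.
    by rewrite mulrC ler_pdivrMr// mul1r lerDl.
  apply/eqP; rewrite -subr_eq0; apply/eqP; apply: Nm_small_eq0 => e e0.
  pose M := Nm (J b) + Nm bd + 1.
  have M0 : 0 < M by rewrite ltr_wpDl// addr_ge0// Nm_ge0.
  have eM : 0 < (e / M)%:C by rewrite ltcR divr_gt0.
  have [[p1 p2] [/sub /= hp [/= b1 b2]]] := hz _ (nbhsx_ballx (x, z) _ eM).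
  move: b1 b2; rewrite -!ball_normE /= !NmE !ltcR => b1 b2.
  have -> : hip (J b) z - hip bd x = hip (J b) (z - p2) - hip bd (x - p1).
    by rewrite !hipBr hp; ring.
  apply: le_trans (NmB _ _) _.
  apply: le_trans (lerD (CauchySchwarz _ _) (CauchySchwarz _ _)) _.
  apply: le_trans (lerD (ler_wpM2l (Nm_ge0 _) (ltW b2)) (ler_wpM2l (Nm_ge0 _) (ltW b1))) _.
  rewrite -mulrDl mulrCA; apply: ler_piMr; first exact: ltW.
  by rewrite ler_pdivrMr// mul1r lerDl.
apply: cinj_dense_eq => b; have [bd hbd] := adj b.
by rewrite (hbd _ hy) (hbd _ hy').
Qed.

End vacuum.

(** * The series of Y(a, f) Omega *)

Section vacuum_vector.
Variables (R : realType) (V : unitaryVOSA R) (H : completion V).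
Local Notation C := R[i].
Local Notation Om := (vvac V).
Local Notation J := (cinj H).
Variables (d : int) (a : V).
Hypotheses (V_eb : energy_bounded V) (a_hom : vhom d a) (a_qp : vir 1 a = 0).

(** Reindexes the symmetric sum over modes by m; the bound N + |d| is large enough for every m with
    |d + 2m| <= N. *)
Lemma smeared_partial_vac (f : C -> C) N : smeared_partial H d a f Om N =
  \sum_(m < (N + `|d|).+1) if (`|(d + m.*2%:Z)%R| <= N)%N
    then fhat f (- (d + m.*2%:Z)) *: J (desc a m) else 0.
Proof.
set M := (N + `|d|).+1.
pose F (m : nat) := fhat f (- (d + m.*2%:Z)) *: J (desc a m).
transitivity (\sum_(i < N.*2.+1) \sum_(m < M)
    if i%:Z - N%:Z == - (d + m.*2%:Z) then F m else 0).
  rewrite /smeared_partial; apply: eq_bigr => i _.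
  have [[m0 e ->]|[ne ->]] := hmode_vac d a (i%:Z - N%:Z).
    have m0M : (m0 < M)%N by have := ltn_ord i; rewrite /M; lia.
    rewrite (bigD1 (Ordinal m0M))//= ifT; last exact/eqP.
    rewrite {1}/F -e big1 ?addr0//.
    move=> m /eqP mm0; case: eqP => // em; exfalso; apply: mm0; apply: val_inj => /=.
    by move: em; rewrite e; lia.
  rewrite linear0 scaler0 big1// => m _; case: eqP => // em.
  by case: (ne m).
rewrite exchange_big/=; apply: eq_bigr => m _; case: ifP => dm.
  have iN : (`|(N%:Z - (d + m.*2%:Z))%R| < N.*2.+1)%N by lia.
  rewrite (bigD1 (Ordinal iN))//= ifT; last by apply/eqP; lia.
  rewrite big1 ?addr0// => i /eqP ii; case: eqP => // ei; exfalso; apply: ii.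
  by apply: val_inj => /=; lia.
apply: big1 => i _; case: eqP => // ei; move: dm; have := ltn_ord i; lia.
Qed.

Lemma coeff_vac_bound (f : C -> C) : rapid f -> exists2 D : R, 0 <= D &
  forall m, Nm (fhat f (- (d + m.*2%:Z)) *: J (desc a m)) <=
    D * (m.+1%:R^-1 - m.+2%:R^-1).
Proof.
move=> rf; have [D1 [n [D10 h1]]] := hmode_bound H Om V_eb a_hom.
have [D2 D20 h2] := rf (n + 2)%N.
exists (D1 * D2 * `|d|%N.+1%:R ^+ 2 * 2); first by rewrite !mulr_ge0// exprn_ge0.
move=> m; rewrite NmZ.
have := h1 (- (d + m.*2%:Z)); rewrite hmode_desc abszN.
have := h2 (- (d + m.*2%:Z)); rewrite abszN.
have ws := weight_shift d m.
move: (absz (d + m.*2%:Z)%R).+1 ws => w ws; rewrite exprD => k2 k1.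
have w0 : 0 < (w%:R : R) by rewrite ltr0n; case: (w) ws => //; rewrite muln0.
rewrite -[leRHS]mulrA; apply: le_trans (ler_wpM2l _ (@invS_telescope R m)); last first.
  by rewrite !mulr_ge0// exprn_ge0.
rewrite ler_pdivlMr ?exprn_gt0 ?ltr0n//.
have ws' : (m.+1%:R : R) ^+ 2 <= (`|d|%N.+1%:R * w%:R) ^+ 2.
  by apply: lerXn2r; rewrite ?nnegrE ?mulr_ge0// -natrM ler_nat.
apply: le_trans (ler_wpM2l (mulr_ge0 (Nm_ge0 _) (Nm_ge0 _)) ws') _.
apply: le_trans (ler_wpM2r (exprn_ge0 _ (mulr_ge0 (ler0n _ _) (ltW w0)))
   (ler_wpM2l (Nm_ge0 _) k1)) _.
have -> : Nm (fhat f (- (d + m.*2%:Z))) * (D1 * w%:R ^+ n) * (`|d|%N.+1%:R * w%:R) ^+ 2 =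
   D1 * (Nm (fhat f (- (d + m.*2%:Z))) * (w%:R ^+ n * w%:R ^+ 2)) * `|d|%N.+1%:R ^+ 2.
  by rewrite exprMn; ring.
by rewrite ler_wpM2r ?exprn_ge0// ler_wpM2l.
Qed.

(** The symmetric truncation and the one in m have the same limit because the series is dominated by
    a summable one; [smeared_unique] then identifies the value chosen by [app]. *)
Lemma smeared_vac (f : C -> C) : rapid f -> exists2 x : H,
  app (smeared H d a f) (J Om) = x &
  \sum_(m < M) fhat f (- (d + m.*2%:Z)) *: J (desc a m) @[M --> \oo] --> x.
Proof.
move=> rf; have [D D0 hD] := coeff_vac_bound rf.
pose F (m : nat) := fhat f (- (d + m.*2%:Z)) *: J (desc a m).
have [x hx hxD] := series_cvg (hD : forall m, Nm (F m) <= _).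
exists x => //.
have hs : smeared_partial H d a f Om N @[N --> \oo] --> x.
  apply/cvg_Nm => e e0.
  pose N0 := (Num.truncn (2 * D / e)).+1.
  exists (N0.*2 + `|d|)%N => N NN.
  (* Every m < n0 passes the cutoff |d + 2m| <= N, so the two truncations differ only in terms from
     n0 on. *)
  set M := (N + `|d|).+1; set n0 := (N - `|d|)./2.
  have n0M : (n0 <= M)%N by rewrite /n0 /M; lia.
  have N0n : (N0 <= n0)%N by rewrite /n0; lia.
  have Dn : D / n0.+1%:R <= e / 2.
    have h : 2 * D / e < N0%:R by exact: truncnS_gt.
    have hn : (N0%:R : R) * e <= n0.+1%:R * e by rewrite ler_pM2r// ler_nat (leq_trans N0n).
    by move: h; rewrite ltr_pdivrMr// ler_pdivrMr ?ltr0n//; lra.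
  have -> : smeared_partial H d a f Om N - x =
      (\sum_(m < M) F m - x) - (\sum_(m < M) F m - smeared_partial H d a f Om N).
    by rewrite opprB [RHS]addrC addrA subrK.
  apply: le_trans (NmB _ _) _; rewrite [leRHS]splitr; apply: lerD.
    apply: le_trans (hxD M) _; apply: le_trans Dn.
    by rewrite ler_wpM2l// lef_pV2 ?posrE ?ltr0n// ler_nat.
  rewrite smeared_partial_vac -/M -sumrB; apply: le_trans (Nm_sum _ _ _) _.
  pose G m := if (n0 <= m)%N then Nm (F m) else 0 : R.
  apply: (@le_trans _ _ (\sum_(m < M) G m)).
    apply: ler_sum => m _; rewrite /G; case: ifP => dm.
      by rewrite subrr Nm0; case: ifP => // _; exact: Nm_ge0.
    by rewrite subr0 ifT//; move: dm; rewrite /n0; lia.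
  rewrite -(big_mkord predT G) (big_cat_nat (leq0n n0) n0M)/= big_nat big1; last first.
    by move=> i /andP[_ i0]; rewrite /G leqNgt i0.
  rewrite add0r (_ : \sum_(n0 <= i < M) G i = \sum_(n0 <= i < M) Nm (F i)); last first.
    by apply: eq_big_nat => i /andP[i0 _]; rewrite /G i0.
  rewrite -(subnKC n0M); apply: le_trans (telescope_bound n0 _ hD) _.
  by apply: le_trans Dn; rewrite ler_wpM2l// gerBl invr_ge0.
have hsx : smeared H d a f (J Om, x).
  by apply: subset_closure => /=; exists Om.
rewrite /app; apply: xget_unique => //= y hy.
exact: (smeared_unique V_eb a_hom a_qp rf hy hsx).
Qed.

End vacuum_vector.

(** * The exponential of K / 2 *)

Section exponential.
Variables (R : realType) (H : hilbert R) (E : pvm H).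
Local Notation C := R[i].
Local Notation g := (fun t : R => expR (t / 2)).
Implicit Types (x y z : H).

Lemma measurable_expR_half : measurable_fun setT (g : measurableTypeR R -> R).
Proof.
apply: continuous_measurable_fun => t.
by apply: continuous_comp; [exact: mulrr_continuous|exact: continuous_expR].
Qed.

Lemma expR_half_lip (n c t : R) : c <= n -> t <= n -> c <= t ->
  `|expR (t / 2) - expR (c / 2)| <= expR (n / 2) * (t - c).
Proof.
move=> cn tn ct.
apply: (@real_mean_value R g (fun s => expR (s / 2) * 2^-1)) => // s /andP[s1 s2].
split.
  have dc : is_derive s (1 : R) (fun=> 2^-1 : R) 0 by exact: is_derive_cst.
  have dr : is_derive s (1 : R) (fun u : R => u) 1 by exact: is_derive_id.
  have d2 : is_derive s (1 : R) (fun u : R => u * 2^-1) 2^-1.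
    by apply: is_derive_eq (is_derive_mul dr dc) _; rewrite mulr0 addr0 mul1r.
  exact: (is_derive1_comp (is_derive_expR _) d2).
rewrite ger0_norm ?mulr_ge0 ?expR_ge0//.
have : expR (s / 2) <= expR (n / 2) by rewrite ler_expR; lra.
have := expR_ge0 (s / 2); lra.
Qed.

(** The weak definition fixes inner products only with vectors of the domain. Cut-offs to windows
    belong to it, as the exponential is bounded there, and they approximate the difference of the
    two values. *)
Lemma fcalc_expR_fun x y y' : fcalc E g (x, y) -> fcalc E g (x, y') -> y = y'.
Proof.
move=> [/= _ h] [/= _ h']; apply/eqP; rewrite -subr_eq0; apply/eqP; set w := y - y'.
have Ew n : E (@window R n) w = 0.
  have mw := @measurable_window R n.
  have dz : fc_dom E g (E (@window R n) w).
    apply: (@fc_dom_pproj _ _ E g (@window R n) w 0 (expR (n%:R / 2)) mw measurable_expR_half).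
    move=> t; rewrite /window /= in_itv/= => /andP[_ tn].
    by rewrite subr0 ger0_norm ?expR_ge0// ler_expR ler_wpM2r ?invr_ge0// ltW.
  apply: Nm_eq0; apply/eqP; rewrite -sqrf_eq0; apply/eqP; apply: complexI.
  rewrite -hipxx -hip_pproj// pproj_sym// /w hipBr.
  by rewrite (h _ dz) (h' _ dz) subrr.
apply: Nm_small_eq0 => e e0.
near \oo => n; rewrite -[w]subr0 -(Ew n); near: n; exact: pproj_window.
Unshelve. all: by end_near. Qed.

Lemma Nm_sum_cells_le (a h : R) K (u : nat -> H) w (s : R) : 0 <= h -> 0 <= s ->
  (forall j, (j < K)%N -> Nm (E (cell a h j) (u j)) <= s * Nm (E (cell a h j) w)) ->
  Nm (\sum_(j < K) E (cell a h j) (u j)) <= s * Nm w.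
Proof.
move=> h0 s0 hu.
rewrite -(ler_pXn2r (ltn0Sn 1)) ?nnegrE ?mulr_ge0 ?Nm_ge0// Nm_sum_cells//.
apply: (@le_trans _ _ (s ^+ 2 * \sum_(j < K) Nm (E (cell a h j) w) ^+ 2)).
  rewrite mulr_sumr; apply: ler_sum => j _; rewrite -exprMn.
  by apply: lerXn2r; rewrite ?nnegrE ?mulr_ge0 ?Nm_ge0// hu.
rewrite -(Nm_sum_cells E a h0 K (fun=> w)) -pproj_block// exprMn ler_wpM2l ?exprn_ge0//.
apply: lerXn2r; rewrite ?nnegrE ?Nm_ge0//; apply: Nm_pproj; exact: measurable_block.
Qed.

Variables (d : int) (v : nat -> H).

Let vprev m := if m is n.+1 then v n else 0.

Hypothesis Kv : forall m, fcalc E (fun t : R => t) (v m, ('i%C * pi%:C) *: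
  ((d + m%:Z - 1)%:~R *: vprev m - m.+1%:R *: v m.+1)).

Lemma imag_tauE (t : R) : imag_tau t = 'i%C * (pi^-1)%:C * t%:C.
Proof. by rewrite /imag_tau mulrC rmorphM/=; ring. Qed.

(* On spectral subspaces where K is nearly c, the vector v m is nearly
   p_m(c) v 0. *)
Lemma spectral_mp_aux (T : R) m : exists D : R, 0 <= D /\
  forall (B : set (measurableTypeR R)) (c e : R), measurable B -> `|c| <= T -> 0 <= e <= 1 ->
    (forall t, B t -> `|t - c| <= e) ->
  Nm (E B (v m - mp d (imag_tau c) m *: v 0)) <= e * D * Nm (E B (v 0)) /\
  Nm (E B (vprev m - mp_prev d (imag_tau c) m *: v 0)) <= e * D * Nm (E B (v 0)).
Proof.
have [k hk] := sum_mp_bound d T.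
have pi0 := pi_gt0 R.
elim: m => [|m [D [D0 IH]]].
  exists 0; split=> // B c e mB _ _ _; rewrite /mp /mp_prev/= scale1r scale0r !subrr.
  by rewrite pproj0// Nm0 mulr0 mul0r.
(* One term per summand of the recurrence: the error of v_(m-1), the deviation of K from c on v_m
   given by [id_near_cst], and |tau| times the error of v_m. T is arbitrary, so D' may be negative
   and enters by its absolute value. *)
pose D' := (absz (d + m%:Z - 1)%R)%:R * D + pi^-1 * (4 * (m.+1%:R ^+ k + D)) + T / pi * D.
exists (D + `|D'|); split; first by rewrite addr_ge0.
move=> B c e mB cT eI hB; have /andP[e0 e1] := eI.
have [h1 h2] := IH B c e mB cT eI hB.
have N0 := Nm_ge0 (E B (v 0)).
split; last first.
  rewrite mp_prevS /=; apply: le_trans h1 _.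
  by rewrite ler_wpM2r// ler_wpM2l// lerDl.
set tau := imag_tau c in h1 h2 *.
set X := v m - mp d tau m *: v 0 in h1; set Y := vprev m - mp_prev d tau m *: v 0 in h2.
pose y := ('i%C * pi%:C) *: ((d + m%:Z - 1)%:~R *: vprev m - m.+1%:R *: v m.+1).
have hK := id_near_cst (Kv m) mB hB e0; rewrite -/y in hK.
have vm : Nm (E B (v m)) <= (m.+1%:R ^+ k + D) * Nm (E B (v 0)).
  have -> : v m = X + mp d tau m *: v 0 by rewrite subrK.
  rewrite pprojD// pprojZ//; apply: le_trans (NmD _ _) _; rewrite NmZ addrC mulrDl.
  apply: lerD; first by rewrite ler_wpM2r// hk.
  by apply: le_trans h1 _; rewrite ler_wpM2r// ler_piMl.
have i2 : 'i%C * 'i%C = -1 :> C by rewrite -expr2 sqr_i.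
have pin : (pi%:C : C) != 0 by rewrite (inj_eq (@complexI _)) lt0r_neq0.
(* Difference of the recurrence for v, with K in place of t, and the one for p_m at t = c; y - c v_m
   is the only term where K enters. *)
have key : m.+1%:R *: (v m.+1 - mp d tau m.+1 *: v 0) =
   (d + m%:Z - 1)%:~R *: Y + ('i%C * (pi^-1)%:C) *: (y - c%:C *: v m) + tau *: X.
  have -> : ('i%C * (pi^-1)%:C) *: (y - c%:C *: v m) =
      m.+1%:R *: v m.+1 - (d + m%:Z - 1)%:~R *: vprev m - tau *: v m.
    rewrite scalerBr /y !scalerA -imag_tauE -/tau.
    have -> : 'i%C * (pi^-1)%:C * ('i%C * pi%:C) = -1 :> C.
      by rewrite mulrACA i2 -rmorphM/= mulVf ?lt0r_neq0// mulr1.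
    by rewrite scaleN1r opprB.
  rewrite scalerBr scalerA mp_rec /X /Y [_ *: (vprev m - _)]scalerBr.
  rewrite [tau *: (_ - _)]scalerBr !scalerA scalerDl.
  set p := (_ * mp_prev d tau m) *: v 0; set q := (tau * _) *: v 0.
  set A := _ *: vprev m; set B' := _ *: v m.+1; set Z := tau *: v m.
  rewrite -[RHS]addrA [_ - Z + _]addrA subrK addrACA opprD.
  by congr (_ + _); rewrite addrC subrK.
have m1 : 1 <= (m.+1%:R : R) by rewrite ler1n.
have m0 : 0 < (m.+1%:R : R) by rewrite ltr0n.
have pV : 0 <= pi^-1 :> R by rewrite invr_ge0 ltW.
set Z := v m.+1 - _ in key *.
have hZ : m.+1%:R * Nm (E B Z) <= e * D' * Nm (E B (v 0)).
  rewrite -[X in X * _]Nm_nat -NmZ -pprojZ// key !pprojD// !pprojZ//.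
  apply: le_trans (NmD _ _) _; apply: le_trans (lerD (NmD _ _) (lexx _)) _.
  rewrite !NmZ Nm_int NmM Nm_i mul1r NmR (ger0_norm pV).
  have -> : e * D' * Nm (E B (v 0)) =
      (absz (d + m%:Z - 1)%R)%:R * (e * D * Nm (E B (v 0))) +
      pi^-1 * (4 * e * ((m.+1%:R ^+ k + D) * Nm (E B (v 0)))) +
      T / pi * (e * D * Nm (E B (v 0))).
    by rewrite /D'; move: (pi^-1 : R) => q; ring.
  apply: lerD; first apply: lerD.
  - by rewrite ler_wpM2l.
  - apply: ler_wpM2l; first by rewrite invr_ge0 ltW.
    by apply: le_trans hK _; rewrite ler_wpM2l// mulr_ge0.
  - apply: ler_pM => //; rewrite ?Nm_ge0// /tau /imag_tau NmM Nm_i mul1r NmR.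
    by rewrite normrM normfV (ger0_norm (ltW pi0)) ler_wpM2r// invr_ge0 ltW.
apply: (@le_trans _ _ (m.+1%:R * Nm (E B Z))); first by rewrite ler_peMl// Nm_ge0.
apply: le_trans hZ _; rewrite ler_wpM2r// ler_wpM2l//.
by apply: le_trans (ler_norm _) _; rewrite lerDr.
Qed.

Lemma spectral_mp (T : R) m : exists2 D : R, 0 <= D &
  forall (B : set (measurableTypeR R)) (c e : R), measurable B -> `|c| <= T -> 0 <= e <= 1 ->
    (forall t, B t -> `|t - c| <= e) ->
  Nm (E B (v m - mp d (imag_tau c) m *: v 0)) <= e * D * Nm (E B (v 0)).
Proof.
have [D [D0 h]] := spectral_mp_aux T m; exists D => // B c e mB cT eI hB.
by have [] := h B c e mB cT eI hB.
Qed.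

(** On a cell around c, yN - exp(c/2) xN splits into spectral errors v_m - p_m(c) v_0 and a scalar
    multiple of v_0, the truncated [twist] sum. N makes the latter small, then the mesh the
    former. *)
Lemma expK_twist (f : C -> C) (x y : H) : test_function f -> supp f `<=` upper_circle ->
  \sum_(m < N) fhat f (- (d + m.*2%:Z)) *: v m @[N --> \oo] --> x ->
  \sum_(m < N) ('i%C ^ d * fhat f (d + m.*2%:Z)) *: v m @[N --> \oo] --> y ->
  fcalc E g (x, y).
Proof.
move=> tf sf /cvg_Nm hx /cvg_Nm hy.
apply: fcalc_riemann => [|t|n e e0]; [exact: measurable_expR_half|exact: expR_ge0|].
pose T : R := n%:R; pose A := expR (T / 2).
have A0 : 0 < A by rewrite expR_gt0.
have T0 : 0 <= T by rewrite ler0n.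
pose v0 := Nm (v 0); have v00 : 0 <= v0 := Nm_ge0 _.
have [Ct Ct0 hCt] := twist_sum_bound d T tf sf.
have [Cw Cw0 hCw] := twist_decay d 0 T tf.
(* The four quarters: truncation of x, divided by A because exp(c/2) multiplies it, truncation of y,
   the scalar sum and the spectral error. *)
have e4 : 0 < e / 4 by rewrite divr_gt0.
have [N1 h1] := hx _ (divr_gt0 e4 A0); have [N2 h2] := hy _ e4.
pose N3 := (Num.truncn (Ct * v0 / (e / 4))).+1.
pose N := maxn (maxn N1 N2) N3.
have {}h1 := h1 N (leq_trans (leq_maxl N1 N2) (leq_maxl _ _)).
have {}h2 := h2 N (leq_trans (leq_maxr N1 N2) (leq_maxl _ _)).
have h3 : Ct / N.+1%:R * v0 <= e / 4.
  have h : Ct * v0 / (e / 4) < N3%:R by exact: truncnS_gt.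
  have hN : (N3%:R : R) * (e / 4) <= N.+1%:R * (e / 4).
    by rewrite ler_pM2r// ler_nat (leq_trans (leq_maxr _ _) (leqnSn _)).
  rewrite mulrAC ler_pdivrMr ?ltr0n//; move: h; rewrite ltr_pdivrMr// => h.
  by rewrite [leRHS]mulrC; apply: le_trans hN; exact: ltW.
set xN := \sum_(m < N) _ in h1; set yN := \sum_(m < N) _ in h2.
have /choice[D hD] : forall m, exists D : R, 0 <= D /\
  forall (B : set (measurableTypeR R)) (c e : R), measurable B -> `|c| <= T -> 0 <= e <= 1 ->
    (forall t, B t -> `|t - c| <= e) ->
  Nm (E B (v m - mp d (imag_tau c) m *: v 0)) <= e * D * Nm (E B (v 0)).
  by move=> m; have [D D0 hD] := spectral_mp T m; exists D.
pose S := \sum_(m < N) Cw * D m.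
have S0 : 0 <= S by apply: sumr_ge0 => m _; rewrite mulr_ge0//; have [] := hD m.
(* The three demands on the mesh h = 1/M: oscillation of exp(t/2) on a cell at most e, spectral
   error at most e/4, and h <= 1. With 2nM cells the window is tiled exactly. *)
pose Q := A / e + S * v0 / (e / 4) + 1.
pose M := (Num.truncn Q).+1.
have QM : Q < M%:R by exact: truncnS_gt.
have M0 : 0 < M%:R :> R by rewrite ltr0n.
pose h : R := M%:R^-1.
have h0 : 0 < h by rewrite invr_gt0.
have q1 : 0 <= A / e by rewrite divr_ge0// ltW.
have q2 : 0 <= S * v0 / (e / 4) by rewrite divr_ge0 ?mulr_ge0// ltW.
have hM1 : h <= 1 by rewrite invf_le1// ltW// (le_lt_trans _ QM)// /Q; lra.
have hA : A * h <= e.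
  rewrite ler_pdivrMr// mulrC -ler_pdivrMr//; apply: ltW; apply: le_lt_trans QM.
  rewrite /Q; lra.
have hS : h * S * v0 <= e / 4.
  have : S * v0 / (e / 4) < M%:R by apply: le_lt_trans QM; rewrite /Q; lra.
  rewrite ltr_pdivrMr// => t; have -> : h * S * v0 = S * v0 / M%:R by rewrite /h; ring.
  by rewrite ler_pdivrMr// [leRHS]mulrC; exact: ltW.
pose a : R := - n%:R; pose cj (j : nat) : R := a + j%:R * h.
pose K := (n + n) * M.
have hK : K%:R * h = n%:R + n%:R.
  by rewrite /K natrM /h mulfK ?lt0r_neq0// natrD.
have cT j : (j < K)%N -> `|cj j| <= T /\ cj j + h <= T.
  move=> jK; have j1 : (j%:R + 1) * h <= n%:R + n%:R.
    by rewrite -hK ler_wpM2r ?(ltW h0)// natr1 ler_nat.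
  have j0 : 0 <= j%:R * h by rewrite mulr_ge0// ltW.
  rewrite ler_norml /cj /a /T; move: j1; rewrite mulrDl mul1r => j1.
  by clear - j0 j1 h0; split; [apply/andP; split|]; lra.
have cellP j t : cell a h j t -> cj j <= t /\ t < cj j + h.
  rewrite /cell /= in_itv/= => /andP[t1 t2]; split => //.
  by move: t2; rewrite /cj -natr1 mulrDl mul1r addrA.
have mc j := @measurable_cell R a h j.
exists h, K, (fun j => expR (cj j / 2)); split=> //; first exact: ltW.
  move=> j jK; split; first exact: expR_ge0.
  move=> t /cellP[t1 t2]; have [_ c2] := cT j jK.
  have tT : t <= T by rewrite ltW// (lt_le_trans t2).
  apply: le_trans (expR_half_lip (le_trans t1 tT) tT t1) _; apply: le_trans hA.
  by rewrite ler_wpM2l ?expR_ge0//; lra.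
have eA j : (j < K)%N -> expR (cj j / 2) <= A.
  move=> jK; rewrite ler_expR ler_wpM2r ?invr_ge0//.
  by have [c1 _] := cT j jK; apply: le_trans c1; exact: ler_norm.
have blk : block a h K = @window R n by rewrite /block hK /a addrA addNr add0r.
have -> : \sum_(j < K) (expR (cj j / 2))%:C *: E (cell a h j) x - E (@window R n) y =
    - \sum_(j < K) E (cell a h j) ((expR (cj j / 2))%:C *: (xN - x)) +
    (E (@window R n) (yN - y)
     - \sum_(j < K) E (cell a h j) (yN - (expR (cj j / 2))%:C *: xN)).
  rewrite -blk !(pproj_block _ _ (ltW h0)) -!sumrB -sumrN -big_split/=.
  apply: eq_bigr => j _; rewrite !pprojB// !pprojZ// !pprojB// scalerBr opprB.
  set X := _ *: E _ x; set Y := _ *: E _ xN; set U := E _ yN; set W := E _ y.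
  have -> : U - W - (U - Y) = Y - W by rewrite opprB addrC addrA subrK.
  by rewrite addrA subrK.
apply: le_trans (NmD _ _) _; rewrite NmN.
have b1 : Nm (\sum_(j < K) E (cell a h j) ((expR (cj j / 2))%:C *: (xN - x))) <= e / 4.
  apply: (@le_trans _ _ (A * Nm (xN - x))).
    apply: (@Nm_sum_cells_le a h K (fun j => (expR (cj j / 2))%:C *: (xN - x)));
      [exact: ltW|exact: ltW|].
    move=> j jK; rewrite pprojZ// NmZ NmR ger0_norm ?expR_ge0//.
    by rewrite ler_wpM2r ?Nm_ge0// eA.
  by move: h1; rewrite ler_pdivlMr// mulrC.
have b2 : Nm (E (@window R n) (yN - y)) <= e / 4.
  by apply: le_trans h2; apply: Nm_pproj; exact: measurable_window.
have b3 : Nm (\sum_(j < K) E (cell a h j) (yN - (expR (cj j / 2))%:C *: xN)) <= e / 4 + e / 4.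
  apply: (@le_trans _ _ ((h * S + Ct / N.+1%:R) * v0)); last first.
    by rewrite mulrDl lerD.
  apply: (@Nm_sum_cells_le a h K (fun j => yN - (expR (cj j / 2))%:C *: xN)).
  - exact: ltW.
  - by rewrite addr_ge0 ?divr_ge0// mulr_ge0// ltW.
  move=> j jK; have [c1 _] := cT j jK.
  have hB t : cell a h j t -> `|t - cj j| <= h.
    move=> /cellP[t1 t2]; rewrite ger0_norm ?subr_ge0// lerBlDl.
    exact: ltW.
  have hI : 0 <= h <= 1 by rewrite hM1 ltW.
  pose tw m := twist f d (cj j) m.
  have -> : yN - (expR (cj j / 2))%:C *: xN =
      \sum_(m < N) tw m *: (v m - mp d (imag_tau (cj j)) m *: v 0) +
      (\sum_(m < N) mp d (imag_tau (cj j)) m * tw m) *: v 0.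
    rewrite scaler_suml -big_split/= /xN /yN scaler_sumr -sumrB.
    apply: eq_bigr => m _; rewrite scalerBr !scalerA [tw m * _]mulrC subrK.
    by rewrite -scalerBl.
  rewrite pprojD// pproj_sum// pprojZ//.
  apply: le_trans (NmD _ _) _; rewrite mulrDl; apply: lerD; last first.
    by rewrite NmZ ler_wpM2r ?Nm_ge0//; exact: hCt.
  apply: le_trans (Nm_sum _ _ _) _.
  rewrite /S mulr_sumr mulr_suml; apply: ler_sum => m _.
  rewrite pprojZ// NmZ; have [D0 hDm] := hD m.
  have := hDm _ _ _ (mc j) c1 hI hB; have := hCw _ m c1; rewrite expr0 mulr1.
  move=> t1 t2; apply: le_trans (ler_pM (Nm_ge0 _) (Nm_ge0 _) t1 t2) _.
  by rewrite !mulrA [Cw * h]mulrC.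
apply: le_trans (lerD b1 (le_trans (NmB _ _) (lerD b2 b3))) _; lra.
Qed.

End exponential.

Theorem theorem5p4 (R : realType) (V : unitaryVOSA R) (H : completion V)
  (V_simple : simple_vosa V) (V_eb : energy_bounded V)
  (E : pvm H) (E_spectral : spectral_measure (opK H) E)
  (d : int) (a : V) (a_qp : quasi_primary d a)
  (f : R[i] -> R[i]) (f_test : test_function f)
  (f_supp : supp f `<=` upper_circle) :
  let expK2 := fcalc E (fun t : R => expR (t / 2)) in
  let Yvac g := app (smeared H d a g) (cinj H (vvac V)) in
  dom expK2 (Yvac f) /\
  app expK2 (Yvac f) = 'i%C ^ d *: Yvac (f \o conjc).
Proof.
move=> expK2 Yvac.
have [[_ a_hom] qa] := a_qp.
have rf : rapid f by move=> n; exact: fhat_decay.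
have rfc : rapid (f \o conjc).
  move=> n; have [D D0 hD] := rf n; exists D => // k.
  by rewrite fhat_conj// -abszN.
have [x xE hx] := smeared_vac H V_eb a_hom qa rf.
have [y yE hy] := smeared_vac H V_eb a_hom qa rfc.
have Kv m : fcalc E (fun t : R => t) (cinj H (desc a m), ('i%C * pi%:C) *:
    ((d + m%:Z - 1)%:~R *: (if m is n.+1 then cinj H (desc a n) else 0) -
     m.+1%:R *: cinj H (desc a m.+1))).
  (* The vectors T^m a lie in V, where the closure of L_1 - L_{-1} is given by its defining
     formula. *)
  rewrite -[fcalc _ _]E_spectral /opK /scale_op /=.
  exists (cinj H (vir 1 (desc a m) - vir (-1) (desc a m))).
    by apply: subset_closure; exists (desc a m).
  have cB u w : cinj H (u - w) = cinj H u - cinj H w by exact: linearB.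
  have cZ c u : cinj H (c *: u) = c *: cinj H u by exact: linearZ.
  rewrite (K_desc a_hom qa) cB !cZ; case: m => [|m] //=.
  by rewrite (linear0 (cinj H)).
(* Reflection negates Fourier indices, so the series of Y(a, f o j) Omega times i^d is the second
   series of [expK_twist]. *)
have main : expK2 (x, 'i%C ^ d *: y).
  apply: (expK_twist Kv f_test f_supp hx).
  move/cvg_Nm : hy => hy; apply/cvg_Nm => e /hy[N hN]; exists N => n /hN.
  have -> : \sum_(m < n) ('i%C ^ d * fhat f (d + m.*2%:Z)) *: cinj H (desc a m) - 'i%C ^ d *: y =
      'i%C ^ d *: (\sum_(m < n) fhat (f \o conjc) (- (d + m.*2%:Z)) *: cinj H (desc a m) - y).
    rewrite scalerBr scaler_sumr; congr (_ - _); apply: eq_bigr => m _.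
    by rewrite fhat_conj// opprK scalerA.
  by rewrite NmZ Nm_i_exp mul1r.
have -> : Yvac f = x by [].
have -> : Yvac (f \o conjc) = y by [].
split; first by exists ('i%C ^ d *: y).
by rewrite /app; apply: xget_unique => // z hz; exact: fcalc_expR_fun hz main.
Qed.
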